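(* Let $n,m$ be integers with $2n\le m\le 2^n$, let $\sigma>0$, and let $A\in\mathbb{R}^{m\times n}$ be a random matrix with i.i.d. entries from $N(0,\sigma^2)$, with rows $A_1,\dots,A_m$. There exists a (randomized) algorithm that takes a point $x_0\in\mathbb{R}^n$ as input and outputs a point $x\in\mathbb{Z}^n$, obtained by rounding each coordinate of $x_0$ either up or down, such that with probability at least $1-4/m^3$, for every $i\in[m]$, \[ |\langle A_i, x-x_0\rangle|\le 480\sigma\left(\sqrt{n\log\tfrac{m}{n}}+\sqrt{\log m\,\log(mn)\,\log\tfrac{m}{\log m}}\right). \] Moreover, the algorithm runs in expected time polynomial in $n$ and $m$.
   Context: The paper does not specify the base of $\log$. *)

(* Defs.v *)
From HB Require Import structures.
From mathcomp Require Export all_boot all_order all_algebra.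
From mathcomp Require Export all_classical all_reals all_analysis.
From mathcomp Require Export measurable_realfun.

Set Implicit Arguments.
Unset Strict Implicit.
Unset Printing Implicit Defensive.

Import Order.TTheory GRing.Theory Num.Theory.

Local Open Scope classical_set_scope.
Local Open Scope ring_scope.

(* Randomized algorithms on real inputs are programs of a real RAM: exact real
   arithmetic and comparisons, natural-number registers for counting and array
   addressing, and fair coin tosses, each command taking unit time.  There are
   no real constants, no integer multiplication or division, and no way to round
   a computed real: unit-cost versions of these would make polynomial time too
   generous a notion.  Expressions are part of the (fixed) program, so
   evaluating one costs O(1) elementary operations. *)

Inductive nexp : Type :=
| NConst of nat
| NReg of nat
| NAdd of nexp & nexp
| NSub of nexp & nexp.

(* RCell a i j reads the cell of indices i, j of the two-dimensional array a. *)
Inductive rexp : Type :=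
| RNat of nexp
| RCell of nat & nexp & nexp
| RAdd of rexp & rexp
| ROpp of rexp
| RMul of rexp & rexp
| RInv of rexp.

Inductive bexp : Type :=
| BLeN of nexp & nexp
| BLeR of rexp & rexp
| BNot of bexp
| BAnd of bexp & bexp.

(* CToss x stores the next fair coin toss, as 0 or 1, in the register x. *)
Inductive cmd : Type :=
| CSkip
| CSetN of nat & nexp
| CSetR of nat & nexp & nexp & rexp
| CToss of nat
| CSeq of cmd & cmd
| CIf of bexp & cmd & cmd
| CWhile of bexp & cmd.

Section Semantics.
Variable R : realType.

Record state := State {
  nreg : nat -> nat;
  cell : nat -> nat -> nat -> R;
  tossed : nat (* number of coins tossed so far *)
}.

Fixpoint neval (s : state) (e : nexp) : nat :=
  match e with
  | NConst k => k
  | NReg x => nreg s x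
  | NAdd e1 e2 => (neval s e1 + neval s e2)%N
  | NSub e1 e2 => (neval s e1 - neval s e2)%N
  end.

Fixpoint reval (s : state) (e : rexp) : R :=
  match e with
  | RNat k => (neval s k)%:R
  | RCell a i j => cell s a (neval s i) (neval s j)
  | RAdd e1 e2 => reval s e1 + reval s e2
  | ROpp e1 => - reval s e1
  | RMul e1 e2 => reval s e1 * reval s e2
  | RInv e1 => (reval s e1)^-1
  end.

Fixpoint beval (s : state) (b : bexp) : bool :=
  match b with
  | BLeN e1 e2 => (neval s e1 <= neval s e2)%N
  | BLeR e1 e2 => reval s e1 <= reval s e2
  | BNot b1 => ~~ beval s b1
  | BAnd b1 b2 => beval s b1 && beval s b2
  end.

Definition set_nreg (s : state) (x v : nat) : state :=
  State (fun y => if y == x then v else nreg s y) (cell s) (tossed s).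

Definition set_cell (s : state) (a i j : nat) (v : R) : state :=
  State (nreg s)
    (fun b k l => if [&& b == a, k == i & l == j] then v else cell s b k l)
    (tossed s).

Definition toss (coin : nat -> bool) (s : state) (x : nat) : state :=
  let s' := set_nreg s x (coin (tossed s)) in
  State (nreg s') (cell s') (tossed s).+1.

(* The commands that remain to be executed, and the current state. *)
Definition config : Type := (seq cmd * state)%type.

Definition step (coin : nat -> bool) (c : config) : config :=
  let: (k, s) := c in
  match k with
  | [::] => c
  | CSkip :: k' => (k', s)
  | CSetN x e :: k' => (k', set_nreg s x (neval s e))
  | CSetR a i j e :: k' =>
      (k', set_cell s a (neval s i) (neval s j) (reval s e))
  | CToss x :: k' => (k', toss coin s x)
  | CSeq c1 c2 :: k' => ([:: c1, c2 & k'], s)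
  | CIf b c1 c2 :: k' => ((if beval s b then c1 else c2) :: k', s)
  | CWhile b c1 :: k' =>
      if beval s b then ([:: c1, CWhile b c1 & k'], s) else (k', s)
  end.

Section Rounding.
Variables n m : nat.

Record instance := Instance {
  inst_sigma : R;
  inst_A : 'M[R]_(m, n);
  inst_x0 : 'cV[R]_n
}.

Definition mx_cells p q (M : 'M[R]_(p, q)) (i j : nat) : R :=
  match insub i, insub j with
  | Some i', Some j' => M i' j'
  | _, _ => 0
  end.

(* Registers 0 and 1 hold n and m; arrays 0, 1, 2, 3 hold A, x0, the integer
   parts of x0, and sigma; everything else is 0.  The integer parts are supplied
   because recovering them from x0 by arithmetic and comparisons takes a number
   of steps that is unbounded in terms of n and m. *)
Definition init (I : instance) : state :=
  State
    (fun x => if x == 0%N then n else if x == 1%N then m else 0%N)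
    (fun a => match a with
       | 0 => mx_cells (inst_A I)
       | 1 => mx_cells (inst_x0 I)
       | 2 => mx_cells (map_mx (fun t => (Num.floor t)%:~R) (inst_x0 I))
       | 3 => fun i j => if (i == 0%N) && (j == 0%N) then inst_sigma I else 0
       | _ => fun _ _ => 0
       end)
    0.

Definition run (prog : cmd) (I : instance) (coin : nat -> bool) (t : nat) :
    config :=
  iter t (step coin) ([:: prog], init I).

(* The output is read off the first column of array 4. *)
Definition output (s : state) : 'cV[R]_n := \col_(j < n) cell s 4 j 0.

Definition outputs (prog : cmd) (I : instance) (coin : nat -> bool)
    (x : 'cV[R]_n) : Prop :=
  exists t s, run prog I coin t = ([::], s) /\ output s = x.

(* +oo if the program does not halt *)
Definition running_time (prog : cmd) (I : instance) (coin : nat -> bool) :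
    \bar R :=
  ereal_inf [set t%:R%:E | t in [set t | (run prog I coin t).1 = [::]]].

Definition is_rounding (x0 x : 'cV[R]_n) : Prop :=
  forall j, x j 0 = (Num.floor (x0 j 0))%:~R \/
            x j 0 = (Num.ceil (x0 j 0))%:~R.

End Rounding.
End Semantics.

Section Independence.
Context (d : measure_display) (T : measurableType d) (R : realType).
Variable P : probability T R.

Definition mutually_independent (I : eqType) (F : I -> set (set T)) : Prop :=
  forall (s : seq I) (E : I -> set T),
    uniq s -> (forall i, i \in s -> F i (E i)) ->
    P (\big[setI/setT]_(i <- s) E i) = (\prod_(i <- s) P (E i))%E.

Definition sigma_of (d' : measure_display) (U : measurableType d')
    (X : {RV P >-> U}) : set (set T) :=
  preimage_set_system setT X measurable.

Definition fair (C : {RV P >-> bool}) : Prop :=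
  P (C @^-1` [set true]) = (2^-1)%:E.

Definition gaussian (mean sd : R) (X : {RV P >-> R}) : Prop :=
  forall B : set R, measurable B -> distribution P X B = normal_prob mean sd B.

End Independence.

Definition rounding_bound (R : realType) (n m : nat) (sigma : R) : R :=
  480 * sigma *
  (Num.sqrt (n%:R * ln (m%:R / n%:R)) +
   Num.sqrt (ln m%:R * ln (m%:R * n%:R) * ln (m%:R / ln m%:R))).

(* Main.v *)
(* Coordinates that are already integral stay; the others are fixed one at a time,
   in phases of lengths about r/2, r/4, ..., where r is the number of fractional
   columns left.  A phase starts from the discrepancy vector d and a threshold T
   and steers against the excess v of d over [-T, T]: while the budget
   4 l^2 sigma^2 < 25 |v|^2 lasts, the l-th column a is rounded up exactly when
   <v, a> <= 0, and afterwards columns are rounded down.  No coins are needed, the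
   Gaussian entries are random enough: each steered column moves the discrepancy by
   sigma / sqrt(2 pi) against v on average, and the fluctuation F of a phase has
   E exp<u, F> <= exp(2 sigma^2 r |u|^2).

   Writing exp(theta x^2) as a Gaussian mixture of exponentials turns this bound
   into E prod_i (1 + k exp(theta F_i^2)) <= (1 + 2k)^m, which controls
   sum_i (|F_i| - Delta)_+^2.  With T increasing by Delta = 16 sigma S (3/4)^j in
   phase j, S = ceil sqrt(n L) and L = ceil log2(m / n), the invariant
   |excess_T(d)|_2 <= sigma r / 8 survives a phase except with probability m^-4.
   Phases see disjoint sets of independent entries, so each one may be analysed for
   a fixed starting vector.  Once r <= sqrt n, rounding down is good enough, and
   T never exceeds 64 sigma S = O(sigma sqrt(n log(m / n))).  If
   log m <= 1024 log(m / n), rounding everything down already works, by a union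
   bound. *)

From HB Require Import structures.
From HB Require Import structures.
From mathcomp Require Import ring lra zify.
Require Import Defs.

Set Implicit Arguments.
Unset Strict Implicit.
Unset Printing Implicit Defensive.

Import Order.TTheory GRing.Theory Num.Theory.
Local Open Scope classical_set_scope.
Local Open Scope ring_scope.

(** * Measurability and expectations *)

Section MeasurablePredicates.
Context (d : measure_display) (T : measurableType d).

Lemma measurable_bool_set (b : T -> bool) :
  measurable_fun setT b -> measurable [set w | b w].
Proof. by move=> mb; rewrite -[X in measurable X]setTI; exact: (mb _ [set true]). Qed.

Lemma measurable_natr_bool (R : realType) (b : T -> bool) :
  measurable_fun setT b -> measurable_fun setT (fun w => (b w)%:R : R).
Proof.
move=> mb; rewrite (_ : (fun w => _) = (fun w => if b w then 1 else 0 : R)).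
  exact: measurable_fun_ifT.
by apply/funext => w; case: (b w).
Qed.

Lemma measurable_exists (I : finType) (b : I -> T -> bool) :
  (forall i, measurable_fun setT (b i)) ->
  measurable_fun setT (fun w => [exists i, b i w]).
Proof.
move=> mb; rewrite (_ : (fun w => _) = (fun w => has (b ^~ w) (enum I))); last first.
  apply/funext => w; apply/existsP/hasP => [[i biw]|[i _ biw]]; exists i => //.
  by rewrite mem_enum.
elim: (enum I) => [|i e IH] /=; first exact: measurable_cst.
exact: measurable_or.
Qed.

Lemma measurable_sum_seq (R : realType) (I : eqType) (s : seq I) (F : I -> T -> R) :
  (forall i, i \in s -> measurable_fun setT (F i)) ->
  measurable_fun setT (fun w => \sum_(i <- s) F i w).
Proof.
elim: s => [|i s IH] mF.
  by under eq_fun do rewrite big_nil; exact: measurable_cst.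
under eq_fun do rewrite big_cons.
apply: measurable_funD; first by apply: mF; rewrite mem_head.
by apply: IH => j js; apply: mF; rewrite inE js orbT.
Qed.

Lemma emeasurable_expR (R : realType) (f : T -> R) :
  measurable_fun setT f -> measurable_fun setT (fun w => (expR (f w))%:E).
Proof. by move=> mf; apply/measurable_EFinP; exact: measurableT_comp. Qed.

End MeasurablePredicates.

Section ProbabilityBounds.
Context (d : measure_display) (T : measurableType d) (R : realType).
Variable P : probability T R.

Lemma integral_natr_bool (b : T -> bool) : measurable_fun setT b ->
  (\int[P]_w (b w)%:R%:E = P [set w | b w])%E.
Proof.
move=> mb; rewrite -expectation_indic ?unlock; last exact: measurable_bool_set.
apply: eq_integral => w _; rewrite indicE; congr ((nat_of_bool _)%:R%:E).
by apply/idP/idP; rewrite inE.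
Qed.

Lemma integral_probability_cst (c : \bar R) : (\int[P]_w c = c)%E.
Proof. by rewrite integral_cst//= probability_setT mule1. Qed.

Lemma probability_le_mean (b : T -> bool) (f : T -> R) :
  measurable_fun setT b -> measurable_fun setT f ->
  (forall w, 0 <= f w) -> (forall w, b w -> 1 <= f w) ->
  (P [set w | b w] <= \int[P]_w (f w)%:E)%E.
Proof.
move=> mb mf f0 f1; rewrite -integral_natr_bool//; apply: ge0_le_integral => //.
- by apply/measurable_EFinP; exact: measurable_natr_bool.
- exact/measurable_EFinP.
- by move=> w _; rewrite lee_fin; case: (boolP (b w)) => [/f1|_].
Qed.

Lemma probability_exists_le (I : finType) (b : I -> T -> bool) :
  (forall i, measurable_fun setT (b i)) ->
  (P [set w | [exists i, b i w]] <= \sum_i P [set w | b i w])%E.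
Proof.
move=> mb; apply: le_trans
  (probability_le_mean (f := fun w => \sum_i (b i w)%:R) _ _ _ _) _.
- exact: measurable_exists.
- by apply: measurable_sum => i; exact: measurable_natr_bool.
- by move=> w; apply: sumr_ge0.
- move=> w /existsP[i biw]; rewrite (bigD1 i)//= biw lerDl.
  exact: sumr_ge0.
under eq_integral do rewrite -sumEFin.
rewrite ge0_integral_sum//; last first.
  by move=> i; apply/measurable_EFinP/measurable_natr_bool.
by apply: lee_sum => i _; rewrite integral_natr_bool.
Qed.

End ProbabilityBounds.

(** * Independent families *)

Section Decoupling.
Context (d : measure_display) (T : measurableType d) (R : realType).
Variables (P : probability T R) (I : finType) (X : I -> {RV P >-> R}).

Definition independent_family : Prop :=
  forall E : I -> set R, (forall i, measurable (E i)) ->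
  P (\big[setI/setT]_i (X i @^-1` E i)) = (\prod_i P (X i @^-1` E i))%E.

Definition cylinders (S : {set I}) : set (set T) :=
  [set A | exists E : I -> set R,
     [/\ forall i, measurable (E i), forall i, i \notin S -> E i = setT
       & A = \big[setI/setT]_i (X i @^-1` E i)]].

(* T with the sigma-algebra generated by the X i, i \in S. *)
Definition cylinder_space (S : {set I}) := g_sigma_algebraType (cylinders S).
HB.instance Definition _ S := Measurable.on (cylinder_space S).

Lemma setI_closed_cylinders S : setI_closed (cylinders S).
Proof.
move=> _ _ [E [mE ES ->]] [F [mF FS ->]]; exists (fun i => E i `&` F i); split.
- by move=> i; exact: measurableI.
- by move=> i iS; rewrite ES// FS// setTI.
- by rewrite -big_split/=; apply: eq_bigr => i _; rewrite preimage_setI.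
Qed.

Lemma cylindersT S : cylinders S setT.
Proof.
by exists (fun=> setT); split => //; rewrite big1// => i _; rewrite preimage_setT.
Qed.

Lemma cylinders_measurable S : cylinders S `<=` measurable.
Proof.
move=> _ [E [mE _ ->]]; apply: bigsetI_measurable => i _.
by rewrite -[X in measurable X]setTI; exact: measurable_funP.
Qed.

Lemma cylinder_space_measurable S (A : set T) :
  <<s cylinders S >> A -> measurable A.
Proof.
apply: (smallest_sub (sigma_algebra_measurable T)).
exact: cylinders_measurable.
Qed.

Lemma measurable_coordinate (S : {set I}) i : i \in S ->
  measurable_fun setT (X i : cylinder_space S -> R).
Proof.
move=> iS _ B mB; rewrite setTI; apply: sub_sigma_algebra.
exists (fun j => if j == i then B else setT); split.
- by move=> j; case: ifP.
- by move=> j jS; case: eqP => // ji; rewrite ji iS in jS.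
- rewrite (bigD1 i)//= eqxx big1 ?setIT// => j /negbTE ->.
  by rewrite preimage_setT.
Qed.

Lemma measurable_from_cylinder_space S d' (U : measurableType d') (f : T -> U) :
  measurable_fun setT (f : cylinder_space S -> U) -> measurable_fun setT f.
Proof.
move=> mf mT B mB; apply: (@cylinder_space_measurable S).
exact: (mf measurableT B mB).
Qed.

Definition coarsen S : T -> cylinder_space S := id.

Lemma measurable_coarsen S : measurable_fun setT (coarsen S).
Proof. by move=> mT B mB; rewrite setTI; exact: (@cylinder_space_measurable S). Qed.

HB.instance Definition _ S :=
  isMeasurableFun.Build _ _ _ _ (coarsen S) (@measurable_coarsen S).

Lemma integral_coarsen S (f : T -> \bar R) :
  measurable_fun setT (f : cylinder_space S -> \bar R) -> (forall w, 0 <= f w)%E ->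
  (\int[distribution P (coarsen S)]_w f w = \int[P]_w f w)%E.
Proof. by move=> mf f0; rewrite ge0_integral_distribution. Qed.

(* The sets independent of B form a Dynkin system. *)
Lemma independent_g_sigma_algebra (G : set (set T)) (B : set T) :
  G `<=` measurable -> setI_closed G -> G setT -> measurable B ->
  (forall A, G A -> P (A `&` B) = (P A * P B)%E) ->
  forall A, <<s G >> A -> P (A `&` B) = (P A * P B)%E.
Proof.
move=> Gm GI GT mB GB A sA.
have PB0 : 0 <= fine (P B) by rewrite fine_ge0.
have PBE : P B = (fine (P B))%:E by rewrite fineK// fin_num_measure.
have := @g_sigma_algebra_measure_unique _ R T G Gm (fun=> setT) (fun=> GT)
  _ (mrestr P mB) (mscale (NngNum PB0) P) GI.
move=> /(_ _ _ _ A sA); rewrite /= /mrestr /mscale/= -PBE muleC; apply.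
- by rewrite bigcup_const//; exists 0%N.
- by move=> C GC; rewrite GB// muleC.
- by move=> _; rewrite setTI; rewrite ltey_eq fin_num_measure.
Qed.

Hypothesis indepX : independent_family.

Lemma independent_cylinders (S1 S2 : {set I}) A B : [disjoint S1 & S2]%B ->
  cylinders S1 A -> cylinders S2 B -> P (A `&` B) = (P A * P B)%E.
Proof.
move=> dS [E [mE ES ->]] [F [mF FS ->]].
have -> : (\big[setI/setT]_i (X i @^-1` E i)) `&`
    (\big[setI/setT]_i (X i @^-1` F i)) =
    \big[setI/setT]_i (X i @^-1` (E i `&` F i)).
  by rewrite -big_split/=; apply: eq_bigr => i _; rewrite preimage_setI.
rewrite !indepX//; last by move=> i; exact: measurableI.
rewrite -big_split/=; apply: eq_bigr => i _.
have [iS|iS] := boolP (i \in S1).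
  by rewrite (FS i) ?setIT ?preimage_setT ?probability_setT ?mule1//
     (disjointFr dS).
by rewrite (ES i)// setTI preimage_setT probability_setT mul1e.
Qed.

Lemma independent_cylinder_spaces (S1 S2 : {set I}) A B : [disjoint S1 & S2]%B ->
  <<s cylinders S1 >> A -> <<s cylinders S2 >> B ->
  P (A `&` B) = (P A * P B)%E.
Proof.
move=> dS sA sB; apply: (@independent_g_sigma_algebra (cylinders S1)) => //.
- exact: cylinders_measurable.
- exact: setI_closed_cylinders.
- exact: cylindersT.
- exact: (@cylinder_space_measurable S2).
move=> {sA}A cA; rewrite setIC muleC.
apply: (@independent_g_sigma_algebra (cylinders S2)) => //.
- exact: cylinders_measurable.
- exact: setI_closed_cylinders.
- exact: cylindersT.
- exact: (@cylinders_measurable S1).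
by move=> C cC; rewrite setIC muleC; exact: independent_cylinders dS cA cC.
Qed.

Section TwoBlocks.
Variables S1 S2 : {set I}.
Hypothesis disjointS : [disjoint S1 & S2]%B.

Lemma measurable_section d' (U : measurableType d') (h : T -> T -> U) (w1 : T) :
  measurable_fun setT
    ((fun w => h w.1 w.2) : cylinder_space S1 * cylinder_space S2 -> U) ->
  measurable_fun setT (h w1 : cylinder_space S2 -> U).
Proof.
by move=> mh; exact: measurableT_comp mh (pair1_measurable (w1 : cylinder_space S1)).
Qed.

Section Kernel.
Variable h : T -> T -> \bar R.
Hypothesis mh : measurable_fun setT
  ((fun w => h w.1 w.2) : cylinder_space S1 * cylinder_space S2 -> \bar R).
Hypothesis h_ge0 : forall w1 w2, (0 <= h w1 w2)%E.

Lemma measurable_partial_integral : measurable_fun setT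
  ((fun w1 => \int[P]_w2 h w1 w2)%E : cylinder_space S1 -> \bar R).
Proof.
have := measurable_fun_fubini_tonelli_F (m2 := distribution P (coarsen S2))
  ((fun w => h w.1 w.2) : cylinder_space S1 * cylinder_space S2 -> \bar R)
  mh (fun w => h_ge0 _ _).
congr measurable_fun; apply/funext => w; rewrite /fubini_F/=.
by rewrite integral_coarsen//; exact: measurable_section.
Qed.

Lemma decoupling : (\int[P]_w h w w = \int[P]_w1 \int[P]_w2 h w1 w2)%E.
Proof.
pose T1 := cylinder_space S1; pose T2 := cylinder_space S2.
pose P1 := distribution P (coarsen S1); pose P2 := distribution P (coarsen S2).
pose diag : T -> (T1 * T2)%type := fun w => (coarsen S1 w, coarsen S2 w).
have mdiag : measurable_fun setT diag.
  by apply: measurable_fun_pair; exact: measurable_coarsen.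
pose Diag : {mfun T >-> (T1 * T2)%type} := HB.pack diag
  (isMeasurableFun.Build _ _ _ _ diag mdiag).
transitivity (\int[distribution P Diag]_w h w.1 w.2)%E.
  by rewrite ge0_integral_distribution.
transitivity (\int[(P1 \x P2)%E]_w h w.1 w.2)%E.
  apply: eq_measure_integral => A mA _; apply/esym.
  apply: product_measure_unique => // B C mB mC.
  exact: independent_cylinder_spaces disjointS mB mC.
rewrite fubini_tonelli1// -[RHS](@integral_coarsen S1).
- apply: eq_integral => w1 _; rewrite /fubini_F/= integral_coarsen//.
  exact: measurable_section.
- exact: measurable_partial_integral.
- by move=> w1; exact: integral_ge0.
Qed.

Lemma decoupling_le (c : \bar R) :
  (forall w1, \int[P]_w2 h w1 w2 <= c)%E -> (\int[P]_w h w w <= c)%E.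
Proof.
move=> hc; rewrite decoupling -[leRHS](integral_probability_cst P).
apply: ge0_le_integral => //.
- by move=> w1 _; exact: integral_ge0.
- exact: (measurable_from_cylinder_space measurable_partial_integral).
Qed.

End Kernel.

Lemma ge0_integral_independentM (f g : T -> \bar R) :
  measurable_fun setT (f : cylinder_space S1 -> \bar R) ->
  measurable_fun setT (g : cylinder_space S2 -> \bar R) ->
  (forall w, 0 <= f w)%E -> (forall w, 0 <= g w)%E ->
  (\int[P]_w (f w * g w) = \int[P]_w f w * \int[P]_w g w)%E.
Proof.
move=> mf mg f0 g0.
rewrite (decoupling (h := fun w1 w2 => f w1 * g w2)%E)//; last 2 first.
- apply: emeasurable_funM.
  + exact: (measurableT_comp mf measurable_fst).
  + exact: (measurableT_comp mg measurable_snd).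
- by move=> w1 w2; rewrite mule_ge0.
have mgT := measurable_from_cylinder_space mg.
under eq_integral do rewrite ge0_integralZl//.
rewrite ge0_integralZr//; first exact: (measurable_from_cylinder_space mf).
exact: integral_ge0.
Qed.

End TwoBlocks.

End Decoupling.

Lemma big_injective (V : Type) (idx : V) (op : Monoid.com_law idx)
    (K I : finType) (h : K -> I) (F : I -> V) :
  injective h -> (forall i, i \notin codom h -> F i = idx) ->
  \big[op/idx]_i F i = \big[op/idx]_k F (h k).
Proof.
move=> h_inj F_idx; rewrite (bigID (fun i => i \in codom h))/=.
rewrite [X in op _ X]big1 ?Monoid.mulm1//.
rewrite (eq_bigl (mem [set h k | k in K]%SET)) => [|i].
  by rewrite big_imset//; move=> ? ? _ _; exact: h_inj.
by apply/codomP/imsetP => [[k ->]|[k _ ->]]; exists k.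
Qed.

Lemma independent_subfamily d (T : measurableType d) (R : realType)
    (P : probability T R) (I K : finType) (X : I -> {RV P >-> R}) (h : K -> I) :
  independent_family X -> injective h -> independent_family (fun k => X (h k)).
Proof.
move=> indepX h_inj E mE.
pose E' i := if [pick k | h k == i] is Some k then E k else setT.
have E'h k : E' (h k) = E k.
  by rewrite /E'; case: pickP => [l /eqP/h_inj ->|/(_ k)/[!eqxx]].
have E'N i : i \notin codom h -> X i @^-1` E' i = setT.
  rewrite /E'; case: pickP => [k /eqP <-|]; first by rewrite codom_f.
  by rewrite preimage_setT.
have := indepX E'; rewrite !(big_injective _ h_inj)//.
- under eq_bigr do rewrite E'h; under [in RHS]eq_bigr do rewrite E'h.
  by apply => i; rewrite /E'; case: pickP.
- by move=> i /E'N ->; exact: probability_setT.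
Qed.

(** * Gaussian integrals *)

Section AffineChangeOfVariables.
Variable R : realType.
Notation mu := (@lebesgue_measure R).

Lemma lebesgue_measure_affine_itv (a b x y : R) : a != 0 -> x < y ->
  mu `]x, y] =
  (`|a|%:E * mu ((fun z => (a * z + b)%R) @^-1` `]x, y]))%E.
Proof.
move=> a0 xy; have [a_gt0|a_lt0] : a > 0 \/ a < 0 by case: ltgtP a0; auto.
- have -> : (fun z => a * z + b) @^-1` `]x, y]%classic =
      `](x - b) / a, (y - b) / a]%classic.
    apply/seteqP; split => z /=; rewrite !in_itv/= ltr_pdivrMr// ltrBlDr;
      by rewrite ler_pdivlMr// lerBrDr [z * a]mulrC.
  rewrite !lebesgue_measure_itv/= !lte_fin ltr_pM2r ?invr_gt0// ltrD2r xy.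
  by rewrite -!EFinB -EFinM gtr0_norm//; congr EFin; field.
- have -> : (fun z => a * z + b) @^-1` `]x, y]%classic =
      `[(y - b) / a, (x - b) / a[%classic.
    apply/seteqP; split => z /=; rewrite !in_itv/= ler_ndivrMr// lerBrDr;
      by rewrite ltr_ndivlMr// ltrBlDr [z * a]mulrC andbC.
  rewrite !lebesgue_measure_itv/= !lte_fin ltr_nM2r ?invr_lt0// ltrD2r xy.
  by rewrite -!EFinB -EFinM ltr0_norm//; congr EFin; field.
Qed.

Lemma ge0_integral_affine (a b : R) (f : R -> \bar R) : a != 0 ->
  measurable_fun setT f -> (forall x, 0 <= f x)%E ->
  (\int[mu]_x f x = `|a|%:E * \int[mu]_x f (a * x + b)%R)%E.
Proof.
move=> a0 mf f0.
pose phi : measurableTypeR R -> measurableTypeR R := fun x => a * x + b.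
have mphi : measurable_fun setT phi.
  by apply: measurable_funD => //; exact: mulrl_measurable.
pose phi_mu : {measure set _ -> \bar R} := pushforward mu phi.
pose nu := mscale (NngNum (normr_ge0 a)) (phi_mu mphi).
have muE (A : set R) : measurable A -> mu A = nu A.
  apply: lebesgue_measure_unique => _ [[x y] _ <-].
  change (mu `]x, y] = `|a|%:E * mu (phi @^-1` `]x, y]))%E.
  have [xy|yx] := ltP x y; first exact: lebesgue_measure_affine_itv.
  by rewrite set_itv_ge -?leNgt// preimage_set0 !measure0 mule0.
transitivity (\int[nu]_x f x)%E.
  by apply: eq_measure_integral => A mA _; exact: muE.
rewrite ge0_integral_mscale//=; congr (_ * _)%E.
by rewrite ge0_integral_pushforward.
Qed.

End AffineChangeOfVariables.

Section NormalIntegrals.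
Variable R : realType.
Notation mu := (@lebesgue_measure R).
Notation gauss := (normal_prob (0 : R) 1).
Implicit Types (f psi : R -> \bar R).

Lemma emeasurable_normal_pdf (m s : R) (D : set R) :
  measurable_fun D (fun x => (normal_pdf m s x)%:E).
Proof.
by apply: measurable_funTS; apply/measurable_EFinP; exact: measurable_normal_pdf.
Qed.

Lemma measurable_normal_pdf2 (s : R) d (U : measurableType d) (g h : U -> R) :
  s != 0 -> measurable_fun setT g -> measurable_fun setT h ->
  measurable_fun setT (fun x => (normal_pdf (g x) s (h x))%:E).
Proof.
move=> s0 mg mh.
rewrite (_ : (fun x => _) = (fun x => (normal_pdf 0 s (h x - g x))%:E)).
  exact: (measurableT_comp (@emeasurable_normal_pdf 0 s setT) (measurable_funB mh mg)).
by apply/funext => x; rewrite !normal_pdfE// /normal_fun subr0.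
Qed.

Lemma integral_normal_prob (m s : R) f :
  measurable_fun setT f -> (forall x, 0 <= f x)%E ->
  (\int[normal_prob m s]_x f x = \int[mu]_x (f x * (normal_pdf m s x)%:E))%E.
Proof.
move=> mf f0; have dom := normal_prob_dominates m s.
rewrite -(Radon_Nikodym_SigmaFinite.change_of_variables dom)//.
apply: ae_eq_integral => //.
- apply: emeasurable_funM => //.
  exact: measurable_int (Radon_Nikodym_SigmaFinite.f_integrable dom).
- by apply: emeasurable_funM => //; exact: emeasurable_normal_pdf.
apply: ae_eqe_mul2l; apply: integral_ae_eq => //.
- exact: Radon_Nikodym_SigmaFinite.f_integrable dom.
- exact: emeasurable_normal_pdf.
- by move=> A _ mA; rewrite -Radon_Nikodym_SigmaFinite.f_integral.
Qed.

Lemma normal_peakE (s : R) : normal_peak s = `|s|^-1 * normal_peak 1.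
Proof.
rewrite /normal_peak expr1n mul1r -mulrnAr sqrtrM ?sqr_ge0//.
by rewrite sqrtr_sqr invfM.
Qed.

Lemma normal_pdf_affine (m s z : R) : s != 0 ->
  `|s| * normal_pdf m s (s * z + m) = normal_pdf 0 1 z.
Proof.
move=> s0; rewrite !normal_pdfE ?oner_eq0// /normal_fun normal_peakE.
rewrite !mulrA divff ?normr_eq0// mul1r addrK subr0; congr (_ * expR _).
by field.
Qed.

Lemma integral_normal_prob_affine (m s : R) f : s != 0 ->
  measurable_fun setT f -> (forall x, 0 <= f x)%E ->
  (\int[normal_prob m s]_x f x = \int[gauss]_z f (m + s * z)%R)%E.
Proof.
move=> s0 mf f0; have maff : measurable_fun setT (fun z : R => m + s * z).
  by apply: measurable_funD => //; exact: mulrl_measurable.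
have mpdf := emeasurable_normal_pdf.
rewrite (integral_normal_prob m s mf f0).
rewrite (integral_normal_prob 0 1 (measurableT_comp mf maff) (fun=> f0 _)).
have pdf0 m' s' x : (0 <= (normal_pdf m' s' x)%:E)%E by rewrite lee_fin normal_pdf_ge0.
rewrite (ge0_integral_affine m s0); last 2 first.
- exact: emeasurable_funM.
- by move=> x; rewrite mule_ge0.
rewrite -ge0_integralZl//.
- by apply: eq_integral => z _; rewrite muleCA -EFinM normal_pdf_affine// [_ + m]addrC.
- apply: emeasurable_funM.
    by under eq_fun do rewrite addrC; exact: measurableT_comp mf maff.
  by apply: measurable_normal_pdf2 => //; under eq_fun do rewrite addrC.
- by move=> z _; rewrite mule_ge0.
Qed.

Lemma integral_normal_probN f :
  measurable_fun setT f -> (forall x, 0 <= f x)%E ->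
  (\int[gauss]_z f (- z)%R = \int[gauss]_z f z)%E.
Proof.
move=> mf f0; have mopp : measurable_fun setT (fun z : R => f (- z)).
  by apply: (measurableT_comp mf); exact: oppr_measurable.
rewrite (integral_normal_prob 0 1 mopp (fun=> f0 _)) (integral_normal_prob 0 1 mf f0).
rewrite [RHS](ge0_integral_affine 0 (_ : -1 != 0 :> R)).
- rewrite normrN1 mul1e; apply: eq_integral => z _.
  by rewrite mulN1r addr0 !normal_pdfE ?oner_eq0// /normal_fun !subr0 sqrrN.
- by rewrite oppr_eq0 oner_eq0.
- by apply: emeasurable_funM => //; exact: emeasurable_normal_pdf.
- by move=> x; rewrite mule_ge0// lee_fin normal_pdf_ge0.
Qed.

Lemma integral_normal_prob_scale_norm (a : R) f :
  measurable_fun setT f -> (forall x, 0 <= f x)%E ->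
  (\int[gauss]_z f (`|a| * z)%R = \int[gauss]_z f (a * z)%R)%E.
Proof.
move=> mf f0; have [a0|a0] := leP 0 a; first by rewrite ger0_norm.
rewrite ltr0_norm//; under eq_integral do rewrite mulNr -mulrN.
apply: (integral_normal_probN (f := fun z => f (a * z))) => //.
exact: (measurableT_comp mf (mulrl_measurable a)).
Qed.

(* The joint density factors through the marginal of a x + b z. *)
Lemma normal_pdf_convolve (a b x y : R) : b != 0 ->
  let w := Num.sqrt (a ^+ 2 + b ^+ 2) in
  normal_pdf (a * x) `|b| y * normal_pdf 0 1 x =
  normal_pdf 0 w y * normal_pdf (a * y / w ^+ 2) (`|b| / w) x.
Proof.
move=> b0 w; have ab0 : 0 < a ^+ 2 + b ^+ 2.
  by rewrite ltr_wpDl ?sqr_ge0// exprn_even_gt0.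
have w0 : 0 < w by rewrite sqrtr_gt0.
have w2 : w ^+ 2 = a ^+ 2 + b ^+ 2 by rewrite sqr_sqrtr ?ltW.
have nb0 : 0 < `|b| by rewrite normr_gt0.
rewrite !normal_pdfE ?oner_eq0 ?gt_eqF ?divr_gt0//.
rewrite mulrACA [RHS]mulrACA !(normal_peakE `|b|) (normal_peakE w).
rewrite (normal_peakE (_ / _)) normrM normrV ?unitfE ?gt_eqF// !normr_id.
rewrite (gtr0_norm w0); congr (_ * _).
  by field; rewrite !gt_eqF.
rewrite /normal_fun -!expRD; congr expR.
rewrite !expr_div_n w2 real_normK ?num_real//; field.
by rewrite b0 gt_eqF.
Qed.

Lemma integral_normal_pdf_convolve (a b y : R) : b != 0 ->
  (\int[mu]_x (normal_pdf (a * x)%R `|b|%R y * normal_pdf 0 1 x)%:E =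
   (normal_pdf 0 (Num.sqrt (a ^+ 2 + b ^+ 2))%R y)%:E)%E.
Proof.
move=> b0; under eq_integral do rewrite normal_pdf_convolve// EFinM.
rewrite ge0_integralZl//.
- by rewrite integral_normal_pdf mule1.
- exact: emeasurable_normal_pdf.
- by move=> x _; rewrite lee_fin normal_pdf_ge0.
- by rewrite lee_fin normal_pdf_ge0.
Qed.

Lemma integral_normal_prob_shift (c b : R) psi : b != 0 ->
  measurable_fun setT psi -> (forall x, 0 <= psi x)%E ->
  (\int[gauss]_z psi (c + b * z)%R = \int[mu]_y (psi y * (normal_pdf c `|b|%R y)%:E))%E.
Proof.
move=> b0 mpsi psi0; have nb0 : `|b| != 0 by rewrite normr_eq0.
have mshift : measurable_fun setT (fun t => psi (c + t)).
  by apply: (measurableT_comp mpsi); exact: measurable_funD.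
rewrite -(integral_normal_prob _ _ mpsi psi0).
rewrite (integral_normal_prob_affine _ nb0 mpsi psi0).
by rewrite (integral_normal_prob_scale_norm b mshift (fun=> psi0 _)).
Qed.

(* A linear combination of independent standard Gaussians is Gaussian. *)
Lemma integral_normal_prob_lincomb (a b : R) psi :
  measurable_fun setT psi -> (forall x, 0 <= psi x)%E ->
  (\int[gauss]_x \int[gauss]_z psi (a * x + b * z)%R =
   \int[gauss]_y psi (Num.sqrt (a ^+ 2 + b ^+ 2) * y)%R)%E.
Proof.
move=> mpsi psi0; have [->|b0] := eqVneq b 0.
  rewrite expr0n addr0 sqrtr_sqr integral_normal_prob_scale_norm//.
  by apply: eq_integral => x _; under eq_integral do rewrite mul0r addr0;
    exact: integral_probability_cst.
set w := Num.sqrt _; have w0 : w != 0.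
  by rewrite gt_eqF// sqrtr_gt0 ltr_wpDl ?sqr_ge0// exprn_even_gt0.
have pdf0 m s x : (0 <= (normal_pdf m s x)%:E)%E by rewrite lee_fin normal_pdf_ge0.
pose T := (measurableTypeR R * measurableTypeR R)%type.
pose shifted (xy : T) : \bar R := (psi xy.2 * (normal_pdf (a * xy.1) `|b| xy.2)%:E)%E.
pose joint (xy : T) : \bar R := (shifted xy * (normal_pdf 0 1 xy.1)%:E)%E.
have mshifted : measurable_fun setT shifted.
  apply: emeasurable_funM; first exact: (measurableT_comp mpsi measurable_snd).
  by apply: measurable_normal_pdf2; [rewrite normr_eq0|exact: measurable_funM|].
have mpdf := @emeasurable_normal_pdf 0 1 setT.
have mjoint : measurable_fun setT joint.
  by apply: emeasurable_funM => //; exact: (measurableT_comp mpdf measurable_fst).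
have shifted0 xy : (0 <= shifted xy)%E by rewrite mule_ge0.
have joint0 xy : (0 <= joint xy)%E by rewrite mule_ge0.
transitivity (\int[mu]_x \int[mu]_y joint (x, y))%E.
  under eq_integral do rewrite integral_normal_prob_shift//.
  rewrite (integral_normal_prob 0 1 (f := fun x => \int[mu]_y shifted (x, y))%E).
  - apply: eq_integral => x _; rewrite -ge0_integralZr//.
    exact: measurableT_comp mshifted (pair1_measurable x).
  - exact: (measurable_fun_fubini_tonelli_F (m2 := mu) shifted).
  - by move=> x; exact: integral_ge0.
rewrite (fubini_tonelli joint mjoint joint0).
under [RHS]eq_integral do rewrite -[(_ * _)%R]add0r.
rewrite (integral_normal_prob_shift 0 w0 mpsi psi0) (ger0_norm (sqrtr_ge0 _)).
apply: eq_integral => y _; rewrite /joint /shifted/=.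
under eq_integral do rewrite -muleA -EFinM.
rewrite ge0_integralZl//; first by rewrite integral_normal_pdf_convolve.
- under eq_fun do rewrite EFinM; apply: emeasurable_funM => //.
  by apply: measurable_normal_pdf2; [rewrite normr_eq0|exact: measurable_funM|].
- by move=> x _; rewrite lee_fin mulr_ge0 ?normal_pdf_ge0.
Qed.

Lemma normal_pdf_tilt (s u x : R) : s != 0 ->
  expR (u * x) * normal_pdf 0 s x =
  expR (s ^+ 2 * u ^+ 2 / 2) * normal_pdf (s ^+ 2 * u) s x.
Proof.
move=> s0; rewrite !normal_pdfE// /normal_fun.
rewrite !(mulrCA _ (normal_peak s)) -!expRD; congr (_ * expR _).
by field.
Qed.

Lemma integral_normal_prob_tilt (s u : R) f : s != 0 ->
  measurable_fun setT f -> (forall x, 0 <= f x)%E ->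
  (\int[normal_prob 0 s]_x (f x * (expR (u * x))%:E) =
   (expR (s ^+ 2 * u ^+ 2 / 2))%:E * \int[normal_prob (s ^+ 2 * u)%R s]_x f x)%E.
Proof.
move=> s0 mf f0; have mexp := emeasurable_expR (mulrl_measurable u).
have mpdf := emeasurable_normal_pdf.
rewrite (integral_normal_prob 0)//; last 2 first.
- exact: emeasurable_funM.
- by move=> x; rewrite mule_ge0// lee_fin expR_ge0.
rewrite (integral_normal_prob _ s mf f0) -ge0_integralZl//.
- by apply: eq_integral => x _; rewrite -muleA -EFinM normal_pdf_tilt// EFinM muleCA.
- by apply: emeasurable_funM => //; exact: mpdf.
- by move=> x _; rewrite mule_ge0// lee_fin normal_pdf_ge0.
Qed.

Lemma integral_expR_normal (u : R) :
  (\int[gauss]_x (expR (u * x))%:E = (expR (u ^+ 2 / 2))%:E)%E.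
Proof.
under eq_integral do rewrite -[(expR _)%:E]mul1e.
rewrite (integral_normal_prob_tilt u (oner_neq0 R) (measurable_cst 1%E) (fun=> lee01)).
by rewrite expr1n mul1r integral_probability_cst mule1.
Qed.

Lemma integral_expR_sqr_normal (k : R) : k < 1 / 2 ->
  (\int[gauss]_x (expR (k * x ^+ 2))%:E = ((Num.sqrt (1 - 2 * k))^-1)%:E)%E.
Proof.
move=> k2; have k0 : 0 < 1 - 2 * k by lra.
set s := (Num.sqrt (1 - 2 * k))^-1; have s0 : 0 < s by rewrite invr_gt0 sqrtr_gt0.
have s2 : s ^+ 2 = (1 - 2 * k)^-1 by rewrite exprVn sqr_sqrtr// ltW.
have pdfE x : expR (k * x ^+ 2) * normal_pdf 0 1 x = s * normal_pdf 0 s x.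
  rewrite !normal_pdfE ?oner_eq0 ?gt_eqF// (normal_peakE s) (gtr0_norm s0) /normal_fun.
  rewrite mulrCA !mulrA divff ?mul1r ?gt_eqF// -mulrA -expRD subr0 s2.
  by congr (_ * expR _); field; rewrite gt_eqF.
rewrite integral_normal_prob//; last first.
  by apply: emeasurable_expR; apply: measurable_funM => //; exact: measurable_funX.
under eq_integral do rewrite -EFinM pdfE EFinM.
rewrite ge0_integralZl//.
- by rewrite integral_normal_pdf mule1.
- exact: emeasurable_normal_pdf.
- by move=> x _; rewrite lee_fin normal_pdf_ge0.
- by rewrite lee_fin ltW.
Qed.

End NormalIntegrals.

Section NormalTails.
Variable R : realType.
Notation mu := (@lebesgue_measure R).
Notation gauss := (normal_prob (0 : R) 1).
Notation peak := (normal_peak (1 : R)).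

Lemma normal_peak_bounds : 1 / 3 <= peak <= 1 / 2.
Proof.
have pi2 := pi_ge2 R; have pi4 : pi < 4 :> R.
  by have := pihalf_lt2 R; rewrite ltr_pdivrMr// -natrM.
rewrite /normal_peak expr1n !mul1r; set q := Num.sqrt _.
have q2 : q ^+ 2 = pi *+ 2 by rewrite sqr_sqrtr// mulrn_wge0// pi_ge0.
have q0 : 0 < q by rewrite sqrtr_gt0 mulrn_wgt0// pi_gt0.
rewrite !lef_pV2 ?posrE//.
by apply/andP; split; nra.
Qed.

Lemma normal_pdf01 (x : R) : normal_pdf 0 1 x = peak * expR (- x ^+ 2 / 2).
Proof. by rewrite normal_pdfE ?oner_eq0// /normal_fun subr0 expr1n. Qed.

Lemma normal_prob_oppr (A : set R) : measurable A ->
  gauss ((fun z => - z) @^-1` A) = gauss A.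
Proof.
move=> mA; have mAN : measurable ((fun z => - z) @^-1` A).
  by rewrite -[X in measurable X]setTI; exact: oppr_measurable.
rewrite -[X in gauss X]setIT -[in RHS](setIT A) -!integral_indic//.
rewrite -[RHS]integral_normal_probN//.
exact/measurable_EFinP/measurable_indic.
Qed.

Lemma normal_prob_half : (gauss `[0%R, +oo[ <= (1 / 2)%:E)%E.
Proof.
have -> : gauss `[0%R, +oo[ = gauss `]0%R, +oo[.
  rewrite -(@setU1itv _ _ _ _ false)// measureU//.
    by rewrite [X in (X + _)%E](_ : _ = 0%E) ?add0e//; exact: integral_set1.
  by apply/seteqP; split => // x [/= ->]; rewrite in_itv/= ltxx.
have negE : gauss `]-oo, 0%R[ = gauss `]0%R, +oo[.
  rewrite -normal_prob_oppr//; congr (gauss _); apply/seteqP.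
  by split => x /=; rewrite !in_itv/= andbT oppr_lt0.
have : (gauss `]0%R, +oo[ + gauss `]-oo, 0%R[ <= 1)%E.
  rewrite -measureU//; first by apply: probability_le1; exact: measurableU.
  apply/seteqP; split => // x [] /=; rewrite !in_itv/= andbT => x_gt0 x_lt0.
  by have := lt_trans x_gt0 x_lt0; rewrite ltxx.
rewrite negE; have : gauss `]0%R, +oo[ \is a fin_num by exact: fin_num_measure.
by case: (gauss _) => // r _; rewrite -EFinD !lee_fin; lra.
Qed.

Lemma onem_le_expR_sqr (t : R) : 0 <= t -> 1 - t <= expR (- t ^+ 2 / 2).
Proof.
move=> t0; have [t1|t1] := leP t 1; last by have := expR_ge0 (- t ^+ 2 / 2); lra.
by have := expR_ge1Dx (- t ^+ 2 / 2); nra.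
Qed.

Lemma normal_prob_itv_ge (t : R) : 0 <= t ->
  ((peak * (1 - t) * t)%:E <= gauss `[0%R, t[)%E.
Proof.
move=> t0; have peak0 := normal_peak_ge0 (1 : R).
apply: (@le_trans _ _ (\int[mu]_(x in `[0%R, t[) (peak * expR (- t ^+ 2 / 2))%:E)%E).
  rewrite integral_cst//= lebesgue_measure_itv/= lte_fin.
  case: ltP => [_|t_le0]; last by have -> : t = 0; [lra|rewrite mulr0 mule0].
  rewrite oppr0 adde0 -EFinM lee_fin ler_wpM2r// ler_wpM2l//.
  exact: onem_le_expR_sqr.
apply: ge0_le_integral => //.
- by move=> x _; rewrite lee_fin mulr_ge0 ?expR_ge0.
- exact: emeasurable_normal_pdf.
- move=> x /=; rewrite in_itv/= => /andP[x0 xt].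
  by rewrite lee_fin normal_pdf01 ler_wpM2l ?ler_expR//; nra.
Qed.

Lemma normal_prob_itv_le (t : R) : t <= 0 ->
  (gauss `[t, 0%R[ <= (peak * - t)%:E)%E.
Proof.
move=> t0; apply: (@le_trans _ _ (\int[mu]_(x in `[t, 0%R[) peak%:E)%E).
  apply: ge0_le_integral => //.
  - by move=> x _; rewrite lee_fin normal_pdf_ge0.
  - exact: emeasurable_normal_pdf.
  - by move=> x _; rewrite lee_fin normal_pdf_ub ?oner_eq0.
rewrite integral_cst//= lebesgue_measure_itv/= lte_fin.
case: ltP => [_|t_ge0]; first by rewrite add0e EFinM.
by have -> : t = 0; [lra|rewrite oppr0 mulr0 mule0].
Qed.

Definition tail_bound (t : R) : R := 1 / 2 - peak * t + peak * t ^+ 2.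

Lemma normal_prob_tail (t : R) : (gauss `[t, +oo[ <= (tail_bound t)%:E)%E.
Proof.
have split_itv (x y : R) : x <= y ->
    (gauss `[x, +oo[ = gauss `[x, y[ + gauss `[y, +oo[)%E.
  move=> xy; rewrite -measureU//; first by rewrite -itv_bndbnd_setU ?bnd_simp.
  apply/seteqP; split => // z [] /=; rewrite !in_itv/= andbT => /andP[_ zy] yz.
  by have := lt_le_trans zy yz; rewrite ltxx.
have [t0|/ltW t0] := leP 0 t.
  have -> : tail_bound t = 1 / 2 - peak * (1 - t) * t by rewrite /tail_bound; ring.
  rewrite EFinB leeBrDl//; apply: le_trans normal_prob_half.
  by rewrite (split_itv _ _ t0); apply: leeD2r; exact: normal_prob_itv_ge.
rewrite (split_itv _ _ t0).
apply: le_trans (leeD (normal_prob_itv_le t0) normal_prob_half) _.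
rewrite -EFinD lee_fin /tail_bound.
have := mulr_ge0 (normal_peak_ge0 (1 : R)) (sqr_ge0 t); lra.
Qed.

Lemma expR_le_invB (x : R) : x < 1 -> expR x <= (1 - x)^-1.
Proof.
move=> x1; rewrite -[expR x]invrK -expRN lef_pV2 ?posrE ?expR_gt0 ?subr_gt0//.
exact: expR_ge1Dx.
Qed.

Lemma expR_addN_le (z : R) : expR z + expR (- z) <= 2 * expR (2 * z ^+ 2).
Proof.
wlog z0 : z / 0 <= z.
  move=> IH; have [/IH//|/ltW zn] := leP 0 z.
  by have := IH (- z); rewrite oppr_ge0 opprK sqrrN addrC; apply.
have [z2|z2] := leP (z ^+ 2) (1 / 2); last first.
  have : expR z <= expR (2 * z ^+ 2) by rewrite ler_expR; nra.
  have : expR (- z) <= expR (2 * z ^+ 2) by rewrite ler_expR; nra.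
  lra.
have z1 : z < 1 by nra.
apply: (@le_trans _ _ (2 * (1 - z ^+ 2)^-1)).
  apply: le_trans (lerD (expR_le_invB z1) (expR_le_invB (_ : - z < 1))) _; first lra.
  rewrite le_eqVlt; apply/predU1P; left; field.
  by rewrite !gt_eqF//; nra.
rewrite ler_pM2l// -div1r ler_pdivrMr; last by lra.
have := expR_ge1Dx (2 * z ^+ 2); have := sqr_ge0 z; nra.
Qed.

Lemma expR_tail_bound_le (g x U : R) : 0 <= g <= 1 -> x ^+ 2 <= U ->
  expR (g ^+ 2 * U / 2) * tail_bound (g * x) <=
  1 / 2 * expR (U / 2 + 2 * peak * x ^+ 2 - peak * x) *
  expR (peak * (1 - 2 * g) * x).
Proof.
have /andP[peak_ge peak_le] := normal_peak_bounds.
move=> /andP[g0 g1] xU; have g2 : g ^+ 2 <= 1 by rewrite expr_le1.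
have x20 := sqr_ge0 x.
apply: (@le_trans _ _ (expR (g ^+ 2 * U / 2) *
    (1 / 2 * expR (2 * peak * ((g * x) ^+ 2 - g * x))))).
  apply: ler_wpM2l; first exact: expR_ge0.
  have := expR_ge1Dx (2 * peak * ((g * x) ^+ 2 - g * x)); rewrite /tail_bound; lra.
rewrite mulrCA -[leRHS]mulrA; apply: ler_wpM2l; first lra.
rewrite -!expRD ler_expR exprMn.
have gU : g ^+ 2 * U <= 1 * U by apply: ler_wpM2r; lra.
have gx : peak * (g ^+ 2 * x ^+ 2) <= peak * (1 * x ^+ 2).
  by apply: ler_wpM2l; [lra|apply: ler_wpM2r].
lra.
Qed.

(* With x = sigma <u, v> / |v|, the first summand is the contribution of the
   columns rounded down and the second that of the columns rounded up. *)
Lemma rounding_mgf_bound (f x U : R) : 0 <= f <= 1 -> x ^+ 2 <= U ->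
  expR (f ^+ 2 * U / 2) * tail_bound (f * x) +
  expR ((1 - f) ^+ 2 * U / 2) * tail_bound ((1 - f) * x)
  <= expR (2 * U - peak * x).
Proof.
have /andP[peak_ge peak_le] := normal_peak_bounds.
move=> f01 xU; have /andP[f0 f1] := f01; have x20 := sqr_ge0 x.
have f01' : 0 <= 1 - f <= 1 by lra.
apply: le_trans (lerD (expR_tail_bound_le f01 xU) (expR_tail_bound_le f01' xU)) _.
set z := peak * (1 - 2 * f) * x.
have -> : peak * (1 - 2 * (1 - f)) * x = - z by rewrite /z; ring.
rewrite -mulrDr.
apply: (@le_trans _ _ (1 / 2 * expR (U / 2 + 2 * peak * x ^+ 2 - peak * x) *
   (2 * expR (2 * z ^+ 2)))).
  by apply: ler_wpM2l; [rewrite mulr_ge0 ?expR_ge0//; lra|exact: expR_addN_le].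
rewrite mulrACA (_ : 1 / 2 * 2 = 1) ?mul1r; last by field.
rewrite -expRD ler_expR.
have z2_le : z ^+ 2 <= 1 / 4 * U.
  have -> : z ^+ 2 = (peak * (1 - 2 * f)) ^+ 2 * x ^+ 2 by rewrite /z; ring.
  apply: ler_pM => //; first exact: sqr_ge0.
  have : - (1 / 2) <= peak * (1 - 2 * f) <= 1 / 2 by apply/andP; split; nra.
  by move=> /andP[? ?]; nra.
have peak_x2 : peak * x ^+ 2 <= 1 / 2 * U by apply: ler_pM => //; lra.
lra.
Qed.

End NormalTails.

(** * Moments of one rounded column *)

Section NormalMean.
Variable R : realType.
Notation gauss := (normal_prob (0 : R) 1).
Implicit Types (psi : R -> \bar R).

Definition normal_mean psi (b V : R) : \bar R :=
  (\int[gauss]_z psi (b + Num.sqrt V * z)%R)%E.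

Lemma normal_mean_ge0 psi b V : (forall x, 0 <= psi x)%E ->
  (0 <= normal_mean psi b V)%E.
Proof. by move=> psi0; exact: integral_ge0. Qed.

Lemma normal_mean0 psi b : normal_mean psi b 0 = psi b.
Proof.
rewrite /normal_mean sqrtr0; under eq_integral do rewrite mul0r addr0.
exact: integral_probability_cst.
Qed.

Lemma measurable_normal_mean d (U : measurableType d) psi (g : U -> R) (V : R) :
  measurable_fun setT psi -> (forall x, 0 <= psi x)%E -> measurable_fun setT g ->
  measurable_fun setT (fun x => normal_mean psi (g x) V).
Proof.
move=> mpsi psi0 mg; apply: (measurable_fun_fubini_tonelli_F (m2 := gauss)
  (fun xz : U * measurableTypeR R => psi (g xz.1 + Num.sqrt V * xz.2))) => //.
apply: (measurableT_comp mpsi); apply: measurable_funD.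
  exact: (measurableT_comp mg measurable_fst).
by apply: measurable_funM.
Qed.

Lemma normal_mean_tilt psi (b u v V s : R) : 0 < s -> 0 <= V ->
  measurable_fun setT psi -> (forall x, 0 <= psi x)%E ->
  (\int[normal_prob 0%R s]_x (normal_mean psi (b + v * x) V * (expR (u * x))%:E) =
   (expR (s ^+ 2 * u ^+ 2 / 2))%:E *
   normal_mean psi (b + s ^+ 2 * u * v) (V + v ^+ 2 * s ^+ 2))%E.
Proof.
move=> s0 V0 mpsi psi0; have sn0 : s != 0 by rewrite gt_eqF.
have maff (a c : R) : measurable_fun setT (fun x : R => a + c * x).
  by apply: measurable_funD => //; exact: mulrl_measurable.
have mmean (a c : R) :
    measurable_fun setT (fun x : R => normal_mean psi (a + c * x) V).
  exact: measurable_normal_mean.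
have mean0 (a : R) : (0 <= normal_mean psi a V)%E by exact: normal_mean_ge0.
rewrite (integral_normal_prob_tilt u sn0 (mmean _ _) (fun=> mean0 _)).
rewrite (integral_normal_prob_affine _ sn0 (mmean _ _) (fun=> mean0 _)).
set a := b + s ^+ 2 * u * v; congr (_ * _)%E.
have mshift : measurable_fun setT (fun t : R => psi (a + t)).
  by apply: (measurableT_comp mpsi); exact: measurable_funD.
transitivity (\int[gauss]_x \int[gauss]_z
    psi (a + (v * s * x + Num.sqrt V * z))%R)%E.
  apply: eq_integral => x _; apply: eq_integral => z _; congr (psi _).
  by rewrite /a; ring.
rewrite (integral_normal_prob_lincomb _ _ mshift (fun=> psi0 _)).
by rewrite sqr_sqrtr// exprMn addrC.
Qed.

Lemma normal_mean_gt0_le (b V : R) : 0 < V ->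
  (normal_mean (fun z => ((0 < z)%R%:R : R)%:E) (- b) V <=
   (tail_bound (b / Num.sqrt V))%:E)%E.
Proof.
move=> V0; have sV0 : 0 < Num.sqrt V by rewrite sqrtr_gt0.
have mpos : measurable_fun setT (fun z : R => 0 < - b + Num.sqrt V * z).
  by apply: measurable_fun_ltr => //; exact: measurable_funD.
rewrite /normal_mean integral_natr_bool//; apply: le_trans (normal_prob_tail _).
apply: le_measure; rewrite ?inE//; first exact: measurable_bool_set.
move=> z /=; rewrite in_itv/= andbT ler_pdivrMr// mulrC addrC subr_gt0.
exact: ltW.
Qed.

Lemma normal_mean_le0_le (b V : R) : 0 < V ->
  (normal_mean (fun z => ((z <= 0)%R%:R : R)%:E) b V <=
   (tail_bound (b / Num.sqrt V))%:E)%E.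
Proof.
move=> V0; have sV0 : 0 < Num.sqrt V by rewrite sqrtr_gt0.
have mneg : measurable_fun setT (fun z : R => b + Num.sqrt V * z <= 0).
  by apply: measurable_fun_ler => //; exact: measurable_funD.
rewrite /normal_mean integral_natr_bool//; apply: le_trans (normal_prob_tail _).
rewrite -[leLHS]normal_prob_oppr; last exact: measurable_bool_set.
apply: le_measure; rewrite ?inE//.
  rewrite -[X in measurable X]setTI; apply: oppr_measurable => //.
  exact: measurable_bool_set.
by move=> z /=; rewrite in_itv/= andbT ler_pdivrMr// mulrN subr_le0 mulrC.
Qed.

End NormalMean.

Section Dot.
Context {R : realType} {I : finType}.
Implicit Types (u v : I -> R).

Definition dot u v : R := \sum_i u i * v i.

Lemma measurable_dot d (T : measurableType d) (u v : T -> I -> R) :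
  (forall i, measurable_fun setT (u ^~ i)) ->
  (forall i, measurable_fun setT (v ^~ i)) ->
  measurable_fun setT (fun w => dot (u w) (v w)).
Proof.
by move=> mu mv; apply: measurable_sum => i; exact: measurable_funM.
Qed.

Lemma dotZl (c : R) u v : dot (fun i => c * u i) v = c * dot u v.
Proof. by rewrite /dot mulr_sumr; apply: eq_bigr => i _; rewrite mulrA. Qed.

Lemma dotZr (c : R) u v : dot u (fun i => c * v i) = c * dot u v.
Proof. by rewrite /dot mulr_sumr; apply: eq_bigr => i _; rewrite mulrCA. Qed.

Lemma dotDr u v1 v2 : dot u (fun i => v1 i + v2 i) = dot u v1 + dot u v2.
Proof. by rewrite /dot -big_split; apply: eq_bigr => i _; rewrite mulrDr. Qed.

Lemma dot0l v : dot (fun=> 0) v = 0.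
Proof. by rewrite /dot big1// => i _; rewrite mul0r. Qed.

Lemma dot0r u : dot u (fun=> 0) = 0.
Proof. by rewrite /dot big1// => i _; rewrite mulr0. Qed.

Lemma dotC u v : dot u v = dot v u.
Proof. by apply: eq_bigr => i _; rewrite mulrC. Qed.

Lemma dot_with (c : R) u v i : u i = 0 ->
  dot [eta u with i |-> c] v = c * v i + dot u v.
Proof.
move=> ui0; rewrite /dot (bigD1 i)//= [in RHS](bigD1 i)//= eqxx ui0 mul0r add0r.
by congr (_ + _); apply: eq_bigr => j /negbTE ->.
Qed.

End Dot.

Notation sqnorm v := (dot v v).

Section SquaredNorm.
Context {R : realType} {I : finType}.
Implicit Types (u v : I -> R).

Lemma sqnorm_ge0 v : 0 <= sqnorm v.
Proof. by apply: sumr_ge0 => i _; rewrite -expr2 sqr_ge0. Qed.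

Lemma sqnorm_ge_sqr v i : v i ^+ 2 <= sqnorm v.
Proof.
rewrite /dot (bigD1 i)//= expr2 lerDl.
by apply: sumr_ge0 => j _; rewrite -expr2 sqr_ge0.
Qed.

Lemma sqnormZ (c : R) v : sqnorm (fun i => c * v i) = c ^+ 2 * sqnorm v.
Proof. by rewrite dotZl dotZr mulrA. Qed.

Lemma sqnorm_with (c : R) u i : u i = 0 ->
  sqnorm [eta u with i |-> c] = c ^+ 2 + sqnorm u.
Proof.
move=> ui0; rewrite dot_with//= eqxx -expr2 [dot u _]dotC dot_with//.
by rewrite ui0 mulr0 add0r.
Qed.

Lemma dot_CauchySchwarz u v : dot u v ^+ 2 <= sqnorm u * sqnorm v.
Proof.
have [v0|v0] := eqVneq (sqnorm v) 0.
  rewrite (_ : dot u v = 0) ?expr0n ?v0 ?mulr0//; apply: big1 => i _.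
  have : v i ^+ 2 <= 0 by rewrite -v0; exact: sqnorm_ge_sqr.
  by rewrite le_eqVlt sqrf_eq0 ltNge sqr_ge0 orbF => /eqP ->; rewrite mulr0.
have v_gt0 : 0 < sqnorm v by rewrite lt_neqAle eq_sym v0 sqnorm_ge0.
rewrite -subr_ge0 -(pmulr_rge0 _ v_gt0).
suff -> : sqnorm v * (sqnorm u * sqnorm v - dot u v ^+ 2) =
    sqnorm (fun i => sqnorm v * u i - dot u v * v i) by exact: sqnorm_ge0.
set K := dot u v; set V := sqnorm v.
transitivity (\sum_i (V ^+ 2 * (u i * u i) - 2 * V * K * (u i * v i) +
    K ^+ 2 * (v i * v i))); last by apply: eq_bigr => i _; ring.
rewrite !big_split/= sumrN -!mulr_sumr -!/(dot _ _) -/V -/K; ring.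
Qed.

End SquaredNorm.

Section GaussianFamily.
Context (d : measure_display) (T : measurableType d) (R : realType).
Variables (P : probability T R) (I : finType) (X : I -> {RV P >-> R}).
Variable sigma : R.
Hypotheses (sigma_gt0 : 0 < sigma) (indepX : independent_family X).
Hypothesis gaussX : forall i, gaussian 0 sigma (X i).
Notation peak := (normal_peak (1 : R)).

Lemma integral_gaussian i (psi : R -> \bar R) :
  measurable_fun setT psi -> (forall x, 0 <= psi x)%E ->
  (\int[P]_w psi (X i w) = \int[normal_prob 0%R sigma]_x psi x)%E.
Proof.
move=> mpsi psi0; pose Y : T -> measurableTypeR R := X i.
have mXi : measurable_fun setT (X i) by exact: measurable_funP.
have mY : measurable_fun setT Y by move=> mT B mB; exact: (mXi mT B mB).
pose law : {measure set measurableTypeR R -> \bar R} := pushforward P Y.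
transitivity (\int[law mY]_x psi x)%E; first by rewrite ge0_integral_pushforward.
by apply: eq_measure_integral => A mA _; exact: gaussX.
Qed.

Lemma integral_gaussian_normal_mean i (psi : R -> \bar R) (b u v V : R) :
  0 <= V -> measurable_fun setT psi -> (forall x, 0 <= psi x)%E ->
  (\int[P]_w (normal_mean psi (b + v * X i w) V * (expR (u * X i w))%:E) =
   (expR (sigma ^+ 2 * u ^+ 2 / 2))%:E *
   normal_mean psi (b + sigma ^+ 2 * u * v) (V + v ^+ 2 * sigma ^+ 2))%E.
Proof.
move=> V0 mpsi psi0; rewrite -normal_mean_tilt//.
apply: (integral_gaussian i (psi := fun x =>
  (normal_mean psi (b + v * x) V * (expR (u * x))%:E)%E)).
- apply: emeasurable_funM; last exact: (emeasurable_expR (mulrl_measurable u)).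
  by apply: measurable_normal_mean => //; exact: measurable_funD.
- by move=> x; rewrite mule_ge0 ?lee_fin ?expR_ge0//; exact: normal_mean_ge0.
Qed.

Lemma integral_tilt_cons i (s : seq I) (u v : I -> R) (psi : R -> \bar R) (b : R) :
  i \notin s -> measurable_fun setT psi -> (forall x, 0 <= psi x)%E ->
  (\int[P]_w (psi (b + \sum_(j <- i :: s) v j * X j w)%R *
     (expR (\sum_(j <- i :: s) u j * X j w))%:E) =
   \int[P]_w1 (\int[P]_w2 (psi ((b + v i * X i w1) + \sum_(j <- s) v j * X j w2)%R *
     (expR (\sum_(j <- s) u j * X j w2))%:E) * (expR (u i * X i w1))%:E))%E.
Proof.
move=> iNs mpsi psi0.
pose S1 := [set i]%SET; pose S2 := [set j in s]%SET.
have disjointS : [disjoint S1 & S2]%B by rewrite disjoints1 inE.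
pose h w1 w2 : \bar R := (psi ((b + v i * X i w1) + \sum_(j <- s) v j * X j w2)%R *
  (expR (\sum_(j <- s) u j * X j w2))%:E * (expR (u i * X i w1))%:E)%E.
have mh : measurable_fun setT ((fun w => h w.1 w.2) :
    cylinder_space X S1 * cylinder_space X S2 -> \bar R).
  have mXi : measurable_fun setT
      (fun w : cylinder_space X S1 * cylinder_space X S2 => X i w.1).
    apply: (measurableT_comp _ measurable_fst).
    by apply: measurable_coordinate; rewrite inE.
  have msum (c : I -> R) : measurable_fun setT
      (fun w : cylinder_space X S1 * cylinder_space X S2 =>
        \sum_(j <- s) c j * X j w.2).
    apply: measurable_sum_seq => j js; apply: measurable_funM => //.
    apply: (measurableT_comp _ measurable_snd).
    by apply: measurable_coordinate; rewrite inE.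
  apply: emeasurable_funM; first apply: emeasurable_funM.
  - apply: (measurableT_comp mpsi); apply: measurable_funD; last exact: msum.
    by apply: measurable_funD => //; apply: measurable_funM.
  - exact: emeasurable_expR.
  - by apply: emeasurable_expR; exact: measurable_funM.
have h0 w1 w2 : (0 <= h w1 w2)%E by rewrite !mule_ge0 ?lee_fin ?expR_ge0.
transitivity (\int[P]_w h w w)%E.
  apply: eq_integral => w _; rewrite /h !big_cons addrA -muleA -EFinM -expRD.
  by rewrite [u i * _ + _]addrC.
rewrite (decoupling indepX disjointS mh h0); apply: eq_integral => w1 _.
have mlin (c : I -> R) : measurable_fun setT (fun w => \sum_(j <- s) c j * X j w).
  by apply: measurable_sum => j; apply: measurable_funM.
rewrite ge0_integralZr//.
- apply: emeasurable_funM; last exact/emeasurable_expR/mlin.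
  by apply: (measurableT_comp mpsi); exact: measurable_funD.
- by move=> w2 _; rewrite mule_ge0 ?lee_fin ?expR_ge0.
Qed.

Lemma gaussian_tilt (s : seq I) (u v : I -> R) (psi : R -> \bar R) (b : R) :
  uniq s -> measurable_fun setT psi -> (forall x, 0 <= psi x)%E ->
  (\int[P]_w (psi (b + \sum_(i <- s) v i * X i w)%R *
     (expR (\sum_(i <- s) u i * X i w))%:E) =
   (expR (sigma ^+ 2 * (\sum_(i <- s) u i * u i) / 2))%:E *
   normal_mean psi (b + sigma ^+ 2 * \sum_(i <- s) u i * v i)
     (sigma ^+ 2 * \sum_(i <- s) v i * v i))%E.
Proof.
move=> + mpsi psi0; elim: s b => [b _|i s IH b /= /andP[iNs us]].
  under eq_integral do rewrite !big_nil.
  by rewrite !big_nil !mulr0 mul0r expR0 normal_mean0 integral_probability_cst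
    !addr0 mule1 mul1e.
rewrite integral_tilt_cons//.
under eq_integral => w _ do rewrite IH// -muleA addrAC.
have V0 : 0 <= sigma ^+ 2 * \sum_(j <- s) v j * v j.
  by rewrite mulr_ge0 ?sqr_ge0// sumr_ge0// => j _; rewrite -expr2 sqr_ge0.
have mmean : measurable_fun setT (fun w => (normal_mean psi
    (b + sigma ^+ 2 * (\sum_(j <- s) u j * v j) + v i * X i w)
    (sigma ^+ 2 * \sum_(j <- s) v j * v j) * (expR (u i * X i w))%:E)%E).
  apply: emeasurable_funM; last by apply: emeasurable_expR; exact: measurable_funM.
  apply: measurable_normal_mean => //; apply: measurable_funD => //.
  exact: measurable_funM.
rewrite ge0_integralZl//; last first.
  by move=> w _; rewrite mule_ge0 ?lee_fin ?expR_ge0//; exact: normal_mean_ge0.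
rewrite integral_gaussian_normal_mean// muleA -EFinM -expRD !big_cons.
congr ((expR _)%:E * normal_mean _ _ _)%E; ring.
Qed.

Lemma gaussian_mgf (u : I -> R) :
  (\int[P]_w (expR (dot u (X ^~ w)))%:E =
   (expR (sigma ^+ 2 * sqnorm u / 2))%:E)%E.
Proof.
have := gaussian_tilt u (fun=> 0) 0 (index_enum_uniq I)
  (measurable_cst (1%:E : \bar R)) (fun=> lee01).
under eq_integral do rewrite mul1e.
by rewrite /normal_mean integral_probability_cst mule1.
Qed.

Section HalfSpaces.
Variables (u v : I -> R).
Hypothesis v_gt0 : 0 < sqnorm v.
Notation x := (sigma * dot u v / Num.sqrt (sqnorm v)).

Lemma normalized_dotE (c : R) :
  sigma ^+ 2 * (c * dot u v) / Num.sqrt (sigma ^+ 2 * sqnorm v) = c * x.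
Proof.
rewrite sqrtrM ?sqr_ge0// sqrtr_sqr gtr0_norm//; field.
by rewrite !gt_eqF ?sqrtr_gt0.
Qed.

Lemma normalized_dot_sqr_le : x ^+ 2 <= sigma ^+ 2 * sqnorm u.
Proof.
rewrite expr_div_n (sqr_sqrtr (ltW v_gt0)) exprMn ler_pdivrMr// -[leRHS]mulrA.
by rewrite ler_pM2l ?exprn_gt0//; exact: dot_CauchySchwarz.
Qed.

Lemma half_space_tilt (c : R) (psi : R -> \bar R) :
  measurable_fun setT psi -> (forall x, 0 <= psi x)%E ->
  (\int[P]_w (psi (dot v (X ^~ w)) * (expR (c * dot u (X ^~ w)))%:E) =
   (expR (c ^+ 2 * (sigma ^+ 2 * sqnorm u) / 2))%:E *
   normal_mean psi (sigma ^+ 2 * (c * dot u v)) (sigma ^+ 2 * sqnorm v))%E.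
Proof.
move=> mpsi psi0.
have := gaussian_tilt (fun i => c * u i) v 0 (index_enum_uniq I) mpsi psi0.
rewrite -!/(dot _ _) sqnormZ dotZl add0r [sigma ^+ 2 * _]mulrCA => <-.
by apply: eq_integral => w _; rewrite add0r -!/(dot _ _) dotZl.
Qed.

Lemma positive_half_space_mgf (f : R) :
  (\int[P]_w ((0 < dot v (X ^~ w))%R%:R%:E * (expR (- f * dot u (X ^~ w)))%:E) <=
   (expR (f ^+ 2 * (sigma ^+ 2 * sqnorm u) / 2) * tail_bound (f * x))%:E)%E.
Proof.
rewrite (half_space_tilt (- f) (psi := fun z => ((0 < z)%R%:R)%:E))//; last first.
  apply/measurable_EFinP/measurable_natr_bool; exact: measurable_fun_ltr.
rewrite sqrrN mulNr mulrN EFinM; apply: lee_wpmul2l; first by rewrite lee_fin expR_ge0.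
by rewrite -normalized_dotE normal_mean_gt0_le// mulr_gt0// exprn_gt0.
Qed.

Lemma negative_half_space_mgf (f : R) :
  (\int[P]_w ((dot v (X ^~ w) <= 0)%R%:R%:E * (expR (f * dot u (X ^~ w)))%:E) <=
   (expR (f ^+ 2 * (sigma ^+ 2 * sqnorm u) / 2) * tail_bound (f * x))%:E)%E.
Proof.
rewrite (half_space_tilt f (psi := fun z => ((z <= 0)%R%:R)%:E))//; last first.
  apply/measurable_EFinP/measurable_natr_bool; exact: measurable_fun_ler.
rewrite EFinM; apply: lee_wpmul2l; first by rewrite lee_fin expR_ge0.
by rewrite -normalized_dotE normal_mean_le0_le// mulr_gt0// exprn_gt0.
Qed.

(* Rounding up exactly when <v, X> <= 0 pushes the column sum against v. *)
Lemma rounded_column_mgf (f : R) : 0 <= f <= 1 ->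
  (\int[P]_w (expR (((dot v (X ^~ w) <= 0)%R%:R - f) * dot u (X ^~ w)))%:E <=
   (expR (2 * (sigma ^+ 2 * sqnorm u) - peak * x))%:E)%E.
Proof.
move=> f01; have mexp (c : R) :
    measurable_fun setT (fun w => (expR (c * dot u (X ^~ w)))%:E).
  apply: emeasurable_expR; apply: measurable_funM => //.
  exact: measurable_dot.
under eq_integral => w _.
  rewrite (_ : (expR _)%:E =
    ((0 < dot v (X ^~ w))%R%:R%:E * (expR (- f * dot u (X ^~ w)))%:E +
     (dot v (X ^~ w) <= 0)%R%:R%:E * (expR ((1 - f) * dot u (X ^~ w)))%:E)%E).
    over.
  by case: leP => _; rewrite ?sub0r mul0e mul1e ?add0e ?adde0.
rewrite ge0_integralD//=.
- have := rounding_mgf_bound f01 normalized_dot_sqr_le; rewrite -lee_fin.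
  apply: le_trans; rewrite EFinD; apply: leeD.
    exact: positive_half_space_mgf.
  exact: negative_half_space_mgf.
- apply: emeasurable_funM => //; apply/measurable_EFinP/measurable_natr_bool.
  by apply: measurable_fun_ltr => //; apply: measurable_dot.
- apply: emeasurable_funM => //; apply/measurable_EFinP/measurable_natr_bool.
  by apply: measurable_fun_ler => //; apply: measurable_dot.
Qed.

End HalfSpaces.
End GaussianFamily.

(** * Subgaussian vectors *)

Section Excess.
Variable R : realType.

Definition excess (t x : R) : R :=
  if t < x then x - t else if x < - t then x + t else 0.

Lemma norm_excess (t x : R) : 0 <= t -> `|excess t x| = Num.max 0 (`|x| - t).
Proof.
move=> t0; rewrite /excess; case: ltP => [tx|xt].
  by rewrite !ger0_norm ?max_r//; lra.
case: ltP => [xNt|Ntx]; first by rewrite !ltr0_norm ?max_r; lra.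
by rewrite normr0 max_l// subr_le0 ler_norml Ntx.
Qed.

Lemma excess0 (x : R) : excess 0 x = x.
Proof.
by rewrite /excess oppr0 !addr0; case: ltgtP.
Qed.

Lemma norm_sub_excess (t x : R) : 0 <= t -> `|x - excess t x| <= t.
Proof.
move=> t0; rewrite /excess ler_norml; case: ltP => [tx|xt]; first lra.
by case: ltP => [xNt|Ntx]; lra.
Qed.

Lemma excess_sqr_le (t x : R) : 0 <= t ->
  excess t x ^+ 2 <= Num.max 0 (x ^+ 2 - t ^+ 2).
Proof.
move=> t0; rewrite le_max /excess; case: ltP => [tx|xt].
  by apply/orP; right; nra.
case: ltP => [xNt|Ntx]; first by apply/orP; right; nra.
by rewrite expr0n lexx.
Qed.

Lemma excess_shift (t D a b y : R) : 0 <= t -> 0 <= D -> `|a| <= t ->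
  excess (t + D) (a + b + y) ^+ 2 <= 2 * b ^+ 2 + 2 * excess D y ^+ 2.
Proof.
move=> t0 D0 at0.
have norm_le : `|excess (t + D) (a + b + y)| <= `|b| + `|excess D y|.
  rewrite !norm_excess ?addr_ge0// ge_max addr_ge0 ?le_max ?lexx//=.
  have := ler_normD (a + b) y; have := ler_normD a b.
  have : `|y| - D <= Num.max 0 (`|y| - D) by rewrite le_max lexx orbT.
  lra.
rewrite -(real_normK (num_real (excess _ _))) -(real_normK (num_real b)).
rewrite -[in leRHS](real_normK (num_real (excess _ _))).
have : `|excess (t + D) (a + b + y)| ^+ 2 <= (`|b| + `|excess D y|) ^+ 2.
  by rewrite ler_sqr ?nnegrE ?addr_ge0.
have := sqr_ge0 (`|b| - `|excess D y|); lra.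
Qed.

Lemma measurable_excess d (U : measurableType d) (t : R) (f : U -> R) :
  measurable_fun setT f -> measurable_fun setT (fun w => excess t (f w)).
Proof.
move=> mf; rewrite /excess; apply: measurable_fun_ifT => //.
- exact: measurable_fun_ltr.
- exact: measurable_funB.
- apply: measurable_fun_ifT => //; first exact: measurable_fun_ltr.
  exact: measurable_funD.
Qed.

Definition excess_vec (I : Type) (t : R) (v : I -> R) : I -> R :=
  fun i => excess t (v i).

End Excess.

Definition sup_exceeds {R : realType} {I : finType} (y : R) (D : I -> R) : bool :=
  [exists i, y < `|D i|].

Lemma sup_exceedsPn {R : realType} {I : finType} (y : R) (D : I -> R) :
  reflect (forall i, `|D i| <= y) (~~ sup_exceeds y D).
Proof.
rewrite /sup_exceeds negb_exists; apply: (iffP forallP) => D_le i.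
  by rewrite leNgt; exact: D_le.
by rewrite -leNgt.
Qed.

Lemma measurable_sup_exceeds {R : realType} {I : finType} d (U : measurableType d)
    (y : R) (D : U -> I -> R) : (forall i, measurable_fun setT (D ^~ i)) ->
  measurable_fun setT (fun w => sup_exceeds y (D w)).
Proof.
move=> mD; apply: measurable_exists => i; apply: measurable_fun_ltr => //.
by apply: measurableT_comp => //; exact: mD.
Qed.

Section SubgaussianVectors.
Context (d : measure_display) (T : measurableType d) (R : realType).
Variables (P : probability T R) (I : finType).
Notation gauss := (normal_prob (0 : R) 1).

Definition subgaussian (D : R) (G : T -> I -> R) : Prop :=
  (forall i, measurable_fun setT (G ^~ i)) /\
  forall u : I -> R,
    (\int[P]_w (expR (dot u (G w)))%:E <= (expR (D * sqnorm u))%:E)%E.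

Variables (D : R) (G : T -> I -> R).
Hypothesis subgaussianG : subgaussian D G.

Let mG i : measurable_fun setT (G ^~ i) := subgaussianG.1 i.

Lemma measurable_expR_dot (u : I -> R) :
  measurable_fun setT (fun w => expR (dot u (G w))).
Proof. by apply: measurableT_comp => //; exact: measurable_dot. Qed.

Section ExponentialSquares.
Variable theta : R.
Hypotheses (theta_ge0 : 0 <= theta) (theta_lt : 4 * (theta * D) < 1).
Notation gain := (Num.sqrt (1 - 4 * (theta * D)))^-1.

Definition expsqr_prod (k : R) (s : seq I) (w : T) : R :=
  \prod_(i <- s) (1 + k * expR (theta * G w i ^+ 2)).

Lemma expsqr_prod_ge0 k s w : 0 <= k -> 0 <= expsqr_prod k s w.
Proof.
by move=> k0; apply: prodr_ge0 => i _; rewrite addr_ge0// mulr_ge0 ?expR_ge0.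
Qed.

Lemma measurable_expsqr_prod k s : measurable_fun setT (expsqr_prod k s).
Proof.
apply: measurable_prod => i _; apply: measurable_funD => //.
apply: measurable_funM => //; apply: measurableT_comp => //.
by apply: measurable_funM => //; exact: measurable_funX.
Qed.

Lemma expR_sqr_mixture (x : R) :
  ((expR (theta * x ^+ 2))%:E =
   \int[gauss]_g (expR (Num.sqrt (2 * theta) * g * x))%:E)%E.
Proof.
under eq_integral do rewrite mulrAC.
rewrite integral_expR_normal exprMn sqr_sqrtr ?mulr_ge0//.
by congr (expR _)%:E; field.
Qed.

(* exp (theta x^2) is a Gaussian mixture of exp (a x), which reduces quadratic
   exponential moments to the linear ones. *)
Lemma integral_expsqr_mixture (f : T -> R) (u : I -> R) i :
  measurable_fun setT f -> (forall w, 0 <= f w) -> u i = 0 ->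
  let tilted w g := expR (dot [eta u with i |-> Num.sqrt (2 * theta) * g] (G w)) in
  measurable_fun setT (fun g : R => \int[P]_w (f w * tilted w g)%:E)%E /\
  (\int[P]_w (f w * expR (theta * G w i ^+ 2) * expR (dot u (G w)))%:E =
   \int[gauss]_g \int[P]_w (f w * tilted w g)%:E)%E.
Proof.
move=> mf f0 ui0 tilted.
have tiltedE w g : tilted w g =
    expR (Num.sqrt (2 * theta) * g * G w i) * expR (dot u (G w)).
  by rewrite /tilted dot_with// expRD.
pose h (wg : T * measurableTypeR R) := (f wg.1 * tilted wg.1 wg.2)%:E.
have mh : measurable_fun setT h.
  apply/measurable_EFinP; apply: measurable_funM; first exact: (measurableT_comp mf).
  under eq_fun do rewrite tiltedE; apply: measurable_funM.
    apply: measurableT_comp => //; apply: measurable_funM.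
      exact: measurable_funM.
    exact: (measurableT_comp (mG i)).
  exact: (measurableT_comp (measurable_expR_dot u)).
have h0 wg : (0 <= h wg)%E by rewrite lee_fin mulr_ge0 ?expR_ge0.
split; first exact: (measurable_fun_fubini_tonelli_G (m1 := P) h).
rewrite -(fubini_tonelli (m1 := P) (m2 := gauss) h mh h0).
apply: eq_integral => w _; rewrite mulrAC EFinM expR_sqr_mixture -ge0_integralZl//.
- by apply: eq_integral => g _; rewrite /h/= tiltedE -EFinM mulrAC mulrA.
- by apply: emeasurable_expR; apply: measurable_funM => //; apply: measurable_funM.
- by rewrite lee_fin mulr_ge0 ?expR_ge0.
Qed.

Lemma integral_expsqr_le (f : T -> R) (u : I -> R) i (B : R) :
  measurable_fun setT f -> (forall w, 0 <= f w) -> u i = 0 -> 0 <= B ->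
  (forall c, \int[P]_w (f w * expR (dot [eta u with i |-> c] (G w)))%:E <=
    (B * expR (D * sqnorm [eta u with i |-> c]))%:E)%E ->
  (\int[P]_w (f w * expR (theta * G w i ^+ 2) * expR (dot u (G w)))%:E <=
   (B * gain * expR (D * sqnorm u))%:E)%E.
Proof.
move=> mf f0 ui0 B0 f_le.
have [mtilted ->] := integral_expsqr_mixture mf f0 ui0.
have msqr : measurable_fun setT (fun g : R => (expR (2 * (theta * D) * g ^+ 2))%:E).
  by apply: emeasurable_expR; apply: measurable_funM => //; exact: measurable_funX.
apply: (@le_trans _ _ (\int[gauss]_g
    ((B * expR (D * sqnorm u))%:E * (expR (2 * (theta * D) * g ^+ 2))%:E))%E).
  apply: ge0_le_integral => //.
  - by move=> g _; apply: integral_ge0 => w _; rewrite lee_fin mulr_ge0 ?expR_ge0.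
  - exact: emeasurable_funM.
  - move=> g _; apply: le_trans (f_le _) _.
    rewrite -EFinM lee_fin -[leRHS]mulrA ler_wpM2l// -expRD ler_expR sqnorm_with//.
    rewrite exprMn sqr_sqrtr ?mulr_ge0// le_eqVlt; apply/predU1P; left; ring.
rewrite ge0_integralZl//; last by rewrite lee_fin mulr_ge0 ?expR_ge0.
rewrite integral_expR_sqr_normal; last by have := theta_lt; lra.
rewrite -EFinM lee_fin mulrAC.
by rewrite (_ : 2 * (2 * _) = 4 * (theta * D)) //; ring.
Qed.

Lemma expsqr_prod_mean (k : R) (s : seq I) (u : I -> R) :
  0 <= k -> uniq s -> (forall i, i \in s -> u i = 0) ->
  (\int[P]_w (expsqr_prod k s w * expR (dot u (G w)))%:E <=
   ((1 + k * gain) ^+ size s * expR (D * sqnorm u))%:E)%E.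
Proof.
move=> k0; elim: s u => [|i s IH] u /=.
  move=> _ _; rewrite mul1r; under eq_integral do rewrite /expsqr_prod big_nil mul1r.
  exact: subgaussianG.2.
move=> /andP[iNs us] u0; have ui0 : u i = 0 by rewrite u0 ?mem_head.
have {}u0 j : j \in s -> u j = 0 by move=> js; rewrite u0 ?inE ?js ?orbT.
have mprod := measurable_expsqr_prod k s.
have prod0 w := expsqr_prod_ge0 s w k0.
set B := (1 + k * gain) ^+ size s; have gain0 : 0 <= gain by rewrite invr_ge0.
have B0 : 0 <= B by rewrite exprn_ge0// addr_ge0// mulr_ge0.
have square_mean : (\int[P]_w (expsqr_prod k s w * expR (theta * G w i ^+ 2) *
    expR (dot u (G w)))%:E <= (B * gain * expR (D * sqnorm u))%:E)%E.
  apply: integral_expsqr_le => // c; apply: IH => // j js /=.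
  by rewrite (negbTE (memPn iNs _ js)) u0.
have consE w : (expsqr_prod k (i :: s) w * expR (dot u (G w)))%:E =
    ((expsqr_prod k s w * expR (dot u (G w)))%:E + k%:E *
     (expsqr_prod k s w * expR (theta * G w i ^+ 2) * expR (dot u (G w)))%:E)%E.
  by rewrite /expsqr_prod big_cons -EFinM -EFinD; congr EFin; ring.
under eq_integral do rewrite consE.
have mlin := measurable_expR_dot u.
have msquare : measurable_fun setT (fun w => (expsqr_prod k s w *
    expR (theta * G w i ^+ 2) * expR (dot u (G w)))%:E).
  apply/measurable_EFinP; apply: measurable_funM => //; apply: measurable_funM => //.
  apply: measurableT_comp => //; apply: measurable_funM => //.
  exact: measurable_funX.
have square0 w : (0 <= (expsqr_prod k s w * expR (theta * G w i ^+ 2) *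
    expR (dot u (G w)))%:E)%E.
  by rewrite lee_fin !mulr_ge0 ?expR_ge0.
rewrite ge0_integralD//; first last.
- by apply: emeasurable_funM.
- by move=> w _; rewrite mule_ge0// lee_fin.
- by apply/measurable_EFinP; exact: measurable_funM.
- by move=> w _; rewrite lee_fin mulr_ge0 ?expR_ge0.
rewrite ge0_integralZl//.
apply: le_trans (leeD (IH _ us u0) (lee_wpmul2l _ square_mean)) _.
  by rewrite lee_fin.
rewrite -EFinM -EFinD lee_fin exprS -/B le_eqVlt; apply/predU1P; left; ring.
Qed.

Lemma expR_sqr_excess_le (t x : R) : 0 <= t ->
  expR (theta * excess t x ^+ 2) <=
  1 + expR (- (theta * t ^+ 2)) * expR (theta * x ^+ 2).
Proof.
move=> t0; rewrite -expRD.
have := excess_sqr_le x t0; rewrite le_max => /orP[excess_le0|excess_le].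
  apply: (@le_trans _ _ 1); last by rewrite lerDl expR_ge0.
  by rewrite -expR0 ler_expR mulr_ge0_le0.
apply: (@le_trans _ _ (expR (- (theta * t ^+ 2) + theta * x ^+ 2))).
  by rewrite ler_expR addrC -mulrBr ler_wpM2l.
by rewrite lerDr.
Qed.

Lemma excess_sqnorm_tail (t B : R) : 0 <= t ->
  (P [set w | (B < sqnorm (excess_vec t (G w)))%R] <=
   (expR (gain * expR (- (theta * t ^+ 2)) * #|I|%:R - theta * B))%:E)%E.
Proof.
move=> t0; set k := expR (- (theta * t ^+ 2)); have k0 : 0 <= k by exact: expR_ge0.
have mprod := measurable_expsqr_prod k (enum I).
have prod0 w := expsqr_prod_ge0 (enum I) w k0.
have excess_le w : B < sqnorm (excess_vec t (G w)) ->
    1 <= expR (- (theta * B)) * expsqr_prod k (enum I) w.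
  move=> /ltW Bw; apply: (@le_trans _ _ (expR (- (theta * B)) *
      \prod_(i <- enum I) expR (theta * excess t (G w i) ^+ 2))).
    rewrite -expR_sum -expRD -[leLHS]expR0 ler_expR -mulr_sumr addrC subr_ge0.
    by rewrite ler_wpM2l// big_enum/=; under eq_bigr do rewrite expr2.
  apply: ler_wpM2l; first exact: expR_ge0.
  by apply: ler_prod => i _; rewrite expR_ge0/= expR_sqr_excess_le.
apply: le_trans (probability_le_mean P _ _ _ excess_le) _.
- apply: measurable_fun_ltr => //; apply: measurable_dot => i;
    exact: measurable_excess.
- exact: measurable_funM.
- by move=> w; rewrite mulr_ge0 ?expR_ge0.
under eq_integral do rewrite EFinM.
rewrite ge0_integralZl//; [|exact/measurable_EFinP|by move=> w _; rewrite lee_fin].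
have prod_le : (\int[P]_w (expsqr_prod k (enum I) w)%:E <=
    ((1 + k * gain) ^+ size (enum I))%:E)%E.
  have := expsqr_prod_mean (u := fun=> 0) k0 (enum_uniq I) (fun _ _ => erefl).
  rewrite dot0l mulr0 expR0 mulr1; congr (_ <= _)%E.
  by apply: eq_integral => w _; rewrite dot0l expR0 mulr1.
apply: le_trans (lee_wpmul2l _ prod_le) _; first by rewrite lee_fin expR_ge0.
rewrite -EFinM lee_fin -cardE [leRHS]expRD [leRHS]mulrC ler_wpM2l ?expR_ge0//.
rewrite expRM_natr lerXn2r ?nnegrE ?expR_ge0 ?addr_ge0 ?mulr_ge0 ?invr_ge0//.
by rewrite [gain * _]mulrC expR_ge1Dx.
Qed.

End ExponentialSquares.

Lemma subgaussian_coordinate (i : I) (c : R) :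
  (\int[P]_w (expR (c * G w i))%:E <= (expR (D * c ^+ 2))%:E)%E.
Proof.
have := subgaussianG.2 [eta (fun=> 0) with i |-> c].
rewrite sqnorm_with// dot0l addr0.
by under eq_integral do rewrite dot_with// dot0l addr0.
Qed.

Lemma subgaussian_sup_tail (y : R) : 0 < D -> 0 <= y ->
  (P [set w | sup_exceeds y (G w)] <=
   (2 * #|I|%:R * expR (- (y ^+ 2 / (4 * D))))%:E)%E.
Proof.
move=> D0 y0; pose c := y / (2 * D); have c0 : 0 <= c by rewrite divr_ge0// mulr_ge0// ltW.
pose signed (si : bool * I) w : R := (-1) ^+ si.1 * G w si.2.
have msigned si : measurable_fun setT (signed si) by exact: measurable_funM.
have tail si : (P [set w | (y < signed si w)%R] <= (expR (- (y ^+ 2 / (4 * D))))%:E)%E.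
  apply: le_trans (probability_le_mean P (f := fun w =>
      expR (- (c * y)) * expR (c * (-1) ^+ si.1 * G w si.2)) _ _ _ _) _.
  - exact: measurable_fun_ltr.
  - apply: measurable_funM => //; apply: measurableT_comp => //.
    exact: measurable_funM.
  - by move=> w; rewrite mulr_ge0 ?expR_ge0.
  - move=> w /ltW yw; rewrite -expRD -[leLHS]expR0 ler_expR addrC -mulrA -mulrBr.
    by rewrite mulr_ge0// subr_ge0.
  under eq_integral do rewrite EFinM.
  rewrite ge0_integralZl//; last by apply: emeasurable_expR; exact: measurable_funM.
  apply: le_trans (lee_wpmul2l _ (subgaussian_coordinate _ _)) _.
    by rewrite lee_fin expR_ge0.
  rewrite -EFinM lee_fin -expRD ler_expR exprMn sqrr_sign mulr1 /c.
  by rewrite le_eqVlt; apply/predU1P; left; field; rewrite gt_eqF.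
have -> : [set w | sup_exceeds y (G w)] = [set w | [exists si, y < signed si w]].
  apply/seteqP; split => w /= /existsP[].
    move=> i; rewrite ltr_normr => /orP[yG|yG]; apply/existsP.
      by exists (false, i); rewrite /signed mul1r.
    by exists (true, i); rewrite /signed mulN1r.
  move=> [[] i]; rewrite /signed ?mulN1r ?mul1r => yG; apply/existsP; exists i;
    by rewrite ltr_normr yG ?orbT.
apply: le_trans (probability_exists_le P _) _.
  by move=> si; exact: measurable_fun_ltr.
apply: le_trans (lee_sum _ (fun si _ => tail si)) _.
by rewrite sumEFin sumr_const lee_fin card_prod card_bool -natrM -[leLHS]mulr_natl.
Qed.

End SubgaussianVectors.

(** * The steered walk *)

Section Walk.
Variables (R : realType) (I : finType) (sigma : R).
Variables (scale : nat) (active : nat -> bool).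
Implicit Types (v : I -> R).

Definition within_budget v (p : nat) : bool :=
  (2 * sigma * p%:R) ^+ 2 < 25 * sqnorm v.

Definition steers v (p : nat) (a : I -> R) : bool := within_budget v p && (dot v a <= 0).

(* disc is the discrepancy of the columns rounded so far, dir the direction
   against which the current phase steers, thr the threshold T of the phase,
   remaining the number of columns left at its start, pos the position in it. *)
Record walk := Walk {
  disc : I -> R; dir : I -> R; thr : R; remaining : nat; pos : nat }.

Definition next_thr (t : R) : R := 3 / 4 * t + 16 * (sigma * scale%:R).

Definition move (s : walk) (y : I -> R) : walk :=
  Walk (fun i => disc s i + y i) (dir s) (thr s) (remaining s) (pos s).

Definition start_phase (s : walk) (r : nat) : walk :=
  let t := next_thr (thr s) in
  Walk (disc s) (fun i => if active r then excess t (disc s i) else 0) t r 0.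

Definition tick (s : walk) : walk :=
  if (remaining s <= (pos s).+1 + (pos s).+1)%N
  then start_phase s (remaining s - (pos s).+1)
  else Walk (disc s) (dir s) (thr s) (remaining s) (pos s).+1.

Definition column_error (s : walk) (f : R) (a : I -> R) : I -> R :=
  fun i => a i * ((steers (dir s) (pos s) a)%:R - f).

Definition advance (s : walk) (f : R) (a : I -> R) : walk :=
  tick (move s (column_error s f a)).

Lemma disc_advance s f a i :
  disc (advance s f a) i = disc s i + column_error s f a i.
Proof. by rewrite /advance /tick; case: ifP. Qed.

Definition walk0 (r : nat) : walk := Walk (fun=> 0) (fun=> 0) 0 r 0.

Lemma steers0 p a : steers (fun=> 0) p a = false.
Proof. by rewrite /steers /within_budget dot0l mulr0 ltNge sqr_ge0. Qed.

Lemma measurable_steers d (U : measurableType d) (v a : U -> I -> R) p :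
  (forall i, measurable_fun setT (v ^~ i)) ->
  (forall i, measurable_fun setT (a ^~ i)) ->
  measurable_fun setT (fun w => steers (v w) p (a w)).
Proof.
move=> mv ma; apply: measurable_and.
  by apply: measurable_fun_ltr => //; apply: measurable_funM => //; exact: measurable_dot.
by apply: measurable_fun_ler => //; exact: measurable_dot.
Qed.

Section Columns.
Variables (J : eqType) (f : J -> R).

Fixpoint block_sum (a : J -> I -> R) v (p : nat) (js : seq J) : I -> R :=
  if js is j :: js' then
    fun i => a j i * ((steers v p (a j))%:R - f j) + block_sum a v p.+1 js' i
  else fun=> 0.

Lemma measurable_block_sum d (U : measurableType d)
    (a : U -> J -> I -> R) (v : U -> I -> R) p js i :
  (forall i, measurable_fun setT (v ^~ i)) ->
  (forall j i, j \in js -> measurable_fun setT (fun w => a w j i)) ->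
  measurable_fun setT (fun w => block_sum (a w) (v w) p js i).
Proof.
move=> mv; elim: js p => [|j js IH] p ma /=; first exact: measurable_cst.
have maj i' : measurable_fun setT (fun w => a w j i') by apply: ma; rewrite mem_head.
apply: measurable_funD.
  apply: measurable_funM => //; apply: measurable_funB => //.
  by apply: measurable_natr_bool; exact: measurable_steers.
by apply: IH => j' i' jj; apply: ma; rewrite inE jj orbT.
Qed.

Lemma block_sum0 a p js i :
  block_sum a (fun=> 0) p js i = \sum_(j <- js) a j i * - f j.
Proof.
elim: js p => [|j js IH] p /=; first by rewrite big_nil.
by rewrite big_cons IH steers0 sub0r.
Qed.

Definition walk_cols (a : J -> I -> R) (s : walk) (js : seq J) : walk :=
  foldl (fun s j => advance s (f j) (a j)) s js.

Lemma walk_cols_phase a D v t r p js :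
  (0 < size js)%N -> (p + size js = uphalf r)%N ->
  walk_cols a (Walk D v t r p) js =
  start_phase (Walk (fun i => D i + block_sum a v p js i) v t r 0) r./2.
Proof.
elim: js D p => [//|j js IH] D p _ /= pj.
have rE : (r = r./2 + uphalf r)%N by lia.
rewrite {1}/advance /tick /move /column_error/=.
case: js IH pj => [|j' js] IH pj.
  rewrite (_ : (r <= p.+1 + p.+1)%N); last by move: pj; rewrite /=; lia.
  rewrite (_ : (r - p.+1 = r./2)%N); last by move: pj; rewrite /=; lia.
  by rewrite /start_phase/=; congr Walk; apply/funext => i; rewrite addr0.
rewrite (_ : (r <= p.+1 + p.+1)%N = false); last by move: pj; rewrite /=; lia.
rewrite IH//; last by move: pj; rewrite /=; lia.
by rewrite /start_phase/=; congr Walk; apply/funext => i; rewrite -addrA.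
Qed.

Lemma disc_walk_cols_inactive a D t r p js i :
  (forall r', (r' <= r)%N -> ~~ active r') ->
  disc (walk_cols a (Walk D (fun=> 0) t r p) js) i =
  D i + \sum_(j <- js) a j i * - f j.
Proof.
elim: js D t r p => [|j js IH] D t r p inactive /=; first by rewrite big_nil addr0.
rewrite {1}/advance /tick /move /column_error/= steers0 big_cons addrA.
case: ifP => _; last by rewrite IH// sub0r.
rewrite /start_phase/= (negbTE (inactive _ (leq_subr _ _))) IH ?sub0r// => r' r'_le.
by apply: inactive; apply: leq_trans r'_le (leq_subr _ _).
Qed.

Section Phases.
Variable js : seq J.

Definition rest (k : nat) : seq J := iter k (fun s => drop (uphalf (size s)) s) js.

Definition block (k : nat) : seq J := take (uphalf (size (rest k))) (rest k).

Definition thr_at (k : nat) : R := iter k next_thr 0.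

Fixpoint disc_at (a : J -> I -> R) (k : nat) : I -> R :=
  if k is k'.+1 then
    fun i => disc_at a k' i +
      block_sum a (excess_vec (thr_at k') (disc_at a k')) 0 (block k') i
  else fun=> 0.

Lemma size_rest k : size (rest k.+1) = (size (rest k))./2.
Proof. by rewrite {1}/rest iterS -/(rest k) size_drop; lia. Qed.

Lemma size_block k : size (block k) = uphalf (size (rest k)).
Proof. by rewrite size_takel//; lia. Qed.

Lemma mem_rest k : {subset rest k.+1 <= rest k}.
Proof. by move=> j; exact: mem_drop. Qed.

Lemma block_sub_rest k : {subset block k <= rest k}.
Proof. by move=> j; exact: mem_take. Qed.

Lemma rest_sub k : {subset rest k <= js}.
Proof. by elim: k => [|k IH] j // /mem_rest /IH. Qed.

Lemma size_rest_leq_sub k : (size (rest k) <= size js - k)%N.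
Proof. by elim: k => [|k IH]; [rewrite subn0|rewrite size_rest; lia]. Qed.

Lemma size_rest_expn2 k : (size (rest k) * 2 ^ k <= size js)%N.
Proof.
elim: k => [|k IH]; first by rewrite muln1.
apply: leq_trans IH; rewrite size_rest expnS mulnA leq_mul2r; apply/orP; right; lia.
Qed.

Hypothesis uniq_js : uniq js.

Lemma uniq_rest k : uniq (rest k).
Proof. by elim: k => //= k IH; rewrite drop_uniq. Qed.

Lemma block_notin_rest k j : j \in block k -> j \notin rest k.+1.
Proof.
have := uniq_rest k; rewrite -{1}(cat_take_drop (uphalf (size (rest k))) (rest k)).
rewrite cat_uniq => /and3P[_ /hasPn disjoint_rest _] jb.
by apply/negP => /disjoint_rest; rewrite jb.
Qed.

Lemma measurable_disc_at d (U : measurableType d) (a : U -> J -> I -> R) k i :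
  (forall j i, j \in js -> j \notin rest k -> measurable_fun setT (fun w => a w j i)) ->
  measurable_fun setT (fun w => disc_at (a w) k i).
Proof.
elim: k i => [|k IH] i ma /=; first exact: measurable_cst.
have {}IH i' : measurable_fun setT (fun w => disc_at (a w) k i').
  by apply: IH => j i'' jj jk; apply: ma => //; apply: contra jk => /mem_rest.
apply: measurable_funD => //; apply: measurable_block_sum.
  by move=> i'; exact: measurable_excess.
move=> j i' jb; apply: ma; last exact: block_notin_rest.
exact/rest_sub/block_sub_rest/jb.
Qed.

Hypothesis active0 : ~~ active 0.

Definition walk_at (a : J -> I -> R) (k : nat) : walk :=
  Walk (disc_at a k)
    (fun i => if active (size (rest k)) then excess (thr_at k) (disc_at a k i) else 0)
    (thr_at k) (size (rest k)) 0.

Lemma walk_cols_at a k : (forall l, (l < k)%N -> active (size (rest l))) ->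
  walk_cols a (walk0 (size js)) js = walk_cols a (walk_at a k) (rest k).
Proof.
elim: k => [|k IH] act.
  congr walk_cols; rewrite /walk0 /walk_at/=; congr Walk; apply/funext => i.
  by rewrite excess0 if_same.
rewrite IH; last by move=> l lk; apply: act; exact: ltnW.
have actk := act k (ltnSn k).
rewrite -{1}(cat_take_drop (uphalf (size (rest k))) (rest k)) /walk_cols foldl_cat.
rewrite -!/(walk_cols _ _ _) -/(block k) {1}/walk_at actk walk_cols_phase ?size_block//.
  by rewrite -size_rest.
by case: (size (rest k)) actk => [|r] actr; [case/negP: active0|rewrite uphalfE].
Qed.

Lemma disc_walk_cols a k i : (forall l, (l < k)%N -> active (size (rest l))) ->
  (forall r, (r <= size (rest k))%N -> ~~ active r) ->
  disc (walk_cols a (walk0 (size js)) js) i =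
  disc_at a k i + \sum_(j <- rest k) a j i * - f j.
Proof.
move=> act inactive; rewrite (walk_cols_at _ act) /walk_at.
by rewrite (negbTE (inactive _ (leqnn _))) disc_walk_cols_inactive.
Qed.

End Phases.
End Columns.
End Walk.

(** * One phase *)

Lemma count_iota_decreasing (q : pred nat) (k : nat) :
  (forall l l', (l <= l')%N -> q l' -> q l) ->
  let c := count q (iota 0 k) in
  (forall l, (l < c)%N -> q l) /\ ((c < k)%N -> ~~ q c).
Proof.
move=> q_decr; elim: k => [|k [q_below q_at]]; first by [].
rewrite -addn1 iotaD count_cat/= add0n addn0.
set c := count _ _ in q_below q_at *.
have ck : (c <= k)%N by rewrite /c -[leqRHS](size_iota 0 k) count_size.
have [qk|nqk] := boolP (q k).
  have -> : c = k.
    apply/eqP; rewrite eqn_leq ck/= leqNgt; apply/negP => /[dup] lt_ck /q_at/negP.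
    by apply; apply: q_decr qk; exact: ltnW.
  rewrite addn1 ltnn; split => // l; rewrite ltnS => lk.
  exact: q_decr qk.
rewrite addn0; split => // _; have [/q_at//|kc] := ltnP c k.
by rewrite (_ : c = k)//; apply/eqP; rewrite eqn_leq ck.
Qed.

Section SteeringBudget.
Variables (R : realType) (I : finType) (sigma : R).
Hypothesis sigma_gt0 : 0 < sigma.
Notation peak := (normal_peak (1 : R)).
Notation norm v := (Num.sqrt (sqnorm v)).
Implicit Types (v : I -> R).

Definition steps v (p k : nat) : nat := count (within_budget sigma v) (iota p k).

Definition drift v (k : nat) : I -> R :=
  fun i => peak * sigma * (steps v 0 k)%:R / norm v * v i.

Lemma within_budgetE v p : within_budget sigma v p = (2 * sigma * p%:R < 5 * norm v).
Proof.
have -> : within_budget sigma v p = ((2 * sigma * p%:R) ^+ 2 < (5 * norm v) ^+ 2).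
  by rewrite /within_budget [(5 * _) ^+ 2]exprMn sqr_sqrtr ?sqnorm_ge0// -natrX.
by rewrite ltr_pXn2r// nnegrE !mulr_ge0 ?sqrtr_ge0// ltW.
Qed.

Lemma steps_bounds v (k r : nat) : (r <= 2 * k)%N ->
  norm v <= sigma * r%:R / 8 ->
  5 * norm v <= 2 * sigma * (steps v 0 k)%:R <= 5 * norm v + 2 * sigma.
Proof.
move=> rk v_le.
have [|steers_below stops_at] := @count_iota_decreasing (within_budget sigma v) k.
  move=> l l' ll'; rewrite !within_budgetE; apply: le_lt_trans.
  by rewrite ler_pM2l ?mulr_gt0// ler_nat.
rewrite -/(steps v 0 k) in steers_below stops_at.
have steps_le : (steps v 0 k <= k)%N.
  by rewrite /steps -[leqRHS](size_iota 0 k) count_size.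
apply/andP; split.
  have [/stops_at|k_le] := ltnP (steps v 0 k) k; first by rewrite within_budgetE -leNgt.
  have : sigma * r%:R <= sigma * (2 * (steps v 0 k)%:R).
    by rewrite ler_pM2l// -natrM ler_nat; lia.
  have : 0 <= sigma * (steps v 0 k)%:R by rewrite mulr_ge0// ltW.
  lra.
case: (steps v 0 k) steers_below => [|l] steers_below.
  by rewrite mulr0 addr_ge0// mulr_ge0 ?sqrtr_ge0// ltW.
have := steers_below l (ltnSn l); rewrite within_budgetE => l_lt.
by rewrite -[l.+1%:R]natr1 mulrDr mulr1 lerD2r ltW.
Qed.

(* A steered column moves by sigma * peak against v / |v|, and peak lies in
   [1/3, 1/2], so 5 |v| / (2 sigma) columns cancel v up to |v| / 4. *)
Lemma sqnorm_sub_drift v (k r : nat) : (r <= 2 * k)%N ->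
  norm v <= sigma * r%:R / 8 ->
  sqnorm (fun i => v i - drift v k i) <= (norm v / 4 + sigma / 2) ^+ 2.
Proof.
move=> rk v_le; have /andP[steps_ge steps_le] := steps_bounds rk v_le.
have /andP[peak_ge peak_le] := normal_peak_bounds R.
have norm0 : 0 <= norm v by exact: sqrtr_ge0.
have norm2 : norm v ^+ 2 = sqnorm v by rewrite sqr_sqrtr// sqnorm_ge0.
set x := norm v in v_le steps_ge steps_le norm0 norm2 *.
set c : R := (steps v 0 k)%:R in steps_ge steps_le *.
have -> : sqnorm (fun i => v i - drift v k i) = ((1 - peak * sigma * c / x) * x) ^+ 2.
  rewrite exprMn norm2 -sqnormZ; apply: eq_bigr => i _.
  by rewrite /drift -/x -/c; ring.
have [x0|xn0] := eqVneq x 0; first by rewrite x0 mulr0 expr0n sqr_ge0.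
have -> : (1 - peak * sigma * c / x) * x = x - peak * (sigma * c) by field.
have drift_ge : peak * (5 * x) <= peak * (2 * sigma * c) by rewrite ler_wpM2l//; lra.
have drift_le : peak * (2 * sigma * c) <= peak * (5 * x + 2 * sigma).
  by rewrite ler_wpM2l//; lra.
have peak_x_ge : 1 / 3 * x <= peak * x by exact: ler_wpM2r.
have peak_x_le : peak * x <= 1 / 2 * x by exact: ler_wpM2r.
have peak_sigma : peak * sigma <= 1 / 2 * sigma by rewrite ler_wpM2r// ltW.
rewrite -subr_ge0 subr_sqr mulr_ge0//; lra.
Qed.

Lemma excess_vec_shrinks (D B : I -> R) (t Dl : R) (k r : nat) :
  (r <= 2 * k)%N -> (100 <= r)%N -> 0 <= t -> 0 <= Dl ->
  let v := excess_vec t D in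
  sqnorm v <= (sigma * r%:R / 8) ^+ 2 ->
  sqnorm (excess_vec Dl (fun i => B i + drift v k i)) <= (sigma * r%:R / 64) ^+ 2 ->
  sqnorm (excess_vec (t + Dl) (fun i => D i + B i)) <= (sigma * r./2%:R / 8) ^+ 2.
Proof.
move=> rk r100 t0 Dl0 v v_le noise_le.
have sigma0 := ltW sigma_gt0; have r1 : 100 <= r%:R :> R by rewrite ler_nat.
have sr0 : 0 <= sigma * r%:R / 8 by rewrite !mulr_ge0// ltW.
have norm_le : norm v <= sigma * r%:R / 8.
  by rewrite -(ler_pXn2r (n := 2))// ?nnegrE ?sqrtr_ge0// sqr_sqrtr// sqnorm_ge0.
have rest_le := sqnorm_sub_drift rk norm_le.
have norm0 : 0 <= norm v by exact: sqrtr_ge0.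
apply: (@le_trans _ _ (2 * sqnorm (fun i => v i - drift v k i) +
    2 * sqnorm (excess_vec Dl (fun i => B i + drift v k i)))).
  rewrite /dot !mulr_sumr -big_split; apply: ler_sum => i _ /=.
  rewrite -!expr2 /excess_vec.
  have -> : D i + B i = (D i - v i) + (v i - drift v k i) + (B i + drift v k i).
    by ring.
  by apply: excess_shift => //; exact: norm_sub_excess.
have r2 : r%:R - 1 <= 2 * r./2%:R :> R.
  by rewrite lerBlDr -natrM natr1 ler_nat; lia.
set s := sigma * r%:R in sr0 norm_le noise_le *.
have s_ge : 100 * sigma <= s by rewrite /s mulrC ler_pM2l.
have rest_sqr : (norm v / 4 + sigma / 2) ^+ 2 <= (s * (29 / 800)) ^+ 2.
  by rewrite ler_pXn2r// ?nnegrE; lra.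
have half_sqr : (s * (99 / 1600)) ^+ 2 <= (sigma * r./2%:R / 8) ^+ 2.
  have : sigma * (r%:R - 1) <= sigma * (2 * r./2%:R) by rewrite ler_pM2l.
  rewrite mulrBr mulr1 -/s => half_ge.
  by rewrite ler_pXn2r// ?nnegrE; lra.
have := sqr_ge0 s; rewrite !exprMn in noise_le rest_sqr half_sqr *; lra.
Qed.

End SteeringBudget.

Section BlockMoments.
Context (d : measure_display) (T : measurableType d) (R : realType).
Variables (P : probability T R) (I J : finType) (X : I * J -> {RV P >-> R}).
Variables (sigma : R) (f : J -> R).
Hypotheses (sigma_gt0 : 0 < sigma) (indepX : independent_family X).
Hypothesis gaussX : forall ij, gaussian 0 sigma (X ij).
Hypothesis f01 : forall j, 0 <= f j <= 1.
Notation peak := (normal_peak (1 : R)).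
Implicit Types (u v : I -> R) (js : seq J).

Definition entries (w : T) (j : J) (i : I) : R := X (i, j) w.

Definition col_set (js : seq J) : {set I * J} := [set ij | ij.2 \in js].

Notation block_at w v p js := (block_sum sigma f (entries w) v p js).

Lemma measurable_entry js j i : j \in js ->
  measurable_fun setT ((fun w => entries w j i) : cylinder_space X (col_set js) -> R).
Proof. by move=> jj; apply: measurable_coordinate; rewrite inE. Qed.

Lemma disjoint_col_set js js' : (forall j, j \in js -> j \notin js') ->
  [disjoint col_set js & col_set js']%B.
Proof.
move=> disjoint_js; rewrite -setI_eq0; apply/eqP/setP => ij; rewrite !inE.
by apply/negbTE/negP => /andP[/disjoint_js /negP].
Qed.

Lemma measurable_block_at v p js i :
  measurable_fun setT (fun w => block_at w v p js i).
Proof.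
by apply: measurable_block_sum => [i'|j i' _]; [exact: measurable_cst|exact: measurable_funP].
Qed.

Lemma column_error_mgf u v p j :
  (\int[P]_w (expR (((steers sigma v p (entries w j))%:R - f j) *
      dot u (entries w j)))%:E <=
   (expR (2 * sigma ^+ 2 * sqnorm u - peak * sigma * (within_budget sigma v p)%:R *
      (dot u v / Num.sqrt (sqnorm v))))%:E)%E.
Proof.
have indep_col : independent_family (fun i => X (i, j)).
  by apply: independent_subfamily indepX _ => i i' [].
have gauss_col i : gaussian 0 sigma (X (i, j)) by exact: gaussX.
rewrite /steers; case: (boolP (within_budget sigma v p)) => /= [budget|_].
  have v_gt0 : 0 < sqnorm v.
    by rewrite -(pmulr_rgt0 _ (ltr0n R 25)); apply: le_lt_trans budget; exact: sqr_ge0.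
  apply: le_trans (rounded_column_mgf sigma_gt0 indep_col gauss_col u v_gt0 (f01 j)) _.
  by rewrite lee_fin ler_expR mulr1 !mulrA.
have := gaussian_mgf sigma_gt0 indep_col gauss_col (fun i => - f j * u i).
under eq_integral do rewrite dotZl -(sub0r (f j)).
move=> ->; rewrite lee_fin ler_expR mulr0 mul0r subr0 sqnormZ sqrrN.
have f2 : f j ^+ 2 <= 1 by have /andP[f0 f1] := f01 j; rewrite expr_le1.
have U0 : 0 <= sigma ^+ 2 * sqnorm u by rewrite mulr_ge0 ?sqr_ge0 ?sqnorm_ge0.
have : f j ^+ 2 * (sigma ^+ 2 * sqnorm u) <= 1 * (sigma ^+ 2 * sqnorm u).
  by rewrite ler_wpM2r.
rewrite mulrCA; lra.
Qed.

Lemma block_mgf u v p js : uniq js ->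
  (\int[P]_w (expR (dot u (block_at w v p js)))%:E <=
   (expR (2 * sigma ^+ 2 * (size js)%:R * sqnorm u -
     peak * sigma * (steps sigma v p (size js))%:R *
       (dot u v / Num.sqrt (sqnorm v))))%:E)%E.
Proof.
elim: js p => [|j js IH] p /=.
  move=> _; under eq_integral do rewrite dot0r expR0.
  by rewrite integral_probability_cst !(mulr0, mul0r) subr0 expR0.
move=> /andP[jNjs ujs].
pose err w := ((steers sigma v p (entries w j))%:R - f j) * dot u (entries w j).
have consE w : dot u (block_at w v p (j :: js)) =
    err w + dot u (block_at w v p.+1 js).
  rewrite /= dotDr; congr (_ + _); rewrite /err -dotZr.
  by apply: eq_bigr => i _; congr (_ * _); rewrite mulrC.
under eq_integral do rewrite consE expRD EFinM.
rewrite (ge0_integral_independentM (S1 := col_set [:: j]) (S2 := col_set js) indepX)//.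
- have -> : 2 * sigma ^+ 2 * (size js).+1%:R * sqnorm u -
      peak * sigma * (steps sigma v p (size js).+1)%:R *
        (dot u v / Num.sqrt (sqnorm v)) =
    (2 * sigma ^+ 2 * sqnorm u - peak * sigma * (within_budget sigma v p)%:R *
        (dot u v / Num.sqrt (sqnorm v))) +
    (2 * sigma ^+ 2 * (size js)%:R * sqnorm u -
      peak * sigma * (steps sigma v p.+1 (size js))%:R *
        (dot u v / Num.sqrt (sqnorm v))).
    by rewrite /steps/= natrD -natr1; ring.
  rewrite expRD EFinM; apply: lee_pmul => //.
  + by apply: integral_ge0 => w _; rewrite lee_fin expR_ge0.
  + by apply: integral_ge0 => w _; rewrite lee_fin expR_ge0.
  + exact: column_error_mgf.
  + exact: IH.
- by apply: disjoint_col_set => k; rewrite inE => /eqP ->.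
- have mcol i : measurable_fun setT
      ((fun w => entries w j i) : cylinder_space X (col_set [:: j]) -> R).
    by apply: measurable_entry; rewrite mem_head.
  apply: emeasurable_expR; apply: measurable_funM; last exact: measurable_dot.
  by apply: measurable_funB => //; apply: measurable_natr_bool; exact: measurable_steers.
- apply: emeasurable_expR; apply: measurable_dot => // i.
  by apply: measurable_block_sum => // j' i' jj'; exact: measurable_entry.
Qed.

Lemma subgaussian_block v js (r : R) : uniq js -> (size js)%:R <= r ->
  subgaussian P (2 * sigma ^+ 2 * r)
    (fun w i => block_at w v 0 js i + drift sigma v (size js) i).
Proof.
move=> ujs sjr; split => [i|u].
  by apply: measurable_funD => //; exact: measurable_block_at.
have driftE : dot u (drift sigma v (size js)) = peak * sigma *
    (steps sigma v 0 (size js))%:R * (dot u v / Num.sqrt (sqnorm v)).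
  by rewrite dotZr mulrAC -!mulrA.
under eq_integral do rewrite dotDr expRD mulrC EFinM.
rewrite ge0_integralZl//; last first.
  by apply: emeasurable_expR; apply: measurable_dot => // i; exact: measurable_block_at.
apply: le_trans (lee_wpmul2l _ (block_mgf u v 0 ujs)) _.
  by rewrite lee_fin expR_ge0.
rewrite -EFinM lee_fin -expRD ler_expR driftE addrCA subrr addr0.
by rewrite ler_wpM2r ?sqnorm_ge0// ler_wpM2l// mulr_ge0 ?sqr_ge0.
Qed.

Lemma subgaussian_rounding_down js (r : R) : uniq js -> (size js)%:R <= r ->
  subgaussian P (2 * sigma ^+ 2 * r)
    (fun w i => \sum_(j <- js) entries w j i * - f j).
Proof.
move=> ujs sjr; have := subgaussian_block (fun=> 0) ujs sjr.
congr (subgaussian P _); apply/funext => w; apply/funext => i.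
by rewrite block_sum0 /drift mulr0 addr0.
Qed.

Definition phase_risk (r : nat) (Dl : R) : R :=
  expR (2 * expR (- (3 / 32 / (sigma ^+ 2 * r%:R) * Dl ^+ 2)) * #|I|%:R
    - 3 / 2 ^+ 17 * r%:R).

Lemma phase_failure (D : I -> R) (t Dl : R) (r : nat) js :
  uniq js -> size js = uphalf r -> (100 <= r)%N -> 0 <= t -> 0 <= Dl ->
  sqnorm (excess_vec t D) <= (sigma * r%:R / 8) ^+ 2 ->
  (P [set w | ((sigma * r./2%:R / 8) ^+ 2 < sqnorm (excess_vec (t + Dl)
     (fun i => D i + block_at w (excess_vec t D) 0 js i)))%R] <=
   (phase_risk r Dl)%:E)%E.
Proof.
move=> ujs sjs r100 t0 Dl0 D_le; set v := excess_vec t D.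
have r_gt0 : 0 < r%:R :> R by rewrite ltr0n; lia.
have sjr : (size js)%:R <= r%:R :> R by rewrite ler_nat sjs; lia.
have noise := subgaussian_block v ujs sjr.
pose theta : R := 3 / 32 / (sigma ^+ 2 * r%:R).
have theta0 : 0 <= theta by rewrite divr_ge0// mulr_ge0 ?sqr_ge0.
have thetaD : theta * (2 * sigma ^+ 2 * r%:R) = 3 / 16.
  by rewrite /theta; field; rewrite !gt_eqF.
have theta_lt : 4 * (theta * (2 * sigma ^+ 2 * r%:R)) < 1 by rewrite thetaD; lra.
have gainE : (Num.sqrt (1 - 4 * (theta * (2 * sigma ^+ 2 * r%:R))))^-1 = 2.
  rewrite thetaD (_ : 1 - 4 * (3 / 16) = (2^-1) ^+ 2); last by field.
  by rewrite sqrtr_sqr ger0_norm ?invr_ge0// invrK.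
have := excess_sqnorm_tail noise theta0 theta_lt ((sigma * r%:R / 64) ^+ 2) Dl0.
rewrite gainE (_ : theta * (sigma * r%:R / 64) ^+ 2 = 3 / 2 ^+ 17 * r%:R); last first.
  by rewrite /theta; field; rewrite !gt_eqF.
apply: le_trans; apply: le_measure; rewrite ?inE.
- apply: measurable_bool_set; apply: measurable_fun_ltr => //.
  apply: measurable_dot => i; apply: measurable_excess; apply: measurable_funD => //;
    exact: measurable_block_at.
- apply: measurable_bool_set; apply: measurable_fun_ltr => //.
  by apply: measurable_dot => i; apply: measurable_excess; exact: noise.1.
- move=> w /=; apply: contraTT; rewrite -!leNgt.
  by apply: excess_vec_shrinks => //; rewrite sjs; lia.
Qed.

End BlockMoments.

(** * Scales and numerical bounds *)

Section IntegerScales.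
Variables n m : nat.

(* The ceilings of log2 (m / n) and of sqrt k. *)
Definition doublings : nat := up_log 2 (m.-1 %/ n).+1.

Lemma doublings_leq k : (0 < n)%N -> (doublings <= k)%N = (m <= n * 2 ^ k)%N.
Proof.
move=> n0; have k0 : (0 < 2 ^ k)%N by rewrite expn_gt0.
transitivity ((m.-1 %/ n).+1 <= 2 ^ k)%N.
  apply/idP/idP => [up_le|]; last exact: up_log_min.
  by apply: leq_trans (@up_logP 2 _ isT) _; rewrite leq_exp2l.
rewrite ltn_divLR// mulnC; have : (0 < n * 2 ^ k)%N by rewrite muln_gt0 n0.
by move: (n * 2 ^ k)%N => N; lia.
Qed.

Lemma ceil_sqrt_exists k : exists s, (k <= s * s)%N.
Proof. by exists k; nia. Qed.

Definition ceil_sqrt k : nat := ex_minn (ceil_sqrt_exists k).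

Lemma ceil_sqrt_leq k s : (ceil_sqrt k <= s)%N = (k <= s * s)%N.
Proof.
rewrite /ceil_sqrt; case: ex_minnP => r kr r_min.
by apply/idP/idP => [rs|/r_min//]; apply: leq_trans kr _; exact: leq_mul.
Qed.

Definition scale : nat := ceil_sqrt (n * doublings).

Hypothesis n_gt0 : (0 < n)%N.

Lemma doublings_ge : (m <= n * 2 ^ doublings)%N.
Proof. by rewrite -doublings_leq. Qed.

Lemma doublings_gt0 : (n < m)%N -> (0 < doublings)%N.
Proof. by rewrite lt0n -leqn0 doublings_leq// muln1 -ltnNge. Qed.

Lemma scale_ge : (n * doublings <= scale * scale)%N.
Proof. by rewrite -ceil_sqrt_leq. Qed.

Lemma doublings_le : (m <= 2 ^ n)%N -> (doublings <= n)%N.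
Proof. by move=> m_le; rewrite doublings_leq// (leq_trans m_le)// leq_pmull. Qed.

Lemma scale_le : (m <= 2 ^ n)%N -> (scale <= n * n)%N.
Proof.
move=> /doublings_le L_le; rewrite ceil_sqrt_leq.
by rewrite (leq_trans (leq_mul (leqnn n) L_le))// leq_pmulr// muln_gt0 n_gt0.
Qed.

(* The second condition, log m > 1024 log (m / n), singles out the instances in
   which rounding down alone is not good enough. *)
Definition steering_range (R : realType) (r : nat) : bool :=
  (n < r * r)%N && ((m%:R / n%:R : R) ^+ (2 ^ 10) < m%:R).

Lemma steering_range_mono (R : realType) r r' : (r <= r')%N ->
  steering_range R r -> steering_range R r'.
Proof.
move=> rr' /andP[nr close]; rewrite /steering_range close andbT.
by apply: leq_trans nr _; exact: leq_mul.
Qed.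

End IntegerScales.

Section ExponentialBounds.
Variable R : realType.

Lemma expr_ge1Dn (x : R) (k : nat) : 0 <= x -> 1 + k%:R * x <= (1 + x) ^+ k.
Proof.
move=> x0; elim: k => [|k IH]; first by rewrite mul0r addr0 expr0.
rewrite exprS; apply: le_trans (ler_wpM2l _ IH); last by rewrite addr_ge0.
have : 0 <= k%:R * x * x by rewrite !mulr_ge0.
by rewrite -[k.+1%:R]natr1; lra.
Qed.

Lemma expr2_le_expR (k : nat) : 2 ^+ k <= expR k%:R :> R.
Proof.
rewrite -[k%:R]mul1r expRM_natr lerXn2r ?nnegrE ?expR_ge0//.
by have := expR_ge1Dx (1 : R); lra.
Qed.

Lemma ln2_ge : 1 / 2 <= ln 2 :> R.
Proof.
rewrite -ler_expR lnK ?posrE//.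
apply: le_trans (expR_le_invB _) _; first lra.
by rewrite (_ : 1 - 1 / 2 = 2^-1) ?invrK//; lra.
Qed.

Lemma expRN_mul_ln (m k : nat) : (0 < m)%N ->
  expR (- (k%:R * ln m%:R)) = (m%:R ^+ k)^-1 :> R.
Proof. by move=> m0; rewrite expRN expRM_natl lnK// posrE ltr0n. Qed.

End ExponentialBounds.

Section PhaseRisk.
Variables (R : realType) (n m L S r k : nat).
Hypotheses (r_gt0 : (0 < r)%N) (r_le : (r * 2 ^ k <= n)%N).
Hypotheses (nL_le : (n * L <= S * S)%N) (m_le : (m <= n * 2 ^ L)%N) (L_gt0 : (0 < L)%N).

Let rR : 0 < r%:R :> R. Proof. by rewrite ltr0n. Qed.

Notation Q := (n%:R / (r%:R * 2 ^+ k) : R).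
Notation exponent := (24 * (S%:R ^+ 2 * (9 / 16) ^+ k / r%:R) : R).

Lemma phase_exponent_ge : 18%:R + L%:R + k%:R + (Q - 1) <= exponent.
Proof.
have Q_ge1 : 1 <= Q.
  by rewrite ler_pdivlMr ?mulr_gt0// mul1r -natrX -natrM ler_nat.
have L_ge1 : 1 <= L%:R :> R by rewrite ler1n.
have LQ_ge : 0 <= (L%:R - 1) * (Q - 1) by rewrite mulr_ge0// subr_ge0.
have growth : L%:R * Q * (1 + k%:R * (1 / 8)) <= S%:R ^+ 2 * (9 / 16) ^+ k / r%:R.
  apply: (@le_trans _ _ (L%:R * Q * (9 / 8) ^+ k)).
    have -> : 9 / 8 = 1 + 1 / 8 :> R by lra.
    apply: ler_wpM2l; first by rewrite mulr_ge0//; lra.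
    by apply: expr_ge1Dn; lra.
  have -> : L%:R * Q * (9 / 8) ^+ k = (n%:R * L%:R) * (9 / 16) ^+ k / r%:R.
    have -> : 9 / 8 = 9 / 16 * 2 :> R by lra.
    by rewrite exprMn; field; rewrite !gt_eqF.
  rewrite ler_pM2r ?invr_gt0// ler_wpM2r ?exprn_ge0//.
  by rewrite expr2 -!natrM ler_nat.
set q := Q in Q_ge1 LQ_ge growth *.
have kQ_ge : 0 <= k%:R * (L%:R * q - 1) by rewrite mulr_ge0//; lra.
have k_ge0 : 0 <= k%:R :> R by [].
apply: (@le_trans _ _ (24 * (L%:R * q * (1 + k%:R * (1 / 8))))).
  have -> : 24 * (L%:R * q * (1 + k%:R * (1 / 8))) =
    24 * (L%:R * q) + 3 * (k%:R * (L%:R * q - 1)) + 3 * k%:R by field.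
  lra.
by rewrite ler_pM2l.
Qed.

Lemma phase_exponential_ge : 2 ^+ 18 * m%:R <= r%:R * expR exponent.
Proof.
apply: (@le_trans _ _ (r%:R * expR (18%:R + L%:R + k%:R + (Q - 1)))); last first.
  by rewrite ler_pM2l// ler_expR phase_exponent_ge.
rewrite (expRD _ (Q - 1)) (expRD _ k%:R) (expRD 18%:R).
have Q_ge0 : 0 <= Q by rewrite divr_ge0// mulr_ge0// ltW.
have pow_ge0 j : 0 <= 2 ^+ j :> R by rewrite exprn_ge0.
apply: (@le_trans _ _ (r%:R * (2 ^+ 18 * 2 ^+ L * 2 ^+ k * Q))).
  have -> : r%:R * (2 ^+ 18 * 2 ^+ L * 2 ^+ k * Q) = 2 ^+ 18 * (n%:R * 2 ^+ L).
    by field; rewrite !gt_eqF.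
  by rewrite ler_pM2l ?exprn_gt0// -natrX -natrM ler_nat.
rewrite ler_pM2l//; apply: ler_pM; rewrite ?mulr_ge0//.
  apply: ler_pM; rewrite ?mulr_ge0 ?expr2_le_expR//.
  by apply: ler_pM; rewrite ?expr2_le_expR.
by have := expR_ge1Dx (Q - 1); lra.
Qed.

Lemma phase_risk_le (I : finType) (sigma t : R) : #|I| = m -> 0 < sigma ->
  t <= r%:R / 2 ^+ 16 ->
  phase_risk I sigma r (16 * (sigma * S%:R) * (3 / 4) ^+ k) <= expR (- t).
Proof.
move=> cardI sigma0 tr; rewrite /phase_risk cardI ler_expR.
have -> : 3 / 32 / (sigma ^+ 2 * r%:R) * (16 * (sigma * S%:R) * (3 / 4) ^+ k) ^+ 2
    = exponent.
  have -> : 9 / 16 = (3 / 4) ^+ 2 :> R by lra.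
  rewrite -exprM mulnC exprM; set q := (3 / 4) ^+ k.
  by field; rewrite !gt_eqF.
have := phase_exponential_ge; set e := exponent => exp_ge; rewrite expRN.
have risk_le : m%:R / expR e <= r%:R / 2 ^+ 18.
  by rewrite ler_pdivlMr ?exprn_gt0// mulrAC ler_pdivrMr ?expR_gt0// mulrC.
have -> : 2 * (expR e)^-1 * m%:R = 2 * (m%:R / expR e) by ring.
have scale_risk : r%:R / 2 ^+ 18 = r%:R / 2 ^+ 16 / 4 :> R by field.
have -> : 3 / 2 ^+ 17 * r%:R = 3 * (r%:R / 2 ^+ 16) / 2 :> R by field.
rewrite scale_risk in risk_le; lra.
Qed.

End PhaseRisk.

Section LogarithmicScales.
Context (R : realType) (n m : nat).
Hypotheses (n_gt0 : (0 < n)%N) (mn : (2 * n <= m)%N).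
Notation ell := (ln (m%:R / n%:R) : R).

Let nR : 0 < n%:R :> R. Proof. by rewrite ltr0n. Qed.
Let mR : 0 < m%:R :> R. Proof. by rewrite ltr0n; lia. Qed.
Let ratio_ge2 : 2 <= m%:R / n%:R :> R.
Proof. by rewrite ler_pdivlMr// -natrM ler_nat. Qed.

Lemma ln_ratio_ge : 1 / 2 <= ell.
Proof. by apply: le_trans (ln2_ge R) _; rewrite ler_ln ?posrE// divr_gt0. Qed.

Lemma n_ln_ratio_ge0 : 0 <= n%:R * ell.
Proof. by rewrite mulr_ge0//; have := ln_ratio_ge; lra. Qed.

Lemma doublings_le_ln : (doublings n m)%:R <= 4 * ell.
Proof.
have ell_ge := ln_ratio_ge; have nm : (n < m)%N by lia.
have := doublings_gt0 n_gt0 nm.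
case LE : (doublings n m) => [//|l] _.
have lm : (n * 2 ^ l < m)%N by rewrite ltnNge -doublings_leq// LE ltnn.
have : 2 ^+ l <= m%:R / n%:R :> R.
  by rewrite ler_pdivlMr// mulrC -natrX -natrM ler_nat ltnW.
rewrite -ler_ln ?posrE ?exprn_gt0 ?divr_gt0// lnXn// => l_le.
have : 1 / 2 *+ l <= ln 2 *+ l :> R by rewrite lerMn2r ln2_ge orbT.
by rewrite -mulr_natr -[l.+1%:R]natr1; lra.
Qed.

Lemma scale_le_sqrt : (scale n m)%:R <= 4 * Num.sqrt (n%:R * ell).
Proof.
have ell_ge := ln_ratio_ge; have nell0 := n_ln_ratio_ge0.
rewrite -(ler_pXn2r (n := 2)) ?nnegrE ?mulr_ge0 ?sqrtr_ge0// exprMn sqr_sqrtr//.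
have S2_le : (scale n m * scale n m <= 4 * (n * doublings n m))%N.
  case SE : (scale n m) => [//|s].
  have : (s * s < n * doublings n m)%N by rewrite ltnNge -ceil_sqrt_leq -/(scale n m) SE ltnn.
  by move: (n * _)%N => N; nia.
move: S2_le; rewrite -(ler_nat R) !natrM -expr2 => /le_trans; apply.
by have := ler_wpM2l (ltW nR) doublings_le_ln; lra.
Qed.

Lemma sqrt_n_le : Num.sqrt n%:R <= 2 * Num.sqrt (n%:R * ell).
Proof.
rewrite -(ler_pXn2r (n := 2)) ?nnegrE ?mulr_ge0 ?sqrtr_ge0// exprMn.
rewrite (sqr_sqrtr n_ln_ratio_ge0) (sqr_sqrtr (ltW nR)).
by have := ler_wpM2l (ltW nR) ln_ratio_ge; have := nR; lra.
Qed.

Lemma rounding_bound_ge (sigma : R) : 0 < sigma ->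
  480 * (sigma * Num.sqrt (n%:R * ell)) <= rounding_bound n m sigma.
Proof.
move=> s0; rewrite /rounding_bound -mulrA ler_pM2l ?ltr0n//.
by rewrite ler_pM2l// lerDl sqrtr_ge0.
Qed.

Lemma ln_ratio_expn : ln ((m%:R / n%:R) ^+ (2 ^ 10)) = 1024 * ell.
Proof. by rewrite lnXn ?divr_gt0// -[LHS]mulr_natl natrX; congr (_ * _); lra. Qed.

Hypothesis close : (m%:R / n%:R) ^+ (2 ^ 10) < m%:R :> R.

Lemma ln_ratio_lt : 1024 * ell < ln m%:R.
Proof. by rewrite -ln_ratio_expn ltr_ln ?posrE ?exprn_gt0 ?divr_gt0. Qed.

Lemma ln_m_ge : 512 <= ln m%:R :> R.
Proof. by have := ln_ratio_lt; have := ln_ratio_ge; lra. Qed.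

Lemma sqrt_n_ge : 2 ^+ 19 * ln m%:R <= Num.sqrt n%:R :> R.
Proof.
have t_ge := ln_m_ge; set t := ln m%:R in t_ge *.
have ln_n_ge : t / 2 <= ln n%:R.
  by have := ln_ratio_lt; rewrite ln_div ?posrE// -/t; lra.
have -> : Num.sqrt n%:R = expR (ln n%:R / 2) :> R.
  apply/eqP; rewrite -(@eqrXn2 _ 2) ?sqrtr_ge0 ?expR_ge0// sqr_sqrtr ?ltW//.
  by rewrite -expRM_natr -mulrA mulVf ?pnatr_eq0// mulr1 lnK ?posrE.
apply: (@le_trans _ _ (expR (t / 64 * 16%:R))); last by rewrite ler_expR; lra.
rewrite expRM_natr; set z := t / 64.
have z_ge8 : 8 <= z by rewrite /z; lra.
have -> : t = z * 2 ^+ 6 by rewrite /z; field.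
apply: (@le_trans _ _ (z * 8 ^+ 15)).
  have -> : 2 ^+ 19 * (z * 2 ^+ 6) = z * 2 ^+ 25 :> R by ring.
  have -> : 8 = 2 ^+ 3 :> R by lra.
  rewrite -exprM; apply: ler_wpM2l; first lra.
  by apply: ler_weXn2l => //; lra.
rewrite [leRHS](exprS _ 15); have z_le : z <= expR z by have := expR_ge1Dx z; lra.
apply: ler_pM => //; rewrite ?exprn_ge0//; first lra.
by rewrite lerXn2r ?nnegrE ?expR_ge0//; lra.
Qed.

End LogarithmicScales.

(** * The sequence of phases *)

Section Thresholds.
Variables (R : realType) (sigma : R) (S : nat).
Hypothesis sigma_ge0 : 0 <= sigma.

Lemma thr_atE k : thr_at sigma S k = 64 * (sigma * S%:R) * (1 - (3 / 4) ^+ k).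
Proof.
elim: k => [|k IH]; first by rewrite expr0 subrr mulr0.
by rewrite /thr_at iterS -/(thr_at sigma S k) IH /next_thr exprS; field.
Qed.

Lemma thr_at_step k :
  thr_at sigma S k.+1 - thr_at sigma S k = 16 * (sigma * S%:R) * (3 / 4) ^+ k.
Proof. by rewrite !thr_atE exprS; field. Qed.

Lemma thr_at_step_ge0 k : 0 <= thr_at sigma S k.+1 - thr_at sigma S k.
Proof. by rewrite thr_at_step !mulr_ge0 ?exprn_ge0. Qed.

Lemma thr_at_bounds k : 0 <= thr_at sigma S k <= 64 * (sigma * S%:R).
Proof.
rewrite thr_atE; have T0 : 0 <= 64 * (sigma * S%:R) by rewrite !mulr_ge0.
have q0 : 0 <= (3 / 4) ^+ k :> R by rewrite exprn_ge0.
have q1 : (3 / 4) ^+ k <= 1 :> R by rewrite exprn_ile1//; lra.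
by rewrite mulr_ge0 ?subr_ge0//= -[leRHS]mulr1 ler_wpM2l// gerBl.
Qed.

End Thresholds.

Section Chain.
Context (d : measure_display) (T : measurableType d) (R : realType).
Variables (P : probability T R) (I J : finType) (X : I * J -> {RV P >-> R}).
Variables (sigma : R) (f : J -> R) (S : nat) (js : seq J).
Hypotheses (sigma_gt0 : 0 < sigma) (indepX : independent_family X).
Hypothesis gaussX : forall ij, gaussian 0 sigma (X ij).
Hypothesis f01 : forall j, 0 <= f j <= 1.
Hypothesis uniq_js : uniq js.
Notation rest := (rest js).
Notation block := (block js).
Notation thr_at := (thr_at sigma S).
Notation disc_at w := (disc_at sigma S f js (entries X w)).

Definition overflow (k : nat) (D : I -> R) : bool :=
  (sigma * (size (rest k))%:R / 8) ^+ 2 < sqnorm (excess_vec (thr_at k) D).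

Lemma measurable_overflow d' (U : measurableType d') k (D : U -> I -> R) :
  (forall i, measurable_fun setT (D ^~ i)) ->
  measurable_fun setT (fun w => overflow k (D w)).
Proof.
move=> mD; apply: measurable_fun_ltr => //.
by apply: measurable_dot => i; exact: measurable_excess.
Qed.

Lemma measurable_disc_at_entries k i : measurable_fun setT (fun w => disc_at w k i).
Proof. by apply: measurable_disc_at => // j i' _ _; exact: measurable_funP. Qed.

Lemma measurable_overflow_at k :
  measurable_fun setT (fun w => overflow k (disc_at w k)).
Proof. by apply: measurable_overflow => i; exact: measurable_disc_at_entries. Qed.

Definition next_disc (w1 w2 : T) (k : nat) : I -> R :=
  fun i => disc_at w1 k i + block_sum sigma f (entries X w2)
    (excess_vec (thr_at k) (disc_at w1 k)) 0 (block k) i.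

Definition first_overflow (k : nat) (w1 w2 : T) : bool :=
  ~~ overflow k (disc_at w1 k) && overflow k.+1 (next_disc w1 w2 k).

Definition past (k : nat) : seq J := [seq j <- js | j \notin rest k].

Lemma disjoint_past_block k :
  [disjoint col_set I (past k) & col_set I (block k)]%B.
Proof.
apply: disjoint_col_set => j; rewrite mem_filter => /andP[jk _].
by apply: contra jk; exact: block_sub_rest.
Qed.

Lemma measurable_first_overflow k :
  measurable_fun setT ((fun w => first_overflow k w.1 w.2) :
    cylinder_space X (col_set I (past k)) * cylinder_space X (col_set I (block k)) ->
    bool).
Proof.
have mpast i : measurable_fun setT ((fun w => disc_at w.1 k i) :
    cylinder_space X (col_set I (past k)) * cylinder_space X (col_set I (block k)) -> R).
  apply: measurable_disc_at => // j i' jj jk.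
  apply: (measurableT_comp _ measurable_fst).
  by apply: measurable_entry; rewrite mem_filter jk.
apply: measurable_and; first by apply: measurable_neg; exact: measurable_overflow.
apply: measurable_overflow => i; apply: measurable_funD => //.
apply: measurable_block_sum => [i'|j i' jb]; first exact: measurable_excess.
apply: (measurableT_comp _ measurable_snd); exact: measurable_entry.
Qed.

Lemma probability_first_overflow k : (100 <= size (rest k))%N ->
  (P [set w | first_overflow k w w] <=
   (phase_risk I sigma (size (rest k)) (thr_at k.+1 - thr_at k))%:E)%E.
Proof.
move=> r100; have mfirst := @measurable_first_overflow k.
have mfirst1 w1 : measurable_fun setT (first_overflow k w1).
  exact: (measurable_from_cylinder_space (measurable_section w1 mfirst)).
have mdiag : measurable_fun setT (fun w => first_overflow k w w).
  apply: measurable_and; first by apply: measurable_neg; exact: measurable_overflow_at.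
  exact: measurable_overflow_at.
rewrite -integral_natr_bool//.
apply: (decoupling_le indepX (disjoint_past_block k)
  (h := fun w1 w2 => (first_overflow k w1 w2)%:R%:E)) => //.
  by apply/measurable_EFinP; exact: measurable_natr_bool.
move=> w1; rewrite integral_natr_bool// /first_overflow.
have [over|] := boolP (overflow k (disc_at w1 k)).
  rewrite (_ : [set w | _] = set0) ?measure0 ?lee_fin ?expR_ge0//.
  by apply/seteqP; split.
rewrite /overflow -leNgt => no_overflow.
have /andP[thr0 _] := thr_at_bounds S (ltW sigma_gt0) k.
have := phase_failure sigma_gt0 indepX gaussX f01 (take_uniq _ (uniq_rest uniq_js k))
  (size_block js k) r100 thr0 (thr_at_step_ge0 S (ltW sigma_gt0) k) no_overflow.
by rewrite addrC subrK -size_rest.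
Qed.

Lemma overflow_step k : (100 <= size (rest k))%N ->
  (P [set w | overflow k.+1 (disc_at w k.+1)] <=
   P [set w | overflow k (disc_at w k)] +
   (phase_risk I sigma (size (rest k)) (thr_at k.+1 - thr_at k))%:E)%E.
Proof.
move=> r100; apply: le_trans (leeD2l _ (probability_first_overflow r100)).
have mover l : measurable [set w | overflow l (disc_at w l)].
  exact/measurable_bool_set/measurable_overflow_at.
have mfirst : measurable [set w | first_overflow k w w].
  apply: measurable_bool_set; apply: measurable_and; last exact: measurable_overflow_at.
  by apply: measurable_neg; exact: measurable_overflow_at.
apply: le_trans (measureU2 _ (mover k) mfirst).
apply: le_measure; rewrite ?inE//; first exact: measurableU.
move=> w /= over; have [over_k|no_over_k] := boolP (overflow k (disc_at w k)).
  by left.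
by right; apply/andP.
Qed.

Lemma overflow_chain K (eps : R) :
  (forall k, (k < K)%N -> (100 <= size (rest k))%N /\
    phase_risk I sigma (size (rest k)) (thr_at k.+1 - thr_at k) <= eps) ->
  (P [set w | overflow K (disc_at w K)] <= (K%:R * eps)%:E)%E.
Proof.
elim: K => [_|K IH risks].
  rewrite mul0r (_ : [set w | _] = set0) ?measure0//; apply/seteqP; split => // w /=.
  rewrite /overflow (_ : excess_vec _ _ = fun=> 0) ?dot0l; first by rewrite ltNge sqr_ge0.
  by apply/funext => i; exact: excess0.
have [r100 risk_le] := risks K (ltnSn K).
apply: le_trans (overflow_step r100) _.
rewrite -[K.+1%:R]natr1 mulrDl mul1r EFinD leeD ?lee_fin//.
by apply: IH => k kK; apply: risks; exact: ltnW.
Qed.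

Lemma norm_disc_le w K (y : R) i : ~~ overflow K (disc_at w K) ->
  `|\sum_(j <- rest K) entries X w j i * - f j| <= y ->
  `|disc_at w K i + \sum_(j <- rest K) entries X w j i * - f j| <=
    64 * (sigma * S%:R) + sigma * (size (rest K))%:R / 8 + y.
Proof.
rewrite /overflow -leNgt => no_overflow tail_le.
have /andP[thr0 thr_le] := thr_at_bounds S (ltW sigma_gt0) K.
apply: le_trans (ler_normD _ _) (lerD _ tail_le).
rewrite -[disc_at w K i](subrK (excess (thr_at K) (disc_at w K i))).
apply: le_trans (ler_normD _ _) (lerD (le_trans (norm_sub_excess _ thr0) thr_le) _).
have size_ge0 : 0 <= sigma * (size (rest K))%:R / 8 by rewrite !mulr_ge0// ltW.
rewrite -(ler_pXn2r (n := 2))// real_normK ?num_real//.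
exact: le_trans (sqnorm_ge_sqr (excess_vec _ _) i) no_overflow.
Qed.

End Chain.

Section Discrepancy.
Context (d : measure_display) (T : measurableType d) (R : realType).
Variables (P : probability T R) (m n : nat) (X : 'I_m * 'I_n -> {RV P >-> R}).
Variables (sigma : R) (f : 'I_n -> R).
Hypotheses (sigma_gt0 : 0 < sigma) (indepX : independent_family X).
Hypothesis gaussX : forall ij, gaussian 0 sigma (X ij).
Hypothesis f01 : forall j, 0 <= f j <= 1.
Hypotheses (n_gt0 : (0 < n)%N) (mn : (2 * n <= m)%N).
Notation S := (scale n m).
Notation active := (steering_range n m R).
Notation ell := (ln (m%:R / n%:R) : R).

Let m_gt0 : (0 < m)%N. Proof. lia. Qed.
Let mR : 0 < m%:R :> R. Proof. by rewrite ltr0n. Qed.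
Let nR : 0 < n%:R :> R. Proof. by rewrite ltr0n. Qed.

Definition rounding_down (s : seq 'I_n) (w : T) (i : 'I_m) : R :=
  \sum_(j <- s) entries X w j i * - f j.

Lemma measurable_rounding_down s i : measurable_fun setT (fun w => rounding_down s w i).
Proof. by apply: measurable_sum => j; apply: measurable_funM. Qed.

Lemma rounding_down_tail s (y r : R) : uniq s -> 0 <= y -> 0 < r -> (size s)%:R <= r ->
  4%:R * ln m%:R <= y ^+ 2 / (8 * sigma ^+ 2 * r) ->
  (P [set w | sup_exceeds y (rounding_down s w)] <= (2 / m%:R ^+ 3)%:E)%E.
Proof.
move=> us y0 r0 sr y_ge.
have sub := subgaussian_rounding_down sigma_gt0 indepX gaussX f01 us sr.
apply: le_trans (subgaussian_sup_tail sub _ y0) _.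
  by rewrite !mulr_gt0 ?exprn_gt0.
rewrite lee_fin card_ord (_ : 4 * _ = 8 * sigma ^+ 2 * r); last by ring.
apply: (@le_trans _ _ (2 * m%:R * expR (- (4%:R * ln m%:R)))).
  by rewrite ler_wpM2l ?mulr_ge0// ler_expR lerN2.
rewrite expRN_mul_ln// le_eqVlt; apply/predU1P; left.
by field; rewrite gt_eqF.
Qed.

Variable js : seq 'I_n.
Hypothesis uniq_js : uniq js.
Notation rest := (rest js).
Notation thr_at := (thr_at sigma S).
Notation disc_at w := (disc_at sigma S f js (entries X w)).

Let size_js : (size js <= n)%N.
Proof. by rewrite -(card_uniqP uniq_js) -[leqRHS]card_ord max_card. Qed.

Lemma rounding_down_failure : m%:R <= (m%:R / n%:R) ^+ (2 ^ 10) :> R ->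
  (P [set w | sup_exceeds (rounding_bound n m sigma) (rounding_down js w)] <=
   (4 / m%:R ^+ 3)%:E)%E.
Proof.
move=> far; have ell_ge := ln_ratio_ge R n_gt0 mn.
pose y := 200 * (sigma * Num.sqrt (n%:R * ell)).
have y0 : 0 <= y by rewrite !mulr_ge0 ?sqrtr_ge0// ltW.
have sn : (size js)%:R <= n%:R :> R by rewrite ler_nat.
have lnm_le : ln m%:R <= 1024 * ell.
  by rewrite -ln_ratio_expn// ler_ln ?posrE ?exprn_gt0 ?divr_gt0.
have yE : y ^+ 2 / (8 * sigma ^+ 2 * n%:R) = 5000 * ell.
  rewrite /y !exprMn (sqr_sqrtr (n_ln_ratio_ge0 R n_gt0 mn)); field.
  by rewrite !gt_eqF.
apply: (@le_trans _ _ (P [set w | sup_exceeds y (rounding_down js w)])).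
  have mexceeds b : measurable [set w | sup_exceeds b (rounding_down js w)].
    by apply: measurable_bool_set; apply: measurable_sup_exceeds => i;
      exact: measurable_rounding_down.
  apply: le_measure; rewrite ?inE// => w /= /existsP[i bound_lt].
  apply/existsP; exists i; apply: le_lt_trans bound_lt.
  apply: le_trans (rounding_bound_ge n m sigma_gt0).
  by rewrite ler_wpM2r ?ler_nat// mulr_ge0 ?sqrtr_ge0// ltW.
apply: le_trans (rounding_down_tail uniq_js y0 nR sn _) _; first by rewrite yE; lra.
by rewrite lee_fin ler_wpM2r ?invr_ge0 ?exprn_ge0// ler_nat.
Qed.

Definition phases_disc (K : nat) (w : T) (i : 'I_m) : R :=
  disc_at w K i + rounding_down (rest K) w i.

Lemma measurable_phases_disc K i : measurable_fun setT (fun w => phases_disc K w i).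
Proof.
apply: measurable_funD; first exact: measurable_disc_at_entries.
exact: measurable_rounding_down.
Qed.

Section CloseRegime.
Hypothesis close : (m%:R / n%:R) ^+ (2 ^ 10) < m%:R :> R.
Variable K : nat.
Hypothesis K_le : (K <= size js)%N.
Hypothesis active_before : forall l, (l < K)%N -> active (size (rest l)).
Hypothesis inactive_at : ~~ active (size (rest K)).
Notation rho := (Num.sqrt n%:R : R).

Let rho2 : rho ^+ 2 = n%:R. Proof. by rewrite sqr_sqrtr// ltW. Qed.
Let rho_gt0 : 0 < rho. Proof. by rewrite sqrtr_gt0. Qed.

Lemma ln_m_le_rho : 2 ^+ 19 * ln m%:R <= rho.
Proof. exact: sqrt_n_ge. Qed.

Lemma rho_lt_size l : (l < K)%N -> rho < (size (rest l))%:R.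
Proof.
move=> /active_before/andP[n_lt _]; rewrite -(@ltr_pXn2r _ 2%N)// ?nnegrE ?(ltW rho_gt0)//.
by rewrite rho2 expr2 -natrM ltr_nat.
Qed.

Lemma size_le_rho : (size (rest K))%:R <= rho.
Proof.
move: inactive_at; rewrite /steering_range close andbT -leqNgt => n_ge.
rewrite -(@ler_pXn2r _ 2%N)// ?nnegrE ?(ltW rho_gt0)//.
by rewrite rho2 expr2 -natrM ler_nat.
Qed.

Lemma overflow_failure :
  (P [set w | overflow sigma S js K (disc_at w K)] <= ((m%:R ^+ 3)^-1)%:E)%E.
Proof.
have t_ge := ln_m_ge n_gt0 mn close; have rho_ge := ln_m_le_rho.
set t := ln m%:R in t_ge rho_ge.
have risks k : (k < K)%N -> (100 <= size (rest k))%N /\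
    phase_risk 'I_m sigma (size (rest k)) (thr_at k.+1 - thr_at k) <=
    expR (- (4%:R * t)).
  move=> kK; have size_gt := rho_lt_size kK.
  have r100 : (100 <= size (rest k))%N by rewrite -(ler_nat R); lra.
  split => //; rewrite thr_at_step.
  apply: (phase_risk_le (n := n) (m := m) (L := doublings n m)) => //.
  - exact: leq_trans r100.
  - exact: leq_trans (size_rest_expn2 js k) size_js.
  - exact: scale_ge.
  - exact: doublings_ge.
  - by apply: doublings_gt0; lia.
  - exact: card_ord.
  - by rewrite ler_pdivlMr ?exprn_gt0//; lra.
apply: le_trans (overflow_chain sigma_gt0 indepX gaussX f01 uniq_js risks) _.
rewrite lee_fin /t expRN_mul_ln// (_ : (m%:R ^+ 3)^-1 = m%:R * (m%:R ^+ 4)^-1 :> R).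
  by rewrite ler_wpM2r ?invr_ge0 ?exprn_ge0// ler_nat; lia.
by field; rewrite gt_eqF.
Qed.

Lemma rest_failure :
  (P [set w | sup_exceeds (sigma * rho) (rounding_down (rest K) w)] <=
   (2 / m%:R ^+ 3)%:E)%E.
Proof.
apply: rounding_down_tail rho_gt0 size_le_rho _; first exact: uniq_rest.
  by rewrite mulr_ge0 ?sqrtr_ge0// ltW.
have -> : (sigma * rho) ^+ 2 / (8 * sigma ^+ 2 * rho) = rho / 8.
  by field; rewrite !gt_eqF.
have := ln_m_ge n_gt0 mn close; have := ln_m_le_rho; lra.
Qed.

Lemma norm_disc_le_rounding_bound w : ~~ overflow sigma S js K (disc_at w K) ->
  ~~ sup_exceeds (sigma * rho) (rounding_down (rest K) w) ->
  ~~ sup_exceeds (rounding_bound n m sigma) (phases_disc K w).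
Proof.
move=> no_overflow /sup_exceedsPn rest_le; apply/sup_exceedsPn => i.
apply: le_trans (norm_disc_le sigma_gt0 no_overflow (rest_le i)) _.
apply: le_trans (rounding_bound_ge n m sigma_gt0).
set q := Num.sqrt (n%:R * ell).
have size_le : sigma * (size (rest K))%:R <= sigma * rho.
  by rewrite ler_pM2l// size_le_rho.
have scale_le : sigma * S%:R <= sigma * (4 * q).
  by rewrite ler_pM2l//; exact: scale_le_sqrt.
have rho_le : sigma * rho <= sigma * (2 * q) by rewrite ler_pM2l//; exact: sqrt_n_le.
have q0 : 0 <= sigma * q by rewrite mulr_ge0 ?sqrtr_ge0// ltW.
by move: scale_le rho_le; rewrite !(mulrCA sigma); lra.
Qed.

Lemma phases_failure :
  (P [set w | sup_exceeds (rounding_bound n m sigma) (phases_disc K w)] <=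
   (4 / m%:R ^+ 3)%:E)%E.
Proof.
have mover : measurable [set w | overflow sigma S js K (disc_at w K)].
  exact/measurable_bool_set/measurable_overflow_at.
have mrest : measurable [set w | sup_exceeds (sigma * rho) (rounding_down (rest K) w)].
  apply: measurable_bool_set; apply: measurable_sup_exceeds => i.
  exact: measurable_rounding_down.
apply: (@le_trans _ _ (P ([set w | overflow sigma S js K (disc_at w K)] `|`
    [set w | sup_exceeds (sigma * rho) (rounding_down (rest K) w)]))).
  apply: le_measure; rewrite ?inE; last first.
  - move=> w /=; apply: contraPP => /not_orP[/negP no_overflow /negP rest_le].
    exact/negP/norm_disc_le_rounding_bound.
  - exact: measurableU.
  - apply: measurable_bool_set; apply: measurable_sup_exceeds => i.
    exact: measurable_phases_disc.
apply: le_trans (measureU2 _ mover mrest) _.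
apply: le_trans (leeD overflow_failure rest_failure) _.
rewrite -EFinD lee_fin -[X in X + _]mul1r -mulrDl ler_wpM2r ?invr_ge0 ?exprn_ge0//.
lra.
Qed.

End CloseRegime.

Lemma last_active_phase : exists K,
  [/\ (K <= size js)%N,
      forall l, (l < K)%N -> active (size (rest l))
    & forall r, (r <= size (rest K))%N -> ~~ active r].
Proof.
have inactive_end : ~~ active (size (rest (size js))).
  have := size_rest_leq_sub js (size js); rewrite subnn leqn0 => /eqP ->.
  by rewrite /steering_range.
have ex_inactive : exists k, ~~ active (size (rest k)) by exists (size js).
case: (ex_minnP ex_inactive) => K inactiveK K_min; exists K; split.
- exact: K_min.
- by move=> l lK; apply/negPn/negP => /K_min; rewrite leqNgt lK.
- by move=> r rK; apply: contra inactiveK; exact: steering_range_mono.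
Qed.

Lemma walk_discrepancy :
  let good := [set w | forall i : 'I_m,
    `|disc (walk_cols sigma S active f (entries X w) (walk0 R 'I_m (size js)) js) i|
      <= rounding_bound n m sigma] in
  measurable good /\ ((1 - 4 / m%:R ^+ 3)%:E <= P good)%E.
Proof.
move=> good; have [K [K_le act inactive]] := last_active_phase.
pose bad := [set w | sup_exceeds (rounding_bound n m sigma) (phases_disc K w)].
have inactive0 : ~~ active 0 by rewrite /steering_range.
have goodE : good = ~` bad.
  apply/seteqP; split => w; rewrite /good /bad /=.
    move=> w_le; apply/negP/sup_exceedsPn => i.
    by have := w_le i; rewrite (disc_walk_cols _ _ _ inactive0 _ _ act inactive).
  move=> /negP/sup_exceedsPn w_le i.
  by rewrite (disc_walk_cols _ _ _ inactive0 _ _ act inactive); exact: w_le.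
have mbad : measurable bad.
  apply: measurable_bool_set; apply: measurable_sup_exceeds => i.
  exact: measurable_phases_disc.
rewrite goodE; split; first exact: measurableC.
have Pbad : (P bad <= (4 / m%:R ^+ 3)%:E)%E.
  have [far|close] := leP (m%:R : R) ((m%:R / n%:R) ^+ (2 ^ 10)); last first.
    exact: phases_failure K_le act (inactive _ (leqnn _)).
  have K0 : K = 0%N.
    case: K K_le act {inactive bad goodE mbad} => [//|K] _ /(_ 0%N isT).
    by rewrite /steering_range ltNge far andbF.
  apply: le_trans (rounding_down_failure far); rewrite /bad K0.
  suff -> : phases_disc 0 = rounding_down js by [].
  by apply/funext => w; apply/funext => i; rewrite /phases_disc add0r.
by rewrite probability_setC// EFinB; exact: leeB.
Qed.

End Discrepancy.

(** * Program logic *)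

Fixpoint written_regs (c : cmd) : seq nat :=
  match c with
  | CSetN x _ | CToss x => [:: x]
  | CSeq c1 c2 | CIf _ c1 c2 => written_regs c1 ++ written_regs c2
  | CWhile _ c1 => written_regs c1
  | CSkip | CSetR _ _ _ _ => [::]
  end.

Fixpoint written_arrays (c : cmd) : seq nat :=
  match c with
  | CSetR a _ _ _ => [:: a]
  | CSeq c1 c2 | CIf _ c1 c2 => written_arrays c1 ++ written_arrays c2
  | CWhile _ c1 => written_arrays c1
  | CSkip | CSetN _ _ | CToss _ => [::]
  end.

Fixpoint toss_free (c : cmd) : bool :=
  match c with
  | CToss _ => false
  | CSeq c1 c2 | CIf _ c1 c2 => toss_free c1 && toss_free c2
  | CWhile _ c1 => toss_free c1
  | CSkip | CSetN _ _ | CSetR _ _ _ _ => true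
  end.

Definition writes_within (xs arrs : seq nat) (c : cmd) : bool :=
  all (mem xs) (written_regs c) && all (mem arrs) (written_arrays c).

Section ProgramLogic.
Variable R : realType.
Implicit Types (s : state R) (c : cmd) (Q : state R -> Prop).

Definition agree_off (xs arrs : seq nat) s s' : Prop :=
  (forall x, x \notin xs -> nreg s' x = nreg s x) /\
  (forall a, a \notin arrs -> cell s' a = cell s a).

Definition unchanged c : state R -> state R -> Prop :=
  agree_off (written_regs c) (written_arrays c).

Lemma agree_off_trans xs arrs s1 s2 s3 :
  agree_off xs arrs s1 s2 -> agree_off xs arrs s2 s3 -> agree_off xs arrs s1 s3.
Proof.
move=> [regs12 cells12] [regs23 cells23]; split.
- by move=> x xN; rewrite regs23// regs12.
- by move=> a aN; rewrite cells23// cells12.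
Qed.

Lemma agree_off_set_nreg xs arrs s x v : x \in xs ->
  agree_off xs arrs s (set_nreg s x v).
Proof. by move=> xxs; split => // y yN /=; rewrite (negbTE (memPnC yN _ xxs)). Qed.

Lemma agree_off_set_cell xs arrs s a i j v : a \in arrs ->
  agree_off xs arrs s (set_cell s a i j v).
Proof.
move=> aarrs; split => // b bN; apply/funext => k; apply/funext => l /=.
by rewrite (negbTE (memPnC bN _ aarrs)).
Qed.

Lemma step_writes_within xs arrs coin k s : all (writes_within xs arrs) k ->
  all (writes_within xs arrs) (step coin (k, s)).1 /\
  agree_off xs arrs s (step coin (k, s)).2.
Proof.
case: k => [//|[|x e|a i j e|x|c1 c2|b c1 c2|b c1] k] /=; rewrite /writes_within/= ?andbT.
- by move=> ->.
- by move=> /andP[xxs ->]; split => //; exact: agree_off_set_nreg.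
- by move=> /andP[aarrs ->]; split => //; exact: agree_off_set_cell.
- move=> /andP[xxs ->]; split => //; exact: (agree_off_set_nreg _ _ _ xxs).
- by rewrite !all_cat => /andP[/andP[/andP[-> ->] /andP[-> ->]] ->].
- by rewrite !all_cat => /andP[/andP[/andP[? ?] /andP[? ?]] ->]; case: ifP => _;
    split => //; apply/andP; split => //; apply/andP.
- by move=> /andP[/andP[w1 w2] wk]; case: ifP => _ /=; split; rewrite ?w1 ?w2.
Qed.

Lemma iter_step_writes_within xs arrs coin t k s : all (writes_within xs arrs) k ->
  agree_off xs arrs s (iter t (step coin) (k, s)).2.
Proof.
move=> wk; suff [] : all (writes_within xs arrs) (iter t (step coin) (k, s)).1 /\
    agree_off xs arrs s (iter t (step coin) (k, s)).2 by [].
elim: t => [//|t]; rewrite iterS; case: (iter t _ _) => k' s' /= [wk' agree_s].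
have [wk'' agree_s'] := step_writes_within coin s' wk'.
by split => //; exact: agree_off_trans agree_s agree_s'.
Qed.

Lemma run_toss_free n m prog (I : instance R n m) coin t : toss_free prog ->
  run prog I coin t = run prog I (fun=> true) t.
Proof.
move=> tf; rewrite /run.
suff : let: (k, s) := iter t (step (fun=> true)) ([:: prog], init I) in
    all toss_free k /\ iter t (step coin) ([:: prog], init I) = (k, s).
  by case: (iter t (step (fun=> true)) _) => k s [].
elim: t => [|t]; first by rewrite /= tf.
rewrite !iterS; case: (iter t (step (fun=> true)) _) => k s [tk ->].
case: k tk => [|[|x e|a i j e|x|c1 c2|b c1 c2|b c1] k] //= /andP[tf_head tf_tail].
- by move/andP: tf_head => [-> ->].
- by move/andP: tf_head => [tf1 tf2]; case: (beval s b); rewrite ?tf1 ?tf2.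
- by case: (beval s b); rewrite /= ?tf_head ?tf_tail.
Qed.

Definition runs c s Q (B : nat) : Prop := exists s' t,
  [/\ forall k, iter t (step (fun=> true)) (c :: k, s) = (k, s'), (t <= B)%N
    & Q s'].

Lemma runs_unchanged c s Q B : runs c s Q B ->
  runs c s (fun s' => unchanged c s s' /\ Q s') B.
Proof.
move=> [s' [t [run_c tB Qs']]]; exists s', t; split => //; split => //.
have := @iter_step_writes_within (written_regs c) (written_arrays c) (fun=> true) t
  [:: c] s; rewrite run_c /= andbT; apply.
by apply/andP; split; apply/allP.
Qed.

Lemma runs_le c s Q B B' : (B <= B')%N -> runs c s Q B -> runs c s Q B'.
Proof.
by move=> BB' [s' [t [run_c tB Qs']]]; exists s', t; split => //; apply: leq_trans BB'.
Qed.

Lemma runs_weaken c s Q Q' B : (forall s', Q s' -> Q' s') -> runs c s Q B ->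
  runs c s Q' B.
Proof. by move=> QQ' [s' [t [run_c tB Qs']]]; exists s', t; split => //; exact: QQ'. Qed.

Lemma runs_skip s Q : Q s -> runs CSkip s Q 1.
Proof. by exists s, 1%N. Qed.

Lemma runs_setN s x e Q : Q (set_nreg s x (neval s e)) -> runs (CSetN x e) s Q 1.
Proof. by move=> Qs'; eexists; exists 1%N. Qed.

Lemma runs_setR s a i j e Q :
  Q (set_cell s a (neval s i) (neval s j) (reval s e)) ->
  runs (CSetR a i j e) s Q 1.
Proof. by move=> Qs'; eexists; exists 1%N. Qed.

Lemma runs_seq c1 c2 s Q1 Q B1 B2 : runs c1 s Q1 B1 ->
  (forall s1, unchanged c1 s s1 -> Q1 s1 -> runs c2 s1 Q B2) ->
  runs (CSeq c1 c2) s Q (B1 + B2).+1.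
Proof.
move=> /runs_unchanged[s1 [t1 [run1 tB1 [unchanged1 Qs1]]]] runs2.
have [s2 [t2 [run2 tB2 Qs2]]] := runs2 s1 unchanged1 Qs1.
exists s2, (t2 + t1).+1; split => //; last by lia.
by move=> k; rewrite iterSr /= iterD run1 run2.
Qed.

Lemma runs_setN_seq s x e c Q B : runs c (set_nreg s x (neval s e)) Q B ->
  runs (CSeq (CSetN x e) c) s Q B.+2.
Proof.
move=> runs_c; apply: (@runs_seq _ _ _ (eq (set_nreg s x (neval s e))) _ 1).
  exact: runs_setN.
by move=> _ _ <-.
Qed.

Lemma runs_setR_seq s a i j e c Q B :
  runs c (set_cell s a (neval s i) (neval s j) (reval s e)) Q B ->
  runs (CSeq (CSetR a i j e) c) s Q B.+2.
Proof.
move=> runs_c; apply: (@runs_seq _ _ _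
  (eq (set_cell s a (neval s i) (neval s j) (reval s e))) _ 1).
  exact: runs_setR.
by move=> _ _ <-.
Qed.

Lemma runs_if s b c1 c2 Q B : runs (if beval s b then c1 else c2) s Q B ->
  runs (CIf b c1 c2) s Q B.+1.
Proof.
move=> [s' [t [run_c tB Qs']]]; exists s', t.+1; split => // k.
by rewrite iterSr /= run_c.
Qed.

Lemma runs_while (Inv : nat -> state R -> Prop) N B b c s :
  (forall i s, (i <= N)%N -> Inv i s -> beval s b = (i < N)%N) ->
  (forall i s, (i < N)%N -> Inv i s -> runs c s (Inv i.+1) B) ->
  Inv 0 s -> runs (CWhile b c) s (Inv N) (N * B.+1).+1.
Proof.
move=> guardE runs_c.
suff runs_from k i s' : (i + k = N)%N -> Inv i s' ->
    runs (CWhile b c) s' (Inv N) (k * B.+1).+1.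
  by move=> Inv0; exact: (runs_from N 0%N).
elim: k i s' => [|k IH] i s' ikN Inv_i.
  rewrite addn0 in ikN; rewrite ikN in Inv_i; exists s', 1%N; split => // k.
  by rewrite /= (guardE N) ?ltnn.
have iN : (i < N)%N by lia.
have [s1 [t1 [run1 tB1 Inv1]]] := runs_c _ _ iN Inv_i.
have [|s2 [t2 [run2 tB2 Inv2]]] := IH i.+1 s1 _ Inv1; first by lia.
exists s2, (t2 + t1).+1; split => //; last by nia.
by move=> k'; rewrite iterSr /= (guardE i _ (ltnW iN) Inv_i) iN iterD run1 run2.
Qed.

End ProgramLogic.

Definition count_up (i : nat) (e : nexp) (c : cmd) : cmd :=
  CSeq (CSetN i (NConst 0))
    (CWhile (BLeN (NAdd (NReg i) (NConst 1)) e)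
      (CSeq c (CSetN i (NAdd (NReg i) (NConst 1))))).

Lemma runs_count_up (R : realType) (Inv : nat -> state R -> Prop) i e c s N B :
  i \notin written_regs c ->
  (forall s', unchanged (count_up i e c) s s' -> neval s' e = N) ->
  Inv 0%N (set_nreg s i 0) ->
  (forall k s', (k < N)%N -> unchanged (count_up i e c) s s' -> nreg s' i = k ->
     Inv k s' -> runs c s' (fun s'' => Inv k.+1 (set_nreg s'' i k.+1)) B) ->
  runs (count_up i e c) s (Inv N) (N * (B + 3)).+3.
Proof.
move=> iNc eE Inv0 runs_c; apply: runs_setN_seq.
pose LoopInv k s' := [/\ unchanged (count_up i e c) s s', nreg s' i = k & Inv k s'].
have Inv0' : LoopInv 0%N (set_nreg s i 0).
  split => //; last by rewrite /= eqxx.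
  by apply: agree_off_set_nreg; rewrite /= inE eqxx.
have runs_loop := runs_while (Inv := LoopInv) _ _ Inv0'.
apply: (@runs_le _ _ _ _ (N * (B + 2).+1).+1); first by lia.
apply: runs_weaken (runs_loop N (B + 2)%N _ _ _ _) => [s' []//||].
- by move=> k s' kN [unch ik _] /=; rewrite ik (eE _ unch) addn1.
move=> k s' kN [unch ik Inv_k].
apply: (@runs_le _ _ _ _ (B + 1).+1); first by lia.
apply: runs_seq (runs_c k s' kN unch ik Inv_k) _ => s'' unch' Inv_k'.
apply: runs_setN; rewrite /= unch'.1// ik addn1; split => //; last by rewrite /= eqxx.
apply: agree_off_trans unch _.
apply: (@agree_off_trans _ _ _ _ s''); last first.
  by apply: agree_off_set_nreg; rewrite /= inE eqxx.
split => [x xN|a aN].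
  by rewrite unch'.1//; apply: contra xN => xc; rewrite /= inE mem_cat xc orbT.
by rewrite unch'.2//; apply: contra aN => ac; rewrite /= mem_cat ac.
Qed.

(** * The program *)

Lemma take_enumS p j (jp : (j < p)%N) :
  take j.+1 (enum 'I_p) = rcons (take j (enum 'I_p)) (Ordinal jp).
Proof.
rewrite (take_nth (Ordinal jp)) ?size_enum_ord//; congr rcons.
exact: (nth_ord_enum (Ordinal jp) (Ordinal jp)).
Qed.

Lemma sum_ord_ltnS (V : nmodType) p (F : 'I_p -> V) i (ip : (i < p)%N) :
  \sum_(k < p | (k < i.+1)%N) F k = \sum_(k < p | (k < i)%N) F k + F (Ordinal ip).
Proof.
rewrite (bigD1 (Ordinal ip)) ?ltnS//= addrC; congr (_ + _).
by apply: eq_bigl => k; rewrite -val_eqE/=; lia.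
Qed.

(* Registers: j, i loop indices; r, l the fields remaining and pos of the walk;
   L, p, S the doublings, n 2^L and the scale.  Arrays: 4 the output, 5 and 6 the
   fields disc and dir, 7 the threshold, 8 the power of m / n, 9 the inner product
   <v, a>, 10 the squared norm of v. *)
Section Program.
Notation rn := (NReg 0). Notation rm := (NReg 1). Notation rj := (NReg 2).
Notation ri := (NReg 3). Notation rr := (NReg 4). Notation rl := (NReg 5).
Notation rL := (NReg 6). Notation rp := (NReg 7). Notation rS := (NReg 8).
Notation K := NConst.
Notation "a +n b" := (NAdd a b) (at level 50).
Notation "a *r b" := (RMul a b) (at level 40).
Notation "a +r b" := (RAdd a b) (at level 50).
Notation xout := (RCell 4 rj (K 0)).
Notation x0j := (RCell 1 rj (K 0)).
Notation flj := (RCell 2 rj (K 0)).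
Notation Aij := (RCell 0 ri rj).
Notation sg := (RCell 3 (K 0) (K 0)).
Notation di := (RCell 5 ri (K 0)).
Notation vi := (RCell 6 ri (K 0)).
Notation cT := (RCell 7 (K 0) (K 0)).
Notation cz := (RCell 8 (K 0) (K 0)).
Notation ch := (RCell 9 (K 0) (K 0)).
Notation cw := (RCell 10 (K 0) (K 0)).
Notation "c1 ;; c2" := (CSeq c1 c2) (at level 61, right associativity).
Notation nonint := (BNot (BLeR x0j flj)).

Definition prog_floor : cmd :=
  count_up 2 rn
    (CIf nonint (CSetN 4 (rr +n K 1)) CSkip ;; CSetR 4 rj (K 0) flj).

Definition prog_doublings : cmd :=
  CSetN 7 rn ;;
  CWhile (BLeN (rp +n K 1) rm) (CSetN 7 (rp +n rp) ;; CSetN 6 (rL +n K 1)).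

Definition prog_scale : cmd :=
  CWhile (BNot (BLeR (RNat rn *r RNat rL) (RNat rS *r RNat rS)))
    (CSetN 8 (rS +n K 1)).

Definition prog_ratio_power : cmd :=
  CSetR 8 (K 0) (K 0) (RNat rm *r RInv (RNat rn)) ;;
  count_up 3 (K 10) (CSetR 8 (K 0) (K 0) (cz *r cz)).

Definition prog_inner_product : cmd :=
  CSetR 9 (K 0) (K 0) (RNat (K 0)) ;;
  count_up 3 rm (CSetR 9 (K 0) (K 0) (ch +r (vi *r Aij))).

Definition budget_test : bexp :=
  BNot (BLeR (RNat (K 25) *r cw)
    ((RNat (K 2) *r sg *r RNat rl) *r (RNat (K 2) *r sg *r RNat rl))).

Definition prog_round : cmd :=
  CIf (BAnd budget_test (BLeR ch (RNat (K 0))))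
    (CSetR 4 rj (K 0) (flj +r RNat (K 1))) CSkip.

Definition prog_disc : cmd :=
  count_up 3 rm (CSetR 5 ri (K 0) (di +r (Aij *r (xout +r ROpp x0j)))).

Definition steering_test : bexp :=
  BAnd (BNot (BLeR (RNat rr *r RNat rr) (RNat rn))) (BNot (BLeR (RNat rm) cz)).

Definition prog_excess : cmd :=
  CIf (BNot (BLeR di cT)) (CSetR 6 ri (K 0) (di +r ROpp cT))
    (CIf (BNot (BLeR (ROpp cT) di)) (CSetR 6 ri (K 0) (di +r cT))
      (CSetR 6 ri (K 0) (RNat (K 0)))).

Definition prog_dir : cmd :=
  CSetR 10 (K 0) (K 0) (RNat (K 0)) ;;
  count_up 3 rm
    (CIf steering_test prog_excess (CSetR 6 ri (K 0) (RNat (K 0))) ;;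
     CSetR 10 (K 0) (K 0) (cw +r (vi *r vi))).

Definition prog_tick : cmd :=
  CSetN 5 (rl +n K 1) ;;
  CIf (BLeN rr (rl +n rl))
    (CSetN 4 (NSub rr rl) ;;
     CSetN 5 (K 0) ;;
     CSetR 7 (K 0) (K 0) (RNat (K 3) *r RInv (RNat (K 4)) *r cT +r
        (RNat (K 16) *r (sg *r RNat rS))) ;;
     prog_dir)
    CSkip.

Definition prog_column : cmd :=
  prog_inner_product ;; prog_round ;; prog_disc ;; prog_tick.

Definition prog_walk : cmd := count_up 2 rn (CIf nonint prog_column CSkip).

Definition prog_parameters : cmd := prog_doublings ;; prog_scale ;; prog_ratio_power.

Definition rounding_program : cmd := prog_floor ;; prog_parameters ;; prog_walk.

Section Correctness.
Variables (R : realType) (n m : nat) (sigma : R).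
Variables (A : 'M[R]_(m, n)) (x0 : 'cV[R]_n).
Hypotheses (n_gt0 : (0 < n)%N) (m_le : (m <= 2 ^ n)%N).
Notation init_state := (init (Instance sigma A x0)).
Notation ratio_pow k := ((m%:R / n%:R : R) ^+ (2 ^ k)).
Notation adv := (advance sigma (scale n m) (steering_range n m R)).

Definition fl (j : 'I_n) : R := (Num.floor (x0 j 0))%:~R.
Definition frac (j : 'I_n) : R := x0 j 0 - fl j.
Definition fractional (j : 'I_n) : bool := fl j < x0 j 0.
Definition fractional_cols : seq 'I_n := [seq j <- enum 'I_n | fractional j].
Definition column (j : 'I_n) (i : 'I_m) : R := A i j.

Definition inputs (s : state R) : Prop :=
  [/\ nreg s 0 = n, nreg s 1 = m
    & forall a, (a < 4)%N -> cell s a = cell init_state a].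

Lemma inputs_unchanged c s s' : unchanged c s s' ->
  all (leq 2) (written_regs c) -> all (leq 4) (written_arrays c) ->
  inputs s -> inputs s'.
Proof.
move=> [regsE cellsE] /allP regs_ge2 /allP arrays_ge4 [sn sm sin].
split; rewrite ?regsE//; try by apply/negP => /regs_ge2.
move=> a a4; rewrite cellsE ?sin//; apply/negP => /arrays_ge4.
by rewrite leqNgt a4.
Qed.

Lemma mx_cellsE p q (M : 'M[R]_(p, q)) (i : 'I_p) (j : 'I_q) :
  mx_cells M i j = M i j.
Proof. by rewrite /mx_cells !valK. Qed.

Lemma cell_A s (i : 'I_m) (j : 'I_n) : inputs s -> cell s 0 i j = A i j.
Proof. by case=> _ _ ->//; exact: mx_cellsE. Qed.

Lemma cell_x0 s (j : 'I_n) : inputs s -> cell s 1 j 0 = x0 j 0.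
Proof. by case=> _ _ ->//; exact: (mx_cellsE _ j ord0). Qed.

Lemma cell_fl s (j : 'I_n) : inputs s -> cell s 2 j 0 = fl j.
Proof. by case=> _ _ ->//; rewrite /= (mx_cellsE _ j ord0) mxE. Qed.

Lemma cell_sigma s : inputs s -> cell s 3 0 0 = sigma.
Proof. by case=> _ _ ->. Qed.

Lemma nonintE s j (jn : (j < n)%N) : inputs s -> nreg s 2 = j ->
  beval s nonint = fractional (Ordinal jn).
Proof.
move=> s_in sj /=; rewrite sj (cell_x0 (Ordinal jn) s_in) (cell_fl (Ordinal jn) s_in).
by rewrite -ltNge.
Qed.

Lemma inputs_init : inputs init_state.
Proof. by []. Qed.

Lemma runs_floor : runs prog_floor init_state
  (fun s => (forall j : 'I_n, cell s 4 j 0 = fl j) /\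
     nreg s 4 = size fractional_cols) (n * 7 + 3).
Proof.
pose Inv j s := (forall k : 'I_n, (k < j)%N -> cell s 4 k 0 = fl k) /\
  nreg s 4 = count fractional (take j (enum 'I_n)).
apply: (@runs_le _ _ _ _ (n * (4 + 3)).+3); first by lia.
apply: (@runs_weaken _ _ _ (Inv n)) => [s [sx sr]|].
  by split=> [j|]; rewrite ?sx// sr take_oversize ?size_enum_ord// size_filter.
apply: runs_count_up => //.
- by move=> s [regsE _] /=; rewrite regsE.
- by split => //; rewrite take0.
move=> j s jn unch sj [sx sr].
have s_in : inputs s := inputs_unchanged unch isT isT inputs_init.
have countE : (nreg s 4 + fractional (Ordinal jn))%N =
    count fractional (take j.+1 (enum 'I_n)).
  by rewrite sr (take_enumS jn) -cats1 count_cat/= addn0.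
apply: (@runs_seq _ _ _ _
  (fun s' => nreg s' 4 = (nreg s 4 + fractional (Ordinal jn))%N) _ 2 1).
  apply: runs_if; rewrite (nonintE jn s_in sj).
  by case: (fractional _); [exact: runs_setN|apply: runs_skip; rewrite addn0].
move=> s1 unch1 s1r; have s1_in := inputs_unchanged unch1 isT isT s_in.
apply: runs_setR; split => [k|] /=; last by rewrite s1r countE.
rewrite andbT unch1.1// sj ltnS leq_eqVlt; case: eqP => [kj _|_ /= kj].
  by rewrite -kj cell_fl.
by rewrite unch1.2// sx.
Qed.

Lemma runs_doublings s : inputs s -> nreg s 6 = 0%N ->
  runs prog_doublings s (fun s' => nreg s' 6 = doublings n m) (n * 4 + 3).
Proof.
move=> [sn sm _] sL.
have L_le := doublings_le n_gt0 m_le.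
apply: (@runs_le _ _ _ _ (doublings n m * 4).+3); first by lia.
apply: runs_setN_seq.
pose Inv i (s' : state R) := [/\ nreg s' 1 = m, nreg s' 6 = i & nreg s' 7 = (n * 2 ^ i)%N].
apply: (@runs_weaken _ _ _ (Inv (doublings n m))) => [s' []//|].
apply: runs_while => [i s' i_le [s'm s'L s'p]|i s' i_lt [s'm s'L s'p]|] /=.
- by rewrite s'm s'p addn1 ltnNge -doublings_leq// -ltnNge.
- apply: runs_setN_seq; apply: runs_setN; split => //=.
    by rewrite s'L addn1.
  by rewrite s'p expnS; lia.
- by split => //=; rewrite sn expn0 muln1.
Qed.

Lemma runs_scale s : inputs s -> nreg s 6 = doublings n m -> nreg s 8 = 0%N ->
  runs prog_scale s (fun s' => nreg s' 8 = scale n m) (n * n * 2).+1.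
Proof.
move=> [sn _ _] sL sS.
have S_le := scale_le n_gt0 m_le.
apply: (@runs_le _ _ _ _ (scale n m * 2).+1); first by lia.
pose Inv i (s' : state R) := [/\ nreg s' 0 = n, nreg s' 6 = doublings n m & nreg s' 8 = i].
apply: (@runs_weaken _ _ _ (Inv (scale n m))) => [s' []//|].
apply: runs_while => [i s' i_le [s'n s'L s'S]|i s' i_lt [s'n s'L s'S]|//] /=.
- by rewrite s'n s'L s'S -!natrM ler_nat -ceil_sqrt_leq ltnNge.
- by apply: runs_setN; split => //=; rewrite s'S addn1.
Qed.

Lemma runs_ratio_power s : inputs s ->
  runs prog_ratio_power s (fun s' => cell s' 8 0 0 = ratio_pow 10) 45.
Proof.
move=> [sn sm _]; apply: runs_setR_seq.
apply: (runs_count_up (Inv := fun i s' => cell s' 8 0 0 = ratio_pow i)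
  (N := 10) (B := 1)) => //=.
- by rewrite sn sm expr1.
- move=> i s' _ _ _ s'z; apply: runs_setR.
  by rewrite /= s'z -expr2 -exprM expnSr.
Qed.

Definition ready (s : state R) : Prop :=
  [/\ inputs s, nreg s 8 = scale n m & cell s 8 0 0 = ratio_pow 10].

Lemma ready_unchanged c s s' : unchanged c s s' ->
  all (leq 2) (written_regs c) && (8 \notin written_regs c) ->
  all (leq 4) (written_arrays c) && (8 \notin written_arrays c) ->
  ready s -> ready s'.
Proof.
move=> unch /andP[regs2 reg8] /andP[arrays4 array8] [s_in sS sz].
by split; [exact: inputs_unchanged unch _ _ s_in|rewrite unch.1|rewrite unch.2].
Qed.

Lemma runs_parameters s : inputs s -> nreg s 6 = 0%N -> nreg s 8 = 0%N ->
  runs prog_parameters s ready (n * n * 2 + n * 4 + 51).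
Proof.
move=> s_in sL sS.
apply: (@runs_le _ _ _ _ ((n * 4 + 3) + ((n * n * 2).+1 + 45).+1).+1); first by lia.
apply: runs_seq (runs_doublings s_in sL) _ => s1 unch1 s1L.
have s1_in := inputs_unchanged unch1 isT isT s_in.
have s1S : nreg s1 8 = 0%N by rewrite unch1.1.
apply: runs_seq (runs_scale s1_in s1L s1S) _ => s2 unch2 s2S.
have s2_in := inputs_unchanged unch2 isT isT s1_in.
apply: runs_weaken (runs_unchanged (runs_ratio_power s2_in)) => s' [unch' s'z].
by split; [exact: inputs_unchanged unch' isT isT s2_in|rewrite unch'.1|].
Qed.

Definition tracks (s : state R) (w : walk R 'I_m) : Prop :=
  [/\ forall i : 'I_m, cell s 5 i 0 = disc w i,
      forall i : 'I_m, cell s 6 i 0 = dir w i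
    & cell s 10 0 0 = sqnorm (dir w)] /\
  [/\ cell s 7 0 0 = thr w, nreg s 4 = remaining w & nreg s 5 = pos w].

Lemma tracks_unchanged c s s' w : unchanged c s s' ->
  all (predC (mem (written_regs c))) [:: 4; 5]%N ->
  all (predC (mem (written_arrays c))) [:: 5; 6; 7; 10]%N ->
  tracks s w -> tracks s' w.
Proof.
move=> [regsE cellsE] /and3P[reg4 reg5 _] /and5P[a5 a6 a7 a10 _].
by move=> [[sd sv sw] [sT sr sl]]; split; split => *; rewrite ?cellsE ?regsE//.
Qed.

Lemma runs_inner_product s w j (jn : (j < n)%N) :
  inputs s -> nreg s 2 = j -> tracks s w ->
  runs prog_inner_product s
    (fun s' => cell s' 9 0 0 = dot (dir w) (column (Ordinal jn))) (m * 4 + 5).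
Proof.
move=> s_in sj [[_ sv _] _].
apply: (@runs_le _ _ _ _ (m * (1 + 3)).+3.+2); first by lia.
apply: runs_setR_seq; set s1 := set_cell _ _ _ _ _.
have unch1 : unchanged (CSetR 9 (K 0) (K 0) (RNat (K 0))) s s1.
  by apply: agree_off_set_cell; rewrite inE.
have s1_in := inputs_unchanged unch1 isT isT s_in.
pose Inv i s' := cell s' 9 0 0 =
  \sum_(k < m | (k < i)%N) dir w k * column (Ordinal jn) k.
apply: (@runs_weaken _ _ _ (Inv m)) => [s' ->|].
  by apply: eq_bigl => i; rewrite ltn_ord.
apply: (runs_count_up (Inv := Inv) (B := 1)) => //.
- by move=> s' unch /=; rewrite unch.1//; case: s_in.
- by rewrite /Inv /= big_pred0.
move=> i s' im unch s'i s'h; have s'_in := inputs_unchanged unch isT isT s1_in.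
apply: runs_setR; rewrite /Inv /= s'h s'i sum_ord_ltnS /column.
rewrite (unch.1 2)// (unch.2 6)// -(sv (Ordinal im)).
by rewrite -(cell_A (Ordinal im) (Ordinal jn) s'_in) /= sj.
Qed.

Lemma budget_testE s w : inputs s -> tracks s w ->
  beval s budget_test = within_budget sigma (dir w) (pos w).
Proof.
move=> s_in [[_ _ sw] [_ _ sl]].
by rewrite /= sw sl (cell_sigma s_in) -expr2 -ltNge.
Qed.

Lemma runs_round s w j (jn : (j < n)%N) :
  inputs s -> nreg s 2 = j -> tracks s w -> cell s 4 j 0 = fl (Ordinal jn) ->
  cell s 9 0 0 = dot (dir w) (column (Ordinal jn)) ->
  runs prog_round s (fun s' =>
    cell s' 4 j 0 = fl (Ordinal jn) +
      (steers sigma (dir w) (pos w) (column (Ordinal jn)))%:R /\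
    forall k, k != j -> cell s' 4 k 0 = cell s 4 k 0) 2.
Proof.
move=> s_in sj sw sx sh; apply: runs_if.
have -> : beval s (BAnd budget_test (BLeR ch (RNat (K 0)))) =
    steers sigma (dir w) (pos w) (column (Ordinal jn)).
  by rewrite /steers -(budget_testE s_in sw) -sh.
case: (steers _ _ _ _); last by apply: runs_skip; rewrite addr0.
apply: runs_setR; split => [|k kj] /=; rewrite sj ?(negbTE kj)// eqxx/=.
by rewrite (cell_fl (Ordinal jn) s_in).
Qed.

Lemma runs_disc s w j (jn : (j < n)%N) (up : bool) :
  inputs s -> nreg s 2 = j -> tracks s w -> cell s 4 j 0 = fl (Ordinal jn) + up%:R ->
  runs prog_disc s (fun s' => tracks s' (move w
    (fun i => column (Ordinal jn) i * (up%:R - frac (Ordinal jn))))) (m * 4 + 3).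
Proof.
move=> s_in sj [[sd sv sw] [sT sr sl]] sx.
have sx' : cell s 4 j 0 - x0 (Ordinal jn) 0 = up%:R - frac (Ordinal jn).
  by rewrite sx /frac opprB addrCA addrA.
apply: (@runs_le _ _ _ _ (m * (1 + 3)).+3); first by lia.
pose Inv i s' := forall k : 'I_m, cell s' 5 k 0 = disc w k +
  if (k < i)%N then column (Ordinal jn) k * (up%:R - frac (Ordinal jn)) else 0.
suff runs_loop : runs prog_disc s (Inv m) (m * (1 + 3)).+3.
  apply: runs_weaken (runs_unchanged runs_loop) => s' [unch s'd].
  by split; split => *; rewrite ?s'd ?ltn_ord ?(unch.2 6)// ?(unch.2 7)// ?(unch.2 10)//
    ?unch.1.
apply: runs_count_up => //.
- by move=> s' unch /=; rewrite unch.1//; case: s_in.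
- by move=> k; rewrite /= sd addr0.
move=> i s' im unch s'i s'd; have s'_in := inputs_unchanged unch isT isT s_in.
apply: runs_setR => k /=.
rewrite andbT s'i ltnS leq_eqVlt; case: eqP => [ki|_]; last exact: s'd.
rewrite -ki s'd -ki ltnn addr0 (unch.1 2)// sj (unch.2 4)//.
by rewrite (cell_A k (Ordinal jn) s'_in) (cell_x0 (Ordinal jn) s'_in) sx'.
Qed.

Lemma steering_testE s : ready s ->
  beval s steering_test = steering_range n m R (nreg s 4).
Proof.
move=> [[sn sm _] _ sz].
by rewrite /= sn sm sz -natrM ler_nat -ltnNge -ltNge.
Qed.

Lemma runs_excess (s : state R) : runs prog_excess s
  (eq (set_cell s 6 (nreg s 3) 0 (excess (cell s 7 0 0) (cell s 5 (nreg s 3) 0)))) 3.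
Proof.
rewrite /excess; apply: runs_if; rewrite /= -ltNge; case: ifP => _.
  by apply: (@runs_le _ _ _ _ 1) => //; exact: runs_setR.
apply: runs_if; rewrite /= -ltNge; case: ifP => _; exact: runs_setR.
Qed.

Definition next_dir (s : state R) (i : nat) : R :=
  if steering_range n m R (nreg s 4) then excess (cell s 7 0 0) (cell s 5 i 0) else 0.

Lemma runs_dir s : ready s ->
  runs prog_dir s (fun s' => (forall i : 'I_m, cell s' 6 i 0 = next_dir s i) /\
    cell s' 10 0 0 = sqnorm (fun i : 'I_m => next_dir s i)) (m * 9 + 5).
Proof.
move=> s_ready; apply: (@runs_le _ _ _ _ (m * (6 + 3)).+3.+2); first by lia.
apply: runs_setR_seq; set s1 := set_cell _ _ _ _ _.
have unch1 : unchanged (CSetR 10 (K 0) (K 0) (RNat (K 0))) s s1.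
  by apply: agree_off_set_cell; rewrite inE.
have s1_ready := ready_unchanged unch1 isT isT s_ready.
pose Inv i s' := (forall k : 'I_m, (k < i)%N -> cell s' 6 k 0 = next_dir s k) /\
  cell s' 10 0 0 = \sum_(k < m | (k < i)%N) next_dir s k * next_dir s k.
apply: (@runs_weaken _ _ _ (Inv m)) => [s' [s'v ->]|].
  by split=> [i|]; [exact: s'v|apply: eq_bigl => i; rewrite ltn_ord].
apply: (runs_count_up (Inv := Inv) (B := 6)) => //.
- by move=> s' unch /=; rewrite unch.1//; case: s_ready => -[].
- by split => //=; rewrite big_pred0.
move=> i s' im unch s'i [s'v s'w].
have s'_ready := ready_unchanged unch isT isT s1_ready.
have s'E : next_dir s' =1 next_dir s.
  by move=> k; rewrite /next_dir unch.1// !unch.2.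
apply: (@runs_seq _ _ _ _ (eq (set_cell s' 6 (nreg s' 3) 0 (next_dir s' (nreg s' 3)))) _ 4 1).
  apply: runs_if; rewrite (steering_testE s'_ready) /next_dir.
  case: ifP => _; first exact: runs_excess.
  by apply: (@runs_le _ _ _ _ 1) => //; exact: runs_setR.
move=> s2 _ <-; apply: runs_setR; rewrite /Inv /= s'i s'E eqxx/=; split => [k|].
  by rewrite andbT ltnS leq_eqVlt; case: eqP => [->//|_ /= /s'v].
by rewrite eqxx/= s'w (sum_ord_ltnS _ im).
Qed.

Lemma runs_tick s w : ready s -> tracks s w ->
  runs prog_tick s
    (fun s' => tracks s' (tick sigma (scale n m) (steering_range n m R) w)) (m * 9 + 14).
Proof.
move=> s_ready [[sd sv sw] [sT sr sl]].
apply: (@runs_le _ _ _ _ (m * 9 + 5).+2.+2.+2.+1.+2); first by lia.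
apply: runs_setN_seq; apply: runs_if; rewrite /= sl sr addn1 /tick.
case: ifP => _; last by apply: (@runs_le _ _ _ _ 1) => //; apply: runs_skip.
apply: runs_setN_seq; apply: runs_setN_seq; apply: runs_setR_seq.
set s1 := set_cell _ _ _ _ _; have [[sn sm sin] sS sz] := s_ready.
have s1_ready : ready s1.
  split => //; split => // a a4; rewrite -sin//.
  by apply/funext => i; apply/funext => j /=; rewrite (ltn_eqF (ltn_trans a4 _)).
have s1T : cell s1 7 0 0 = next_thr sigma (scale n m) (thr w).
  by rewrite /= sT sS sin.
have s1r : nreg s1 4 = (remaining w - (pos w).+1)%N by rewrite /= sr.
apply: runs_weaken (runs_unchanged (runs_dir s1_ready)) => s' [unch [s'v s'w]].
have dirE (i : 'I_m) : next_dir s1 i =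
    dir (start_phase sigma (scale n m) (steering_range n m R) w
      (remaining w - (pos w).+1)) i.
  by rewrite /next_dir s1T s1r /= sd.
split; split => /=.
- by move=> i; rewrite unch.2//= sd.
- by move=> i; rewrite s'v dirE.
- by rewrite s'w; apply: eq_bigr => i _; rewrite dirE.
- by rewrite unch.2.
- by rewrite unch.1//= s1r.
- by rewrite unch.1.
Qed.

Lemma runs_column s w j (jn : (j < n)%N) :
  ready s -> nreg s 2 = j -> cell s 4 j 0 = fl (Ordinal jn) -> tracks s w ->
  runs prog_column s (fun s' =>
    [/\ tracks s' (adv w (frac (Ordinal jn)) (column (Ordinal jn))),
      cell s' 4 j 0 = fl (Ordinal jn) +
        (steers sigma (dir w) (pos w) (column (Ordinal jn)))%:R &
      forall k, k != j -> cell s' 4 k 0 = cell s 4 k 0]) (m * 17 + 27).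
Proof.
move=> s_ready sj sx sw; have [s_in _ _] := s_ready.
apply: (@runs_le _ _ _ _ ((m * 4 + 5) + (2 + ((m * 4 + 3) + (m * 9 + 14)).+1).+1).+1);
  first by lia.
apply: runs_seq (runs_inner_product jn s_in sj sw) _ => s1 unch1 s1h.
have s1_ready := ready_unchanged unch1 isT isT s_ready.
have s1w := tracks_unchanged unch1 isT isT sw.
have s1j : nreg s1 2 = j by rewrite unch1.1.
have s1x : cell s1 4 j 0 = fl (Ordinal jn) by rewrite unch1.2.
have [s1_in _ _] := s1_ready.
apply: runs_seq (runs_round s1_in s1j s1w s1x s1h) _ => s2 unch2 [s2x s2x'].
have s2_ready := ready_unchanged unch2 isT isT s1_ready; have [s2_in _ _] := s2_ready.
have s2w := tracks_unchanged unch2 isT isT s1w.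
have s2j : nreg s2 2 = j by rewrite unch2.1.
apply: runs_seq (runs_disc s2_in s2j s2w s2x) _ => s3 unch3 s3w.
have s3_ready := ready_unchanged unch3 isT isT s2_ready.
apply: runs_weaken (runs_unchanged (runs_tick s3_ready s3w)) => s' [unch' s'w].
split => [//||k kj]; rewrite unch'.2// unch3.2//.
by rewrite s2x'// unch1.2.
Qed.

Definition walk_to (j : nat) : walk R 'I_m :=
  walk_cols sigma (scale n m) (steering_range n m R) frac column
    (walk0 R 'I_m (size fractional_cols)) [seq k <- take j (enum 'I_n) | fractional k].

Definition rounds_up (j : 'I_n) : bool :=
  fractional j && steers sigma (dir (walk_to j)) (pos (walk_to j)) (column j).

Definition walk_output : 'cV[R]_n := \col_j (fl j + (rounds_up j)%:R).

Lemma walk_toS j (jn : (j < n)%N) : walk_to j.+1 =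
  if fractional (Ordinal jn) then adv (walk_to j) (frac (Ordinal jn)) (column (Ordinal jn))
  else walk_to j.
Proof.
rewrite /walk_to (take_enumS jn) filter_rcons; case: ifP => // _.
by rewrite /walk_cols foldl_rcons.
Qed.

Lemma ceil_fractional (j : 'I_n) : fractional j ->
  fl j + 1 = (Num.ceil (x0 j 0))%:~R.
Proof.
rewrite /fractional /fl => fl_lt.
rewrite (_ : Num.ceil (x0 j 0) = Num.floor (x0 j 0) + 1) ?intrD//.
by apply: ceil_def; rewrite addrK fl_lt ltW// floorD1_gt.
Qed.

Lemma walk_output_rounding : is_rounding x0 walk_output.
Proof.
move=> j; rewrite mxE /rounds_up; case: (boolP (fractional j)) => [frac_j|_] /=.
  by case: (steers _ _ _ _); rewrite ?addr0; [right; exact: ceil_fractional|left].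
by left; rewrite addr0.
Qed.

Lemma disc_walk_to j i : (j <= n)%N ->
  disc (walk_to j) i = \sum_(k < n | (k < j)%N) A i k * (walk_output k 0 - x0 k 0).
Proof.
elim: j => [_|j IH jn].
  by rewrite /walk_to take0 big_pred0.
rewrite (sum_ord_ltnS _ jn) -IH ?(ltnW jn)// walk_toS mxE /rounds_up.
case: ifP => [_|/negbT]; rewrite /= -addrA.
  rewrite disc_advance; congr (_ + _); rewrite /column_error /frac /column.
  by rewrite opprB addrCA addrA.
rewrite /fractional -leNgt => x0_le; suff -> : x0 (Ordinal jn) 0 = fl (Ordinal jn).
  by rewrite add0r subrr mulr0 addr0.
by apply/le_anti; rewrite x0_le floor_le.
Qed.

Lemma walk_output_disc i : \sum_(j < n) A i j * (walk_output j 0 - x0 j 0) =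
  disc (walk_cols sigma (scale n m) (steering_range n m R) frac column
    (walk0 R 'I_m (size fractional_cols)) fractional_cols) i.
Proof.
have := disc_walk_to i (leqnn n); rewrite /walk_to take_oversize ?size_enum_ord// => ->.
by apply: eq_bigl => j; rewrite ltn_ord.
Qed.

Lemma runs_walk s : ready s -> tracks s (walk_to 0) ->
  (forall j : 'I_n, cell s 4 j 0 = fl j) ->
  runs prog_walk s (fun s' => output n s' = walk_output) (n * (m * 17 + 31) + 3).
Proof.
move=> s_ready s_walk0 sx.
apply: (@runs_le _ _ _ _ (n * ((m * 17 + 27).+1 + 3)).+3); first by lia.
pose Inv j s' := tracks s' (walk_to j) /\
  forall k : 'I_n, cell s' 4 k 0 = fl k + ((k < j)%N && rounds_up k)%:R.
apply: (@runs_weaken _ _ _ (Inv n)) => [s' [_ s'x]|].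
  by apply/colP => j; rewrite !mxE s'x ltn_ord.
apply: runs_count_up => //.
- by move=> s' unch /=; rewrite unch.1//; case: s_ready => -[].
- by split => // k; rewrite addr0 -sx.
move=> j s' jn unch s'j [s'w s'x]; have s'_ready := ready_unchanged unch isT isT s_ready.
have [s'_in _ _] := s'_ready.
have s'xj : cell s' 4 j 0 = fl (Ordinal jn) by rewrite (s'x (Ordinal jn)) ltnn addr0.
apply: runs_if; rewrite (nonintE jn s'_in s'j).
have InvS s'' : tracks s'' (walk_to j.+1) ->
    cell s'' 4 j 0 = fl (Ordinal jn) + (rounds_up (Ordinal jn))%:R ->
    (forall k, k != j -> cell s'' 4 k 0 = cell s' 4 k 0) ->
    Inv j.+1 (set_nreg s'' 2 j.+1).
  move=> s''w s''xj s''x; split => // k /=; rewrite ltnS leq_eqVlt.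
  have [kj|kj] := eqVneq (k : nat) j; last by rewrite s''x.
  by rewrite /= kj s''xj; congr (fl _ + (rounds_up _)%:R); exact: val_inj.
have := InvS; rewrite walk_toS /rounds_up; case: ifP => [frac_j|_] InvSj.
  apply: runs_weaken (runs_column s'_ready s'j s'xj s'w) => s'' [*]; exact: InvSj.
apply: (@runs_le _ _ _ _ 1); first by lia.
by apply: runs_skip; apply: InvSj; rewrite ?addr0.
Qed.

Definition time_bound : nat := n * (m * 17 + 31) + n * n * 2 + n * 11 + 59.

Lemma runs_rounding_program :
  runs rounding_program init_state (fun s => output n s = walk_output) time_bound.
Proof.
apply: (@runs_le _ _ _ _ ((n * 7 + 3) + ((n * n * 2 + n * 4 + 51) +
  (n * (m * 17 + 31) + 3)).+1).+1); first by rewrite /time_bound; lia.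
apply: runs_seq runs_floor _ => s1 unch1 [s1x s1r].
have s1_in := inputs_unchanged unch1 isT isT inputs_init.
have s1_walk0 : tracks s1 (walk_to 0).
  rewrite /walk_to take0; split; split => *; rewrite ?s1r ?unch1.1 ?unch1.2//=.
  by rewrite /dot big1// => i _; rewrite mulr0.
have s1L : nreg s1 6 = 0%N by rewrite unch1.1.
have s1S : nreg s1 8 = 0%N by rewrite unch1.1.
apply: runs_seq (runs_parameters s1_in s1L s1S) _ => s2 unch2 s2_ready.
apply: runs_walk s2_ready _ _; first exact: tracks_unchanged unch2 isT isT s1_walk0.
by move=> j; rewrite unch2.2.
Qed.

Lemma step_halted coin t (s : state R) : iter t (step coin) ([::], s) = ([::], s).
Proof. by elim: t => //= t ->. Qed.

Lemma rounding_program_outputs coin y :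
  outputs rounding_program (Instance sigma A x0) coin y <-> y = walk_output.
Proof.
have [s [t [run_s _ <-]]] := runs_rounding_program; split; last first.
  by move=> ->; exists t, s; rewrite run_toss_free// /run run_s.
move=> [t' [s' [run_s' <-]]]; rewrite run_toss_free// /run in run_s'.
have := run_s [::]; have [tt'|/ltnW t't] := leqP t t'.
  by rewrite -(subnK tt') iterD run_s step_halted in run_s'; case: run_s' => ->.
by rewrite -(subnK t't) iterD run_s' step_halted => -[->].
Qed.

Lemma running_time_toss_free prog (I : instance R n m) coin : toss_free prog ->
  running_time prog I coin = running_time prog I (fun=> true).
Proof.
move=> toss_free_prog; rewrite /running_time; congr ereal_inf.
by apply/seteqP; split => _ [t /= halted <-]; exists t => //=; move: halted;
  rewrite !(run_toss_free (prog := prog))//.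
Qed.

Lemma running_time_le coin :
  (0 <= running_time rounding_program (Instance sigma A x0) coin <= time_bound%:R%:E)%E.
Proof.
rewrite running_time_toss_free//; apply/andP; split.
  by apply: le_ereal_inf_tmp => _ [t _ <-]; rewrite lee_fin.
have [s [t [run_s t_le _]]] := runs_rounding_program.
apply: (@le_trans _ _ t%:R%:E); last by rewrite lee_fin ler_nat.
by apply: ereal_inf_lbound; exists t => //=; rewrite /run run_s.
Qed.

End Correctness.
End Program.

(** * The theorem *)

Lemma frac_itv (R : realType) n (x0 : 'cV[R]_n) j : 0 <= frac x0 j <= 1.
Proof.
rewrite /frac subr_ge0 floor_le/= lerBlDl.
by apply: ltW; have := floorD1_gt (x0 j 0); rewrite intrD.
Qed.

Lemma mutually_independent_family d (T : measurableType d) (R : realType)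
    (P : probability T R) (I : finType) (J : eqType) (X : I -> {RV P >-> R})
    (F : I + J -> set (set T)) :
  (forall i, F (inl i) = sigma_of (X i)) -> mutually_independent P F ->
  independent_family X.
Proof.
move=> F_inl indF E mE.
pose preims (a : I + J) := if a is inl i then X i @^-1` E i else setT.
have := indF [seq inl i | i <- index_enum I] preims.
rewrite !big_map; apply; first by rewrite map_inj_uniq ?index_enum_uniq// => ? ? [].
by move=> _ /mapP[i _ ->]; rewrite F_inl; exists (E i) => //; rewrite setTI.
Qed.

Lemma rounding_program_discrepancy d (T : measurableType d) (R : realType)
    (P : probability T R) n m (sigma : R) (X : 'I_m * 'I_n -> {RV P >-> R})
    (x0 : 'cV[R]_n) (coin : T -> nat -> bool) :
  (0 < n)%N -> (2 * n <= m)%N -> (m <= 2 ^ n)%N -> 0 < sigma ->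
  independent_family X -> (forall ij, gaussian 0 sigma (X ij)) ->
  let good := [set w | exists x : 'cV[R]_n,
    outputs rounding_program (Instance sigma (\matrix_(i, j) X (i, j) w) x0) (coin w) x /\
    forall i : 'I_m,
      `|\sum_(j < n) X (i, j) w * (x j 0 - x0 j 0)| <= rounding_bound n m sigma] in
  measurable good /\ ((1 - 4 / m%:R ^+ 3)%:E <= P good)%E.
Proof.
move=> n_gt0 mn m_le sigma_gt0 indepX gaussX good.
have := walk_discrepancy sigma_gt0 indepX gaussX (frac_itv x0) n_gt0 mn
  (filter_uniq (fractional x0) (enum_uniq 'I_n)).
rewrite -/(fractional_cols x0) /=; set walk_good := (X in measurable X).
suff -> : good = walk_good by [].
pose A w : 'M[R]_(m, n) := \matrix_(i, j) X (i, j) w.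
have discE w i : \sum_(j < n) X (i, j) w * (walk_output sigma (A w) x0 j 0 - x0 j 0) =
    disc (walk_cols sigma (scale n m) (steering_range n m R) (frac x0) (entries X w)
      (walk0 R 'I_m (size (fractional_cols x0))) (fractional_cols x0)) i.
  have <- : column (A w) = entries X w.
    by apply/funext => j; apply/funext => k; rewrite /column mxE.
  by rewrite -walk_output_disc; apply: eq_bigr => j _; rewrite [A w i j]mxE.
apply/seteqP; split => w /=.
  by move=> [x [/rounding_program_outputs ->// good_w]] i; rewrite -discE.
move=> good_w; exists (walk_output sigma (A w) x0); split => [|i]; last by rewrite discE.
exact/rounding_program_outputs.
Qed.

Lemma rounding_program_time d (T : measurableType d) (R : realType)
    (P : probability T R) n m (sigma : R) (A : 'M[R]_(m, n)) (x0 : 'cV[R]_n)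
    (coin : T -> nat -> bool) :
  (0 < n)%N -> (m <= 2 ^ n)%N ->
  let time w := running_time rounding_program (Instance sigma A x0) (coin w) in
  measurable_fun setT time /\ (\int[P]_w time w <= (time_bound n m)%:R%:E)%E.
Proof.
move=> n_gt0 m_le time.
have -> : time = cst (running_time rounding_program (Instance sigma A x0) (fun=> true)).
  by apply/funext => w; exact: running_time_toss_free.
split; first exact: measurable_cst.
rewrite integral_cst//= probability_setT mule1.
by have /andP[] := running_time_le sigma A x0 n_gt0 m_le (fun=> true).
Qed.

(* The outer variable stands for n and the inner one for m. *)
Definition time_poly (R : realType) : {poly {poly R}} :=
  'X * (('X)%:P * 17%:R + 31%:R) + 'X * 'X * 2%:R + 'X * 11%:R + 59%:R.

Lemma time_polyE (R : realType) n m :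
  (time_poly R).[n%:R].[m%:R] = (time_bound n m)%:R.
Proof.
have horner_nat2 k (x : {poly R}) : (k%:R : {poly {poly R}}).[x] = k%:R.
  by rewrite hornerMn hornerC.
have horner_nat k (x : R) : (k%:R : {poly R}).[x] = k%:R by rewrite hornerMn hornerC.
rewrite /time_poly /time_bound.
do ! rewrite ?hornerD ?hornerM ?hornerX ?hornerC ?horner_nat2 ?horner_nat.
by rewrite !natrD !natrM !natrD !natrM.
Qed.

Theorem theorem2 (R : realType) :
  exists (prog : cmd) (q : {poly {poly R}}),
  forall (n m : nat) (sigma : R),
    (0 < n)%N -> (2 * n <= m)%N -> (m <= 2 ^ n)%N -> 0 < sigma ->
  [/\ forall (A : 'M[R]_(m, n)) (x0 x : 'cV[R]_n) (coin : nat -> bool),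
        outputs prog (Instance sigma A x0) coin x -> is_rounding x0 x,
      forall (d : measure_display) (T : measurableType d)
          (P : probability T R)
          (A : 'I_m -> 'I_n -> {RV P >-> R}) (coin : nat -> {RV P >-> bool}),
        (forall i j, gaussian 0 sigma (A i j)) ->
        (forall k, fair (coin k)) ->
        mutually_independent P
          (fun a : ('I_m * 'I_n) + nat =>
             match a with
             | inl ij => sigma_of (A ij.1 ij.2)
             | inr k => sigma_of (coin k)
             end) ->
        forall x0 : 'cV[R]_n,
        let good := [set w : T | exists x : 'cV[R]_n,
          outputs prog (Instance sigma (\matrix_(i, j) A i j w) x0)
            (fun k => coin k w) x /\
          forall i : 'I_m,
            `|\sum_(j < n) A i j w * (x j 0 - x0 j 0)|
              <= rounding_bound n m sigma] in
        measurable good /\ ((1 - 4 / m%:R ^+ 3)%:E <= P good)%E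
    & forall (d : measure_display) (T : measurableType d)
          (P : probability T R) (coin : nat -> {RV P >-> bool}),
        (forall k, fair (coin k)) ->
        mutually_independent P (fun k => sigma_of (coin k)) ->
        forall (A : 'M[R]_(m, n)) (x0 : 'cV[R]_n),
        let time := fun w : T =>
          running_time prog (Instance sigma A x0) (fun k => coin k w) in
        measurable_fun setT time /\
        (\int[P]_w time w <= (q.[n%:R].[m%:R])%:E)%E].
Proof.
exists rounding_program, (time_poly R) => n m sigma n_gt0 mn m_le sigma_gt0; split.
- by move=> A x0 x coin /rounding_program_outputs ->//; exact: walk_output_rounding.
- move=> d T P A coin gaussA _ indepA x0.
  apply: (rounding_program_discrepancy (X := fun ij => A ij.1 ij.2)) => //.
  exact: (mutually_independent_family (J := nat)) indepA.
- move=> d T P coin _ _ A x0; rewrite time_polyE.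
  exact: (rounding_program_time _ _ _ _ (fun w k => coin k w)).
Qed.
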